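(* Let $X$ be a rearrangement-invariant Banach function space over a $\sigma$-finite and resonant measure space $(\mathcal{R},\mu)$, and let $X'$ be its associate space. Assume that $X$ has absolutely continuous norm and that $X'$ has the (ACR) property. Let $\phi\colon\mathcal{R}\to\mathcal{R}$ be a measurable mapping for which there is some $A\in(0,\infty)$ such that for every $n\in\mathbb{N}$, $n\ge1$, $$A^{-1}\mu(E)\le\mu(\phi^{-n}(E))\le A\,\mu(E)\quad\text{for every measurable }E\subseteq\mathcal{R}.$$ Then the composition operator $T_\phi f=f\circ\phi$ is pointwise ergodic on $X$, i.e. for every $f\in X$ $$\frac1n\sum_{i=0}^{n-1}T_\phi^i f\to Tf\quad\mu\text{-a.e. as }n\to\infty,$$ where $T\colon X\to X$ is the continuous linear mean ergodic limit operator of $T_\phi$ (see context). If (all other assumptions being kept) $X$ does not have absolutely continuous norm but has the (ACR) property, then the same $\mu$-a.e. convergence holds for those $f\in X$ that have absolutely continuous norm in $X$.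
   Context: $\mathbb{N}$ contains $0$. $\mathcal{M}=\mathcal{M}(\mathcal{R},\mu)$ is the set of extended complex-valued $\mu$-measurable functions on $\mathcal{R}$ (identified when equal $\mu$-a.e.), $\mathcal{M}_+$ the non-negative ones; $\lambda$ is Lebesgue measure. For $f\in\mathcal{M}$ put $f_*(s)=\mu(\{|f|>s\})$ and $f^*(t)=\inf\{s\ge0:\ f_*(s)\le t\}$, $s,t\in[0,\infty)$. A $\sigma$-finite $(\mathcal{R},\mu)$ is resonant if $\sup_{\tilde g\in\mathcal{M},\,\tilde g^*=g^*}\int_{\mathcal{R}}|f\tilde g|\,d\mu=\int_0^\infty f^*g^*\,d\lambda$ for all $f,g\in\mathcal{M}$ (equivalently, it is non-atomic, or completely atomic with all atoms of equal measure). A Banach function norm is a map $\lVert\cdot\rVert\colon\mathcal{M}\to[0,\infty]$ with $\lVert\,|f|\,\rVert=\lVert f\rVert$ whose restriction to $\mathcal{M}_+$ satisfies: (P1) it is absolutely homogeneous, vanishes exactly at $f=0$ a.e., and is subadditive; (P2) $f\le g$ a.e. implies $\lVert f\rVert\le\lVert g\rVert$; (P3) $f_n\uparrow f$ a.e. implies $\lVert f_n\rVert\uparrow\lVert f\rVert$; (P4) $\lVert\chi_E\rVert<\infty$ if $\mu(E)<\infty$; (P5) if $\mu(E)<\infty$ there is a finite $C_E$ with $\int_E f\,d\mu\le C_E\lVert f\rVert$ for all $f\in\mathcal{M}_+$. It is rearrangement-invariant (r.i.) if $f^*=g^*$ implies $\lVert f\rVert=\lVert g\rVert$. The corresponding space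 is $X=\{f\in\mathcal{M}:\lVert f\rVert_X<\infty\}$. The associate space $X'$ is defined by the same recipe from $\lVert f\rVert_{X'}=\sup_{\lVert g\rVert_X\le1}\int_{\mathcal{R}}|fg|\,d\mu$. A function $f\in X$ has absolutely continuous norm if $\lVert f\chi_{E_k}\rVert_X\to0$ for every sequence of measurable sets with $\chi_{E_k}\to0$ $\mu$-a.e.; $X$ has absolutely continuous norm if every $f\in X$ does. An r.i. space $Y$ has the (ACR) property if $\lim_{t\to\infty}f^*(t)=0$ for every $f\in Y$. $\phi^n$ is the $n$-fold composition and $\phi^{-n}(E)$ the preimage of $E$ under $\phi^n$. The operator $T$: if $X$ has absolutely continuous norm, $Tf$ is the $\lVert\cdot\rVert_X$-limit of $\frac1n\sum_{i=0}^{n-1}T_\phi^i f$. If $X$ only has the (ACR) property, $Tf$ is the limit of $\frac1n\sum_{i=0}^{n-1}T_\phi^i f$ in the locally convex topology $\xi$ on $X$ induced by the norms $|f|_\varphi=\int_0^\infty\varphi^*f^*\,d\lambda$, $\varphi\in X'$. Under the stated hypotheses these limits exist for all $f\in X$ and define a continuous linear operator on $X$. *)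

(* Defs.v *)
From HB Require Import structures.
From mathcomp Require Import all_boot all_order all_algebra.
From mathcomp Require Import all_classical all_reals all_analysis.
From mathcomp Require Import measurable_realfun complex.
Set Implicit Arguments.
Unset Strict Implicit.
Unset Printing Implicit Defensive.
Import Order.TTheory GRing.Theory Num.Theory.
Import numFieldNormedType.Exports.
Local Open Scope classical_set_scope.
Local Open Scope ring_scope.

(* Almost-everywhere equality is kept explicit instead of forming quotients.
   The cone M_+ consists of extended-real functions; rearrangements, function
   norms and associate norms see a function only through its modulus, which
   lies in M_+, so they are defined on M_+.  A function of finite norm is finite
   almost everywhere, so elements of a function space are represented by
   complex-valued functions without infinite values. *)

Definition cmeasurable (R : realType) d (S : measurableType d)
    (f : S -> R[i]) : Prop :=
  measurable_fun setT (fun x => complex.Re (f x)) /\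
  measurable_fun setT (fun x => complex.Im (f x)).

Definition cmod (R : realType) (S : Type) (f : S -> R[i]) : S -> \bar R :=
  fun x => (complex.Re `|f x|)%:E.

Definition Mplus (R : realType) d (S : measurableType d) :
    set (S -> \bar R) :=
  [set f : S -> \bar R | measurable_fun setT f /\ forall x, (0 <= f x)%E].

Section rearrangement.
Context (R : realType) d (S : measurableType d) (mu : {measure set S -> \bar R}).
Local Open Scope ereal_scope.

Definition distr (f : S -> \bar R) (s : R) : \bar R :=
  mu [set x | s%:E < `|f x|].

(* Meaningful for 0 <= t only; the infimum of the empty set is +oo. *)
Definition rearr (f : S -> \bar R) (t : R) : \bar R :=
  ereal_inf [set s%:E | s in [set s : R | (0 <= s)%R /\ distr f s <= t%:E]].

Definition same_rearr (f g : S -> \bar R) : Prop :=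
  forall t : R, (0 <= t)%R -> rearr f t = rearr g t.

Definition rearr_pairing (f g : S -> \bar R) : \bar R :=
  \int[lebesgue_measure]_(t in `[0%R, +oo[) (rearr f t * rearr g t).

Definition resonant : Prop :=
  forall f g, Mplus f -> Mplus g ->
    ereal_sup [set \int[mu]_x (f x * h x) | h in
                 [set h | Mplus h /\ same_rearr h g]] =
    rearr_pairing f g.

End rearrangement.

Section function_norms.
Context (R : realType) d (S : measurableType d) (mu : {measure set S -> \bar R}).
Implicit Types rho : (S -> \bar R) -> \bar R.
Local Open Scope ereal_scope.

(* [rho] is the restriction to M_+ of the norm; its values outside M_+ are
   irrelevant, and the norm of a complex function [f] is [rho (cmod f)]. *)
Record banach_function_norm rho : Prop := BanachFunctionNorm {
  bfn_ge0 : forall f, Mplus f -> 0 <= rho f ;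
  bfn_homogeneous : forall (a : R) f, (0 <= a)%R -> Mplus f ->
    rho (fun x => a%:E * f x) = a%:E * rho f ;
  bfn_eq0 : forall f, Mplus f ->
    rho f = 0 <-> {ae mu, forall x, f x = 0} ;
  bfn_subadditive : forall f g, Mplus f -> Mplus g ->
    rho (fun x => f x + g x) <= rho f + rho g ;
  bfn_lattice : forall f g, Mplus f -> Mplus g ->
    {ae mu, forall x, f x <= g x} -> rho f <= rho g ;
  bfn_fatou : forall (f_ : nat -> S -> \bar R) f,
    (forall n, Mplus (f_ n)) -> Mplus f ->
    {ae mu, forall x, nondecreasing_seq (fun n => f_ n x) /\
                      f_ n x @[n --> \oo] --> f x} ->
    nondecreasing_seq (fun n => rho (f_ n)) /\
    rho (f_ n) @[n --> \oo] --> rho f ;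
  bfn_indic : forall E, measurable E -> mu E < +oo ->
    rho (fun x => (\1_E x)%:E) < +oo ;
  bfn_local_integral : forall E, measurable E -> mu E < +oo ->
    exists C : R, forall f, Mplus f ->
      \int[mu]_(x in E) f x <= C%:E * rho f }.

Definition rearrangement_invariant rho : Prop :=
  forall f g, Mplus f -> Mplus g -> same_rearr mu f g -> rho f = rho g.

Definition associate rho : (S -> \bar R) -> \bar R := fun f =>
  ereal_sup [set \int[mu]_x (f x * g x) | g in
               [set g | Mplus g /\ rho g <= 1]].

Definition cnorm rho (f : S -> R[i]) : \bar R := rho (cmod f).

Definition bfspace rho : set (S -> R[i]) :=
  [set f | cmeasurable f /\ cnorm rho f < +oo].

Definition ac_norm rho (f : S -> R[i]) : Prop :=
  forall E : nat -> set S, (forall k, measurable (E k)) ->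
    {ae mu, forall x, (\1_(E k) x : R) @[k --> \oo] --> (0 : R)%R} ->
    rho (fun x => cmod f x * (\1_(E k) x)%:E) @[k --> \oo] --> 0.

Definition ac_norm_space rho : Prop :=
  forall f, bfspace rho f -> ac_norm rho f.

Definition ACR rho : Prop :=
  forall f, bfspace rho f ->
    rearr mu (cmod f) t @[t --> +oo%R] --> 0.

(* Families of seminorms inducing the norm topology and the topology xi. *)
Definition norm_topology rho : set ((S -> R[i]) -> \bar R) := [set cnorm rho].

Definition xi_topology rho : set ((S -> R[i]) -> \bar R) :=
  [set (fun f => rearr_pairing mu (cmod psi) (cmod f)) |
    psi in bfspace (associate rho)].

End function_norms.

Section ergodic.
Context (R : realType) d (S : measurableType d) (mu : {measure set S -> \bar R}).
Implicit Types (rho : (S -> \bar R) -> \bar R) (P : set ((S -> R[i]) -> \bar R))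
  (X : set (S -> R[i])) (T : (S -> R[i]) -> (S -> R[i])).

Definition cvg_for P (u : nat -> S -> R[i]) (l : S -> R[i]) : Prop :=
  forall p, P p -> p (u n \- l) @[n --> \oo] --> 0%E.

(* Continuity of [T : X -> X] for the topology induced by the seminorms in
   [P]: basic neighbourhoods are given by finitely many of them. *)
Definition continuous_for P X T : Prop :=
  forall f, X f -> forall p, P p -> forall e : R, 0 < e ->
    exists Q, [/\ finite_set Q, Q `<=` P &
      exists2 delta : R, 0 < delta & forall g, X g ->
        (forall q, Q q -> (q (g \- f)%R < delta%:E)%E) ->
        (p (T g \- T f)%R < e%:E)%E].

Definition linear_on X T : Prop :=
  forall (a : R[i]) f g, X f -> X g ->
    {ae mu, forall x, T (fun y => a * f y + g y) x = a * T f x + T g x}.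

Definition composition_operator (phi : S -> S) (f : S -> R[i]) : S -> R[i] :=
  f \o phi.

Definition ergodic_mean (phi : S -> S) (n : nat) (f : S -> R[i]) : S -> R[i] :=
  fun x => n%:R^-1 * \sum_(i < n) iter i (composition_operator phi) f x.

(* [T] is the mean ergodic limit operator on the function space of [rho], the
   limits being taken in the topology induced by [P].  It is continuous both for
   the norm and for that topology, and unique up to almost-everywhere equality,
   since the seminorms used separate points. *)
Definition mean_ergodic_limit rho P (phi : S -> S) T : Prop :=
  let X := bfspace rho in
  [/\ forall f, X f -> X (T f),
      linear_on X T,
      continuous_for (norm_topology rho) X T,
      continuous_for P X T &
      forall f, X f -> cvg_for P (fun n => ergodic_mean phi n f) (T f)].

Definition ergodic_means_cvg_ae (phi : S -> S) (f Tf : S -> R[i]) : Prop :=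
  {ae mu, forall x, (fun n => ergodic_mean phi n f x : R[i]^o) @ \oo -->
                    (Tf x : R[i]^o)}.

End ergodic.

(* Main.v *)
Require Import Defs.
From mathcomp Require Import all_boot all_order all_algebra.
From mathcomp Require Import all_classical all_reals all_analysis.
From mathcomp Require Import measurable_realfun complex.
From mathcomp Require Import ring lra.
Set Implicit Arguments.
Unset Strict Implicit.
Unset Printing Implicit Defensive.
Import Order.TTheory GRing.Theory Num.Theory.
Import numFieldNormedType.Exports.
Local Open Scope classical_set_scope.
Local Open Scope ring_scope.

(** Why the theorem holds.

The norm of an r.i. space and the seminorms of the topology xi are gauges: a
gauge sends [u] to the supremum of the integrals of [u * h] over a family of
weights [h] closed under equimeasurability.  For the norm the family is the unit
ball of the associate norm, which is the Lorentz-Luxemburg theorem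
([norm_le_gauge_dual_ball], a separation argument in L2 of a set of finite
measure); for the seminorm of [psi] it consists of the functions equimeasurable
with [psi].  Resonance turns the integrals into pairings of rearrangements
([gauge_pairing_ge], [gauge_pairing_ub]).  The bounds on [phi] dilate
rearrangements by at most a factor [A], so every iterate of the composition
operator, hence every ergodic mean, is bounded by [A] in every gauge
([gauge_iter], [gauge_average]), and by Fatou's lemma so is any pointwise limit
of the means ([gauge_limit]).  Both parts of the theorem are thus one statement
about gauges.

The pointwise limit exists although [phi] need not preserve the measure.  If
every orbit sees a non-negative sum of [g] at some time, then the orbits can be
tiled by blocks with non-negative sums ([tiling]); since integrals along orbits
are controlled up to [A], this yields a maximal inequality
([ergodic_maximal_inequality]) and a lower bound, up to a sublinear error, for
the integrals of the ergodic sums ([sublinear_lower_bound]).  The set where the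
averages of a summable function oscillate across an interval is invariant, and
the lower bound, applied to both sides of the interval, shows that it is null
([invariant_oscillation_null]).  So the averages of summable functions converge
almost everywhere ([summable_averages_cvg]), and the same follows for locally
summable functions that exceed each positive level on a set of finite measure
only ([tame_averages_cvg]).  All functions of the space are of this kind: by the
(ACR) property, or because functions of absolutely continuous norm in an r.i.
space cannot exceed a positive level on a set of infinite measure
([ac_vanishing]).  Hence the limit operator may be defined pointwise, and it is
linear and continuous by the estimate on limits.

It remains to see that the means converge to the pointwise limit in the gauge
([gauge_cvg_tame]).  For a bounded summable function the differences are of two
kinds: on a set of finite measure, given by the maximal inequality, they are
bounded and tend to zero, so absolute continuity of the gauge applies to them;
elsewhere they are uniformly small with bounded integrals, and such thinly
spread functions are small in the gauge because the weights have uniformly small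
tails ([gauge_spread]).  These tails are where the (ACR) property of the
associate space enters ([dual_ball_uniform_tails],
[equimeasurable_uniform_tails]).  A general function is reduced to a bounded
summable one by cutting off its very large and very small values, which is
harmless where it has absolutely continuous gauge: for the norm this is the
hypothesis, for the seminorms of xi it follows from dominated convergence on
the half-line ([equimeasurable_gauge_ac]). *)

(** * Rearrangements *)

Section rearrangement_lemmas.
Context (R : realType) d (S : measurableType d) (mu : {measure set S -> \bar R}).
Local Open Scope ereal_scope.
Implicit Types (f g h u : S -> \bar R).

Lemma measurable_super f s : measurable_fun setT f ->
  measurable [set x | s%:E < `|f x|].
Proof.
move=> mf; rewrite -[X in measurable X]setTI.
by apply: emeasurable_fun_o_infty => //; exact: measurableT_comp.
Qed.

Lemma distrE f s : Mplus f -> distr mu f s = mu [set x | s%:E < f x].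
Proof.
by move=> Mf; rewrite /distr; congr (mu _); apply/seteqP; split => x /=;
  rewrite gee0_abs //; case: Mf.
Qed.

Lemma rearr_le f (t s : R) : (0 <= s)%R -> distr mu f s <= t%:E ->
  rearr mu f t <= s%:E.
Proof. by move=> s0 fs; apply: ereal_inf_lbound; exists s. Qed.

Lemma rearr_ge0 f t : 0 <= rearr mu f t.
Proof. by apply: le_ereal_inf_tmp => _ [s [s0 _] <-]; rewrite lee_fin. Qed.

Lemma le_rearr f g (t t' : R) :
  (forall s : R, (0 <= s)%R -> distr mu g s <= t'%:E -> distr mu f s <= t%:E) ->
  rearr mu f t <= rearr mu g t'.
Proof.
move=> fg; apply: le_ereal_inf_tmp => _ [s [s0 gs] <-].
by apply: rearr_le => //; exact: fg.
Qed.

Lemma rearr_nonincreasing f : {homo rearr mu f : t t' / (t <= t')%R >-> t' <= t}.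
Proof.
by move=> t t' tt'; apply: le_rearr => s s0 /le_trans; apply; rewrite lee_fin.
Qed.

Lemma le_distr f g s : measurable_fun setT f -> measurable_fun setT g ->
  (forall x, `|f x| <= `|g x|) -> distr mu f s <= distr mu g s.
Proof.
move=> mf mg fg; apply: le_measure; rewrite ?inE; try exact: measurable_super.
by move=> x /= /lt_le_trans; exact.
Qed.

Lemma rearr_mono f g t : Mplus f -> Mplus g -> (forall x, f x <= g x) ->
  rearr mu f t <= rearr mu g t.
Proof.
move=> [mf f0] [mg g0] fg; apply: le_rearr => s s0; apply: le_trans.
by apply: le_distr => // x; rewrite !gee0_abs.
Qed.

Lemma measurable_rearr f (D : set R) : measurable D ->
  measurable_fun D (rearr mu f).
Proof.
move=> mD; apply: (measurable_funS measurableT) => //.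
apply: (measurability _ (ErealGenOInfty.measurableE R)) => _ [_ [x ->] <-].
rewrite setTI; apply: is_interval_measurable => a b /= fa fb c /andP[ac cb].
move: fb; rewrite /= !in_itv/= !andbT => /lt_le_trans; apply.
exact: rearr_nonincreasing.
Qed.

(** The infimum defining the rearrangement is attained, because the
distribution function is continuous from the right. *)
Lemma distr_rearr f (s t : R) : (0 <= s)%R -> Mplus f ->
  rearr mu f t <= s%:E -> distr mu f s <= t%:E.
Proof.
move=> s0 Mf fs; rewrite distrE//.
pose F n := [set x | (s + n.+1%:R^-1)%:E < f x].
have mF n : measurable (F n).
  rewrite -[F n]setTI; apply: emeasurable_fun_o_infty => //; exact: Mf.1.
have FU : \bigcup_n F n = [set x | s%:E < f x].
  apply/seteqP; split => [x [n _] /=|x /= sf].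
    by apply: le_lt_trans; rewrite lee_fin lerDl.
  case fx : (f x) sf => [r| |]//; last first.
    by exists 0%N => //=; rewrite /F/= fx ltry.
  by rewrite lte_fin => /ltr_add_invr[k sk]; exists k => //=; rewrite /F/= fx lte_fin.
have Ft n : mu (F n) <= t%:E.
  have : rearr mu f t < (s + n.+1%:R^-1)%:E.
    by rewrite (le_lt_trans fs)// lte_fin ltrDl.
  move=> /ereal_inf_lt[_ [s' [s'0 fs'] <-]]; rewrite lte_fin => s's.
  apply: le_trans fs'; rewrite distrE//; apply: le_measure; rewrite ?inE//.
    rewrite -[X in measurable X]setTI.
    by apply: emeasurable_fun_o_infty => //; exact: Mf.1.
  by move=> x /=; apply: le_lt_trans; rewrite lee_fin ltW.
have := @nondecreasing_cvg_mu _ _ _ mu F mF.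
rewrite FU => /(_ _ _)/cvg_lim <-//.
- apply: lime_le; last exact: nearW.
  apply: ereal_nondecreasing_is_cvgn => m n mn; apply: le_measure; rewrite ?inE//.
  by move=> x /=; apply: le_lt_trans; rewrite lee_fin lerD2l lef_pV2 ?posrE ?ltr0n// ler_nat.
- by rewrite -FU; exact: bigcupT_measurable.
- move=> m n mn; apply/subsetPset => x /=; apply: le_lt_trans.
  by rewrite lee_fin lerD2l lef_pV2 ?posrE ?ltr0n// ler_nat.
Qed.

End rearrangement_lemmas.

(** * The cone of non-negative measurable functions *)

Section cone.
Context (R : realType) d (S : measurableType d) (mu : {measure set S -> \bar R}).
Local Open Scope ereal_scope.
Implicit Types (f g h u : S -> \bar R).

Definition absE (r : S -> R) : S -> \bar R := fun x => `|r x|%:E.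

Lemma Mplus_absE (r : S -> R) : measurable_fun setT r -> Mplus (absE r).
Proof.
move=> mr; split => [|x]; last by rewrite lee_fin.
by apply/measurable_EFinP; exact: measurableT_comp.
Qed.

Lemma Mplus_comp f (phi : S -> S) : measurable_fun setT phi ->
  Mplus f -> Mplus (f \o phi).
Proof.
by move=> mphi [mf f0]; split => [|x]; [exact: measurableT_comp|exact: f0].
Qed.

Lemma MplusD f g : Mplus f -> Mplus g -> Mplus (fun x => f x + g x).
Proof.
move=> [mf f0] [mg g0]; split => [|x]; first exact: emeasurable_funD.
exact: adde_ge0.
Qed.

Lemma MplusM f g : Mplus f -> Mplus g -> Mplus (fun x => f x * g x).
Proof.
move=> [mf f0] [mg g0]; split => [|x]; first exact: emeasurable_funM.
exact: mule_ge0.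
Qed.

Lemma Mplus_cst (a : \bar R) : 0 <= a -> Mplus (fun _ : S => a).
Proof. by move=> a0; split. Qed.

Lemma MplusZ (a : R) f : (0 <= a)%R -> Mplus f -> Mplus (fun x => a%:E * f x).
Proof. by move=> a0 Mf; apply: MplusM => //; exact: Mplus_cst. Qed.

Lemma Mplus_indic (E : set S) : measurable E -> Mplus (fun x => (\1_E x : R)%:E).
Proof.
move=> mE; split => [|x]; last by rewrite lee_fin.
by apply/measurable_EFinP.
Qed.

Lemma Mplus_min f g : Mplus f -> Mplus g -> Mplus (fun x => mine (f x) (g x)).
Proof.
move=> [mf f0] [mg g0]; split => [|x]; first exact: measurable_mine.
by rewrite le_min f0 g0.
Qed.

Lemma Mplus_sum (I : Type) (s : seq I) (F : I -> S -> \bar R) :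
  (forall i, Mplus (F i)) -> Mplus (fun x => \sum_(i <- s) F i x).
Proof.
move=> MF; split => [|x]; last by apply: sume_ge0 => i _; exact: (MF i).2.
by apply: emeasurable_sum => i; exact: (MF i).1.
Qed.

Lemma measurable_gte f (a : \bar R) : Mplus f -> measurable [set x | a < f x].
Proof.
move=> [mf _]; rewrite -[X in measurable X]setTI.
exact: emeasurable_fun_o_infty.
Qed.

Lemma le_int_ae f g : Mplus f -> Mplus g -> {ae mu, forall x, f x <= g x} ->
  \int[mu]_x f x <= \int[mu]_x g x.
Proof.
move=> [mf f0] [mg g0] fg; apply: ae_ge0_le_integral => //.
by apply: filterS fg => x.
Qed.

Lemma le_int f g : Mplus f -> Mplus g -> (forall x, f x <= g x) ->
  \int[mu]_x f x <= \int[mu]_x g x.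
Proof. by move=> Mf Mg fg; apply: le_int_ae => //; exact: aeW. Qed.

Lemma intD f g : Mplus f -> Mplus g ->
  \int[mu]_x (f x + g x) = \int[mu]_x f x + \int[mu]_x g x.
Proof. by move=> [mf f0] [mg g0]; rewrite ge0_integralD. Qed.

Lemma intZ (a : R) f : (0 <= a)%R -> Mplus f ->
  \int[mu]_x (a%:E * f x) = a%:E * \int[mu]_x f x.
Proof. by move=> a0 [mf f0]; rewrite ge0_integralZl. Qed.

Lemma int_ge0 f : Mplus f -> 0 <= \int[mu]_x f x.
Proof. by move=> [_ f0]; exact: integral_ge0. Qed.

Lemma int_indic (E : set S) : measurable E ->
  \int[mu]_x (\1_E x : R)%:E = mu E.
Proof. by move=> mE; rewrite integral_indic// setIT. Qed.

Lemma cvge_ub (u : nat -> \bar R) (l b : \bar R) :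
  u n @[n --> \oo] --> l -> (forall n, u n <= b) -> l <= b.
Proof.
move=> ul ub; rewrite -(cvg_lim _ ul)//; apply: lime_le; last exact: nearW.
by apply/cvg_ex; exists l.
Qed.

End cone.

(** * Resonance *)

Section dilation.
Context (R : realType).
Local Open Scope ereal_scope.

(** Lebesgue measure is [a^-1] times its image under division by [a]. *)
Lemma integral_dilation (a : R) (F : R -> \bar R) : (0 < a)%R ->
  measurable_fun setT F -> (forall t, 0 <= F t) ->
  \int[lebesgue_measure]_(t in `[0%R, +oo[) F (t / a)%R =
  a%:E * \int[lebesgue_measure]_(t in `[0%R, +oo[) F t.
Proof.
move=> a0 mF F0.
pose phi (t : measurableTypeR R) : measurableTypeR R := (t / a)%R.
have mphi : measurable_fun setT phi by exact: mulrr_measurable.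
have ai0 : (0 < a^-1)%R by rewrite invr_gt0.
pose k := NngNum (ltW ai0).
have pE (A : set (measurableTypeR R)) : measurable A ->
    lebesgue_measure A =
    mscale k (pushforward (@lebesgue_measure R) phi) A.
  apply: lebesgue_measure_unique => //= _ [[x y]] _ <-.
  have -> : mscale k (pushforward lebesgue_measure phi) `]x, y]%classic =
      a^-1%:E * lebesgue_measure `](x * a)%R, (y * a)%R]%classic.
    have <- : phi @^-1` `]x, y]%classic = `](x * a)%R, (y * a)%R]%classic.
      by apply/seteqP; split => t /=;
        rewrite /phi !in_itv/= ltr_pdivlMr// ler_pdivrMr//.
    by [].
  rewrite !lebesgue_measure_itv/= !lte_fin ltr_pM2r//; case: ifPn => xy.
    by rewrite -!EFinD -EFinM -mulrBl mulrCA mulVf ?mulr1// gt_eqF.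
  by rewrite mule0.
have i0 : phi @^-1` `[0%R, +oo[%classic = `[0%R, +oo[%classic.
  by apply/seteqP; split => t /=; rewrite /phi !in_itv/= !andbT pmulr_lge0.
have mFD : measurable_fun (`[0%R, +oo[ : set (measurableTypeR R)) F.
  exact: measurable_funTS.
rewrite [in RHS](@eq_measure_integral _ _ _ _ (mscale k (pushforward (@lebesgue_measure R) phi))); last first.
  by move=> A mA _; exact: pE.
rewrite ge0_integral_mscale//= ge0_integral_pushforward//= i0.
by rewrite muleA -EFinM mulfV ?mul1e// gt_eqF.
Qed.

End dilation.

Section resonance.
Context (R : realType) d (S : measurableType d) (mu : {measure set S -> \bar R}).
Local Open Scope ereal_scope.
Implicit Types (f g h u : S -> \bar R) (H : set (S -> \bar R)).

Lemma rearr_pairingC f g : rearr_pairing mu f g = rearr_pairing mu g f.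
Proof. by apply: eq_integral => t _; rewrite muleC. Qed.

Lemma rearr_le_cst u (c t : R) : (0 <= c)%R -> (0 <= t)%R -> Mplus u ->
  (forall x, u x <= c%:E) -> rearr mu u t <= c%:E.
Proof.
move=> c0 t0 Mu uc; apply: rearr_le => //; rewrite distrE//.
rewrite (_ : [set x | _] = set0) ?measure0 ?lee_fin//.
by apply/seteqP; split => x //=; rewrite ltNge uc.
Qed.

Lemma rearr_eq0 u (F : set S) (t : R) : measurable F -> Mplus u ->
  (forall x, ~ F x -> u x = 0) -> mu F <= t%:E -> rearr mu u t = 0.
Proof.
move=> mF Mu uF Ft; apply/eqP; rewrite eq_le rearr_ge0 andbT.
apply: rearr_le => //; apply: le_trans Ft; rewrite distrE//.
apply: le_measure; rewrite ?inE//; first exact: measurable_gte.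
by move=> x /=; apply: contraPP => /uF ->; rewrite ltxx.
Qed.

Lemma rearr_indic_ge1 (F : set S) (t : R) : measurable F -> t%:E < mu F ->
  1 <= rearr mu (fun x => (\1_F x)%:E) t.
Proof.
move=> mF tF; apply: le_ereal_inf_tmp => _ [s [s0 fs] <-].
rewrite lee_fin leNgt; apply/negP => s1.
move: fs; apply/negP; rewrite -ltNge; apply: (lt_le_trans tF).
rewrite distrE; last exact: Mplus_indic.
apply: le_measure; rewrite ?inE//; first exact/measurable_gte/Mplus_indic.
by move=> x Fx /=; rewrite indicE mem_set// lte_fin.
Qed.

Lemma rearr_indic_le1 (F : set S) (t : R) : measurable F -> (0 <= t)%R ->
  rearr mu (fun x => (\1_F x)%:E) t <= 1.
Proof.
move=> mF t0; apply: rearr_le_cst => //; first exact: Mplus_indic.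
by move=> x; rewrite indicE lee_fin; case: (_ \in _).
Qed.

(** Comparing distribution functions up to a factor costs the same factor in
the pairing: the hypothesis dilates the rearrangement of [f], and the dilation
may be transferred to that of [h], which is monotone. *)
Lemma pairing_dilation (A : R) f g h : (1 <= A)%R ->
  (forall s : R, (0 <= s)%R -> distr mu f s <= A%:E * distr mu g s) ->
  rearr_pairing mu f h <= A%:E * rearr_pairing mu g h.
Proof.
move=> A1 fg; have A0 : (0 < A)%R by exact: lt_le_trans A1.
have <- := @integral_dilation R A (fun t => rearr mu g t * rearr mu h t) A0; last 2 first.
- by apply: emeasurable_funM; exact: measurable_rearr.
- by move=> t; apply: mule_ge0; exact: rearr_ge0.
have mdil : measurable_fun setT (fun t : R => t / A)%R by exact: mulrr_measurable.
apply: ge0_le_integral => //.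
- by move=> t _; apply: mule_ge0; exact: rearr_ge0.
- by apply: emeasurable_funM; exact: measurable_rearr.
- apply: measurable_funTS; apply: emeasurable_funM;
    by apply: (measurableT_comp _ mdil); exact: measurable_rearr.
move=> t /=; rewrite in_itv/= andbT => t0; apply: lee_pmul; rewrite ?rearr_ge0//.
- apply: le_rearr => s s0 gs; apply: (le_trans (fg s s0)).
  by rewrite -lee_pdivlMl// -EFinM mulrC.
- by apply: rearr_nonincreasing; rewrite ler_pdivrMr// ler_peMr.
Qed.

Context (res : resonant mu).

(** The Hardy-Littlewood inequality, which is the easy half of resonance. *)
Lemma int_le_pairing f h : Mplus f -> Mplus h ->
  \int[mu]_x (f x * h x) <= rearr_pairing mu f h.
Proof.
move=> Mf Mh; rewrite -res//; apply: ereal_sup_ubound; exists h => //.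
Qed.

Lemma pairing_ub f h (b : \bar R) : Mplus f -> Mplus h ->
  (forall h', Mplus h' -> same_rearr mu h' h -> \int[mu]_x (f x * h' x) <= b) ->
  rearr_pairing mu f h <= b.
Proof.
by move=> Mf Mh fb; rewrite -res//; apply: ge_ereal_sup => _ [h' [? ?] <-]; exact: fb.
Qed.

Lemma rearr_pairing_one u : Mplus u ->
  rearr_pairing mu u (fun x => (\1_setT x)%:E) =
  \int[lebesgue_measure]_(t in `[0%R, +oo[) rearr mu u t.
Proof.
move=> Mu; apply: eq_integral => t; rewrite inE/= in_itv/= andbT => t0.
have [tS|St] := ltP t%:E (mu setT).
  suff -> : rearr mu (fun x : S => (\1_setT x : R)%:E) t = 1 by rewrite mule1.
  by apply/le_anti/andP; split; [exact: rearr_indic_le1|exact: rearr_indic_ge1].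
by rewrite (rearr_eq0 measurableT Mu _ St) ?mul0e// => x /(_ I).
Qed.

(** Resonance applied to the constant function one, all of whose equimeasurable
copies are bounded by one. *)
Lemma integral_rearr u : Mplus u ->
  \int[lebesgue_measure]_(t in `[0%R, +oo[) rearr mu u t = \int[mu]_x u x.
Proof.
move=> Mu; have M1 := @Mplus_indic R _ S setT measurableT.
rewrite -rearr_pairing_one//; apply/eqP; rewrite eq_le; apply/andP; split.
  apply: pairing_ub => // h Mh h1; apply: le_int_ae => //; first exact: MplusM.
  have h0 : distr mu h 1%R <= 0.
    by apply: distr_rearr => //; rewrite h1//; exact: rearr_indic_le1.
  exists [set x | 1 < h x]; split; first exact: measurable_gte.
    by apply/eqP; rewrite eq_le measure_ge0 andbT -distrE.
  move=> x /= ; apply: contra_notP => /negP; rewrite -leNgt => hx.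
  by rewrite -[leRHS]mule1; apply: lee_wpmul2l => //; exact: Mu.2.
apply: le_trans (int_le_pairing Mu M1).
apply: le_int => //; first exact: MplusM.
by move=> x; rewrite indicE in_setT mule1.
Qed.

End resonance.

(** * Gauges: suprema of integrals against a family of weights *)

Section gauge.
Context (R : realType) d (S : measurableType d) (mu : {measure set S -> \bar R}).
Local Open Scope ereal_scope.
Implicit Types (f g h u v : S -> \bar R) (H : set (S -> \bar R)).

(** The function norm and the seminorms defining the topology xi are all of this
form, with a family of weights that is closed under equimeasurability; the
convergence of ergodic means is proved once for all of them. *)
Definition gauge H u : \bar R :=
  ereal_sup [set \int[mu]_x (u x * h x) | h in H].

(** Closure under equimeasurability is what makes a gauge depend on the
rearrangement of its argument only, through resonance. *)
Record rearr_stable H : Prop := RearrStable {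
  stable_neq0 : H !=set0 ;
  stable_Mplus : H `<=` @Mplus R d S ;
  stable_same_rearr : forall h h', H h -> Mplus h' -> same_rearr mu h' h -> H h' }.

Lemma gauge_ge H h u : H h -> \int[mu]_x (u x * h x) <= gauge H u.
Proof. by move=> Hh; apply: ereal_sup_ubound; exists h. Qed.

Lemma gauge_ub H u (b : \bar R) :
  (forall h, H h -> \int[mu]_x (u x * h x) <= b) -> gauge H u <= b.
Proof. by move=> ub; apply: ge_ereal_sup => _ [h Hh <-]; exact: ub. Qed.

Context (H : set (S -> \bar R)) (sH : rearr_stable H).

Lemma gauge_ge0 u : Mplus u -> 0 <= gauge H u.
Proof.
move=> Mu; have [h Hh] := stable_neq0 sH; apply: le_trans (gauge_ge u Hh).
by apply: int_ge0; apply: MplusM => //; exact: stable_Mplus Hh.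
Qed.

Lemma gauge_mono u v : Mplus u -> Mplus v -> {ae mu, forall x, u x <= v x} ->
  gauge H u <= gauge H v.
Proof.
move=> Mu Mv uv; apply: gauge_ub => h Hh; apply: le_trans (gauge_ge v Hh).
have Mh := stable_Mplus sH Hh; apply: le_int_ae; try exact: MplusM.
by apply: filterS uv => x uv; apply: lee_wpmul2r => //; exact: Mh.2.
Qed.

Lemma gaugeD u v : Mplus u -> Mplus v ->
  gauge H (fun x => u x + v x) <= gauge H u + gauge H v.
Proof.
move=> Mu Mv; apply: gauge_ub => h Hh; have Mh := stable_Mplus sH Hh.
apply: le_trans (leeD (gauge_ge u Hh) (gauge_ge v Hh)).
rewrite -intD; try exact: MplusM.
apply: le_int; [|by apply: MplusD; exact: MplusM|].
  by apply: MplusM => //; exact: MplusD.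
by move=> x; rewrite ge0_muleDl//; [exact: Mu.2|exact: Mv.2].
Qed.

Lemma gaugeZ (a : R) u : (0 <= a)%R -> Mplus u ->
  gauge H (fun x => a%:E * u x) <= a%:E * gauge H u.
Proof.
move=> a0 Mu; apply: gauge_ub => h Hh; have Mh := stable_Mplus sH Hh.
under eq_integral do rewrite -muleA.
rewrite intZ//; last exact: MplusM.
by apply: lee_wpmul2l => //; exact: gauge_ge.
Qed.

Lemma gauge_sum n (F : 'I_n -> S -> \bar R) : (forall i, Mplus (F i)) ->
  gauge H (fun x => \sum_(i < n) F i x) <= \sum_(i < n) gauge H (F i).
Proof.
elim: n F => [|n IH] F MF.
  rewrite big_ord0; apply: gauge_ub => h Hh.
  by under eq_integral do rewrite big_ord0 mul0e; rewrite integral0.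
rewrite big_ord_recr/=; under [in leLHS]eq_fun do rewrite big_ord_recr/=.
apply: (le_trans (gaugeD _ _)) => //; first exact: Mplus_sum.
by apply: leeD => //; exact: IH.
Qed.

Lemma limn_einf_ge0 (u : nat -> \bar R) : (forall n, 0 <= u n) -> 0 <= limn_einf u.
Proof.
move=> u0; rewrite limn_einf_lim; apply: lime_ge; first exact: is_cvg_einfs.
by apply: nearW => n; apply: le_ereal_inf_tmp => _ [m _ <-].
Qed.

(** Only an inequality with the lower limit holds: for [l = 0] and [k = +oo] the
products may be infinite while [l * k = 0]. *)
Lemma cvg_mul_le_einf (u : nat -> \bar R) (l k : \bar R) : (forall n, 0 <= u n) ->
  0 <= k -> u n @[n --> \oo] --> l -> l * k <= limn_einf (fun n => u n * k).
Proof.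
move=> u0 k0 ul.
have l0 : 0 <= l by rewrite -(cvg_lim _ ul)//; apply: lime_ge; [apply/cvg_ex; exists l|exact: nearW].
case: k k0 => [k| |//] k0.
  have c : u n * k%:E @[n --> \oo] --> l * k%:E by exact: cvgeZr.
  by rewrite (cvg_limn_einf_sup c).1.
move: l0; rewrite le_eqVlt => /predU1P[<-|l0].
  by rewrite mul0e; apply: limn_einf_ge0 => n; exact: mule_ge0.
suff c : u n * +oo @[n --> \oo] --> +oo.
  by rewrite (cvg_limn_einf_sup c).1 leey.
apply: cvg_near_cst; have /ul ulp : nbhs l [set y | 0 < y].
  by apply: open_nbhs_nbhs; split => //; exact: open_ereal_gt_ereal.
by near=> n; rewrite gt0_muley//; near: n; exact: ulp.
Unshelve. all: by end_near.
Qed.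

(** Fatou's lemma for each weight separately; since weights may be infinite, the
products need not converge and only their lower limit is compared. *)
Lemma gauge_fatou (u_ : nat -> S -> \bar R) u (b : \bar R) :
  (forall n, Mplus (u_ n)) -> Mplus u ->
  {ae mu, forall x, u_ n x @[n --> \oo] --> u x} ->
  (forall n, gauge H (u_ n) <= b) -> gauge H u <= b.
Proof.
move=> Mu_ Mu u_u ub; apply: gauge_ub => h Hh; have Mh := stable_Mplus sH Hh.
have M n : Mplus (fun x => u_ n x * h x) by exact: MplusM.
apply: (@le_trans _ _ (\int[mu]_x limn_einf (fun n => u_ n x * h x))).
  apply: le_int_ae; first exact: MplusM.
    split => [|x]; last by apply: limn_einf_ge0 => n; exact: (M n).2.
    apply: measurableT_comp => //; apply: measurable_fun_limn_esup => n.
    by apply: measurableT_comp => //; exact: (M n).1.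
  apply: filterS u_u => x u_u; apply: cvg_mul_le_einf => //; last exact: Mh.2.
  by move=> n; exact: (Mu_ n).2.
apply: (le_trans (fatou mu measurableT _ _)) => //=.
- by move=> n; exact: (M n).1.
- by move=> n x _; exact: (M n).2.
rewrite limn_einf_lim; apply: lime_le; first exact: is_cvg_einfs.
apply: nearW => n; apply: ge_ereal_inf; exists (\int[mu]_x (u_ n x * h x)).
  by exists n => /=.
by apply: (le_trans _ (ub n)); exact: gauge_ge.
Qed.

Context (res : resonant mu).

Lemma gauge_pairing_ge h u : Mplus u -> H h -> rearr_pairing mu u h <= gauge H u.
Proof.
move=> Mu Hh; apply: pairing_ub => //; first exact: stable_Mplus Hh.
by move=> h' Mh' h'h; apply: gauge_ge; exact: stable_same_rearr h'h.
Qed.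

Lemma gauge_pairing_ub u (b : \bar R) : Mplus u ->
  (forall h, H h -> rearr_pairing mu u h <= b) -> gauge H u <= b.
Proof.
move=> Mu ub; apply: gauge_ub => h Hh; apply: le_trans (ub h Hh).
by apply: int_le_pairing => //; exact: stable_Mplus Hh.
Qed.

(** The supremum over the weights inherits [pairing_dilation], since by resonance
the pairings with weights have the same supremum as the integrals. *)
Lemma gauge_dilation (A : R) u v : (1 <= A)%R -> Mplus u -> Mplus v ->
  (forall s : R, (0 <= s)%R -> distr mu u s <= A%:E * distr mu v s) ->
  gauge H u <= A%:E * gauge H v.
Proof.
move=> A1 Mu Mv uv; apply: gauge_pairing_ub => // h Hh.
apply: (le_trans (pairing_dilation h A1 uv)); apply: lee_wpmul2l.
  by rewrite lee_fin (le_trans _ A1).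
exact: gauge_pairing_ge.
Qed.

End gauge.

(** * The Lorentz-Luxemburg theorem *)

Section ae_convergence.
Context (R : realType) d (S : measurableType d) (mu : {measure set S -> \bar R}).
Local Open Scope ereal_scope.

Lemma Mplus_einf (u_ : nat -> S -> \bar R) : (forall n, Mplus (u_ n)) ->
  Mplus (fun x => limn_einf (u_ ^~ x)).
Proof.
move=> Mu; split => [|x]; last by apply: limn_einf_ge0 => n; exact: (Mu n).2.
apply: measurableT_comp => //; apply: measurable_fun_limn_esup => n.
by apply: measurableT_comp => //; exact: (Mu n).1.
Qed.

Lemma Mplus_einfs (u_ : nat -> S -> \bar R) n : (forall n, Mplus (u_ n)) ->
  Mplus (fun x => einfs (u_ ^~ x) n).
Proof.
move=> Mu; split => [|x].
  by apply: measurable_fun_einfs => k; exact: (Mu k).1.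
by apply: le_ereal_inf_tmp => _ [m _ <-]; exact: (Mu m).2.
Qed.

Lemma int_fatou (u_ : nat -> S -> \bar R) u (b : \bar R) :
  (forall n, Mplus (u_ n)) -> Mplus u ->
  {ae mu, forall x, u_ n x @[n --> \oo] --> u x} ->
  (forall n, \int[mu]_x u_ n x <= b) -> \int[mu]_x u x <= b.
Proof.
move=> Mu_ Mu u_u ub.
apply: (@le_trans _ _ (\int[mu]_x limn_einf (u_ ^~ x))).
  apply: le_int_ae => //; first exact: Mplus_einf.
  by apply: filterS u_u => x /cvg_limn_einf_sup[-> _].
apply: (le_trans (fatou mu measurableT _ _)) => //=.
- by move=> n; exact: (Mu_ n).1.
- by move=> n x _; exact: (Mu_ n).2.
rewrite limn_einf_lim; apply: lime_le; first exact: is_cvg_einfs.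
apply: nearW => n; apply: ge_ereal_inf; exists (\int[mu]_x u_ n x) => //.
by exists n => /=.
Qed.

(** The series of increments has finite integral, hence converges absolutely at
almost every point. *)
Lemma ae_cvg_of_summable_increments (v : nat -> S -> R) (C : R) :
  (forall k, measurable_fun setT (v k)) -> (0 <= C)%R ->
  (forall k, \int[mu]_x `|v k.+1 x - v k x|%:E <= (C / (2 ^ k.+1)%:R)%:E) ->
  {ae mu, forall x, cvgn (v ^~ x)}.
Proof.
move=> mv C0 vC.
have M k : Mplus (fun x => `|v k.+1 x - v k x|%:E).
  by apply: Mplus_absE; exact: measurable_funB.
pose U x := \sum_(0 <= k <oo) `|v k.+1 x - v k x|%:E.
have iU : \int[mu]_x U x < +oo.
  rewrite /U (@integral_nneseries _ _ _ mu setT measurableT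
    (fun k x => `|v k.+1 x - v k x|%:E) (fun k => (M k).1)
    (fun k x _ => (M k).2 x)).
  apply: (@le_lt_trans _ _ C%:E); last by rewrite ltry.
  apply: le_trans (epsilon_trick0 xpredT C0); apply: lee_nneseries => //.
  by move=> i _ _; exact: int_ge0.
have mU : measurable_fun setT U.
  by apply: ge0_emeasurable_sum => // k _; exact: (M k).1.
have U0 x : 0 <= U x by apply: nneseries_ge0 => k _ _; exact: (M k).2.
have /integrable_ae /= : mu.-integrable setT U.
  apply/integrableP; split => //.
  by under eq_integral do rewrite gee0_abs//.
move=> /(_ measurableT); apply: filterS => x /(_ I) Ux.
have {Ux}/nnseries_is_cvg c : U x < +oo by rewrite ltey_eq Ux.
have : cvgn (series (fun k => v k.+1 x - v k x)%R).
  by apply: normed_cvg; exact: c.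
rewrite (_ : series _ = [sequence v n x - v 0%N x]_n%R); last first.
  exact: (telescopeK (v ^~ x)).
move=> /cvg_ex[l cl]; apply/cvg_ex; exists (l + v 0%N x)%R.
rewrite (_ : v ^~ x = (fun n => (v n x - v 0%N x) + v 0%N x)%R).
  by apply: cvgD => //; exact: cvg_cst.
by apply/funext => n; rewrite subrK.
Qed.

End ae_convergence.

Section norm.
Context (R : realType) d (S : measurableType d) (mu : {measure set S -> \bar R}).
Local Open Scope ereal_scope.
Context (rho : (S -> \bar R) -> \bar R) (nrho : banach_function_norm mu rho).
Implicit Types (u : S -> \bar R).

(** The tail infima increase to the limit, so the monotone Fatou property of the
norm applies to them. *)
Lemma norm_fatou (u_ : nat -> S -> \bar R) u (b : \bar R) :
  (forall n, Mplus (u_ n)) -> Mplus u ->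
  {ae mu, forall x, u_ n x @[n --> \oo] --> u x} ->
  (forall n, rho (u_ n) <= b) -> rho u <= b.
Proof.
move=> Mu_ Mu u_u ub.
pose v n x := einfs (u_ ^~ x) n.
have Mv n : Mplus (v n) by exact: Mplus_einfs.
have [] := bfn_fatou nrho Mv Mu.
  apply: filterS u_u => x u_u; split; first exact: nondecreasing_einfs.
  exact: cvg_einfs.
move=> _ /cvge_ub; apply => n; apply: le_trans (ub n); apply: (bfn_lattice nrho) => //.
by apply: aeW => x; apply: ge_ereal_inf; exists (u_ n x) => //; exists n => /=.
Qed.

Lemma norm_cst0 : rho (fun _ => 0) = 0.
Proof.
by apply/(bfn_eq0 nrho); [exact: Mplus_cst|exact: aeW].
Qed.

Lemma norm_convex (t : R) u v : (0 <= t <= 1)%R -> Mplus u -> Mplus v ->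
  rho u <= 1 -> rho v <= 1 ->
  rho (fun x => (1 - t)%:E * u x + t%:E * v x) <= 1.
Proof.
move=> /andP[t0 t1] Mu Mv u1 v1; have t1' : (0 <= 1 - t)%R by rewrite subr_ge0.
apply: (le_trans (bfn_subadditive nrho (MplusZ t1' Mu) (MplusZ t0 Mv))).
rewrite !(bfn_homogeneous nrho)//.
rewrite [leRHS](_ : 1 = (1 - t)%:E * 1 + t%:E * 1); last first.
  by rewrite !mule1 -EFinD subrK.
by apply: leeD; apply: lee_wpmul2l; rewrite ?lee_fin.
Qed.

End norm.

Section projection.
Context (R : realType) d (S : measurableType d) (mu : {measure set S -> \bar R}).
Local Open Scope ereal_scope.
Implicit Types (u v w : S -> R).

Definition sqdist v w : \bar R := \int[mu]_x ((v x - w x) ^+ 2)%:E.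

(** The minorants of [u] in the unit ball: the nearest point to [u] can be found
among them, so that all functions involved stay bounded. *)
Definition minorants (rho : (S -> \bar R) -> \bar R) u : set (S -> R) :=
  [set v : S -> R | [/\ measurable_fun setT v, forall x, (0 <= v x <= u x)%R &
    rho (EFin \o v) <= 1]].

Lemma Mplus_EFin v : measurable_fun setT v -> (forall x, 0 <= v x)%R ->
  Mplus (EFin \o v).
Proof. by move=> mv v0; split; [exact/measurable_EFinP|move=> x; rewrite lee_fin]. Qed.

Lemma Mplus_sq v w : measurable_fun setT v -> measurable_fun setT w ->
  Mplus (fun x => ((v x - w x) ^+ 2)%:E).
Proof.
move=> mv mw; split => [|x]; last by rewrite lee_fin sqr_ge0.
by apply/measurable_EFinP; apply: measurable_funX; exact: measurable_funB.
Qed.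

Lemma Mplus_prod v w : measurable_fun setT v -> measurable_fun setT w ->
  (forall x, 0 <= v x)%R -> (forall x, 0 <= w x)%R ->
  Mplus (fun x => (v x * w x)%:E).
Proof.
move=> mv mw v0 w0; split => [|x]; last by rewrite lee_fin mulr_ge0.
by apply/measurable_EFinP; exact: measurable_funM.
Qed.

Lemma cvgn_EFin (a : nat -> R) (l : R) :
  a n @[n --> \oo] --> l -> (a n)%:E @[n --> \oo] --> l%:E.
Proof. by move=> al; apply: cvg_EFin => //; exact: nearW. Qed.

Lemma sqdist_le v w (F : set S) (c : R) : measurable F ->
  measurable_fun setT v -> measurable_fun setT w ->
  (forall x, `|v x - w x| <= c)%R ->
  (forall x, ~ F x -> v x = w x) -> sqdist v w <= (c ^+ 2)%:E * mu F.
Proof.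
move=> mF mv mw vw vwF; rewrite -int_indic// -intZ ?sqr_ge0//; last exact: Mplus_indic.
apply: le_int; [exact: Mplus_sq|by apply: MplusZ; [exact: sqr_ge0|exact: Mplus_indic]|].
move=> x; rewrite indicE; case: (boolP (x \in F)) => [_|/negP xF].
  rewrite mule1 lee_fin -real_normK ?num_real// lerXn2r ?nnegrE//.
  exact: le_trans (vw x).
rewrite vwF ?subrr ?expr0n ?mule0//.
by move=> Fx; apply: xF; rewrite inE.
Qed.

Context (rho : (S -> \bar R) -> \bar R) (nrho : banach_function_norm mu rho).
Local Notation K := (minorants rho).

Lemma minorants0 u : (forall x, 0 <= u x)%R -> K u (fun _ => 0%R).
Proof.
move=> u0; split; [exact: measurable_cst|by move=> x; rewrite lexx u0|].
rewrite [X in rho X](_ : _ = fun _ => 0)//.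
by rewrite (norm_cst0 nrho) lee01.
Qed.

Lemma minorants_convex u (t : R) v w : (0 <= t <= 1)%R -> K u v -> K u w ->
  K u (fun x => (1 - t) * v x + t * w x)%R.
Proof.
move=> t01 [mv v0 rv] [mw w0 rw]; have /andP[t0 t1] := t01; split.
- by apply: measurable_funD; apply: measurable_funM.
- move=> x; have /andP[v0x vux] := v0 x; have /andP[w0x wux] := w0 x.
  by apply/andP; split; nra.
- rewrite [X in rho X](_ : _ = fun x => (1 - t)%:E * (v x)%:E + t%:E * (w x)%:E)//.
  by apply: (norm_convex nrho) => //; apply: Mplus_EFin => // x;
    [have /andP[] := v0 x|have /andP[] := w0 x].
Qed.

Context (u : S -> R) (F : set S) (n : R).
Context (u_meas : measurable_fun setT u) (mF : measurable F) (Ffin : mu F < +oo).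
Context (u0 : forall x, (0 <= u x)%R)
  (un : forall x, (u x <= n)%R) (uF : forall x, ~ F x -> u x = 0%R).

Let D := ereal_inf [set sqdist u v | v in K u].

Let D0 : 0 <= D.
Proof.
by apply: le_ereal_inf_tmp => _ [v [mv _ _] <-]; apply: int_ge0; exact: Mplus_sq.
Qed.

Let D_le v : K u v -> D <= sqdist u v.
Proof. by move=> Kv; apply: ereal_inf_lbound; exists v. Qed.

Lemma sqdist_minorants_fin v : K u v -> sqdist u v < +oo.
Proof.
move=> [mv v0 _]; apply: (@le_lt_trans _ _ ((n ^+ 2)%:E * mu F)).
  apply: sqdist_le => // x.
    have /andP[? ?] := v0 x; rewrite ger0_norm ?subr_ge0//.
    by apply: le_trans (un x); rewrite lerBlDr lerDl.
  move=> /uF ux; apply/le_anti; have /andP[vx ->] := v0 x.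
  by rewrite ux vx.
by rewrite lte_mul_pinfty// lee_fin sqr_ge0.
Qed.

Let Dfin : D \is a fin_num.
Proof.
rewrite ge0_fin_numE//; apply: (le_lt_trans (D_le (minorants0 u0))).
exact/sqdist_minorants_fin/minorants0.
Qed.

(** Near-minimizers are close to each other, by the parallelogram identity and
convexity. *)
Let parallelogram v w (a b : R) : K u v -> K u w ->
  sqdist u v <= D + a%:E -> sqdist u w <= D + b%:E ->
  sqdist v w <= (2 * a + 2 * b)%:E.
Proof.
move=> Kv Kw va wb; have [mv _ _] := Kv; have [mw _ _] := Kw.
have h01 : (0 <= (2^-1 : R) <= 1)%R by apply/andP; split; lra.
have Kz := minorants_convex h01 Kv Kw; set z := (fun x => _) in Kz; have [mz _ _] := Kz.
have : sqdist v w + 4%:E * sqdist u z = 2%:E * sqdist u v + 2%:E * sqdist u w.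
  rewrite -!intZ//; try exact: Mplus_sq.
  rewrite -!intD; try exact: Mplus_sq; try (apply: MplusZ => //; exact: Mplus_sq).
  apply: eq_integral => x _; rewrite -!EFinM -!EFinD; congr EFin.
  by rewrite /z; field.
move=> e; have : sqdist v w + 4%:E * D <= 2%:E * (D + a%:E) + 2%:E * (D + b%:E).
  apply: (@le_trans _ _ (sqdist v w + 4%:E * sqdist u z)).
    by apply: leeD2l; apply: lee_wpmul2l => //; exact: D_le.
  by rewrite e; apply: leeD; apply: lee_wpmul2l.
have : 0 <= sqdist v w by apply: int_ge0; exact: Mplus_sq.
move: (sqdist v w) => s {e va wb}; case: D Dfin => [D'| |]// _.
by case: s => [s| |]// _; rewrite -!EFinD !lee_fin => h; lra.
Qed.

(** Trades a bound on squares for one on absolute values; the additive constant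
is affordable on sets of finite measure and is summable along [q = 2 ^ k]. *)
Lemma norm_le_sq (q y : R) : (0 < q)%R -> (`|y| <= q * y ^+ 2 + q^-1)%R.
Proof.
move=> q0; rewrite -(ler_pM2l q0) mulrDr mulfV ?gt_eqF// mulrA.
rewrite -[(y ^+ 2)%R]real_normK ?num_real//; move: `|y|%R (normr_ge0 y) => z z0.
nra.
Qed.

(** A minimizing sequence whose excess decays like [4^-k] has summable
increments, by the parallelogram identity, so it converges almost everywhere;
by the Fatou property the limit stays in the unit ball, and by Fatou's lemma it
attains the minimum.  This replaces completeness of L2. *)
Lemma nearest_minorant :
  exists2 p, K u p & forall v, K u v -> sqdist u p <= sqdist u v.
Proof.
suff [p Kp pD] : exists2 p, K u p & sqdist u p <= D.
  by exists p => // v Kv; exact: le_trans (D_le Kv).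
pose e (k : nat) : R := ((2 ^ k)%:R^-1 ^+ 2)%R.
have q0 k : (0 < (2 ^ k)%:R :> R)%R by rewrite ltr0n expn_gt0.
have e0 k : (0 < e k)%R by rewrite exprn_gt0// invr_gt0.
have /choice[v vP] k : exists v, K u v /\ sqdist u v <= D + (e k)%:E.
  have [_ [v Kv <-] /ltW] := lb_ereal_inf_adherent (e0 k) Dfin.
  by exists v.
have mv k : measurable_fun setT (v k) by case: (vP k) => -[].
have v0 k x : (0 <= v k x)%R by case: (vP k) => -[_ /(_ x) /andP[]].
have vu k x : (v k x <= u x)%R by case: (vP k) => -[_ /(_ x) /andP[]].
have vF k x : ~ F x -> v k x = 0%R.
  by move=> /uF ux; apply/le_anti; rewrite v0 -{1}ux vu.
have muF0 : (0 <= fine (mu F))%R by rewrite fine_ge0.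
have inc k : \int[mu]_x `|v k.+1 x - v k x|%:E <=
    ((8 + 2 * fine (mu F)) / (2 ^ k.+1)%:R)%:E.
  have qi0 : (0 <= (2 ^ k)%:R^-1 :> R)%R by rewrite invr_ge0.
  apply: (@le_trans _ _ ((2 ^ k)%:R%:E * sqdist (v k.+1) (v k) + (2 ^ k)%:R^-1%:E * mu F)).
    rewrite -int_indic// -!intZ//; [|exact: Mplus_indic|exact: Mplus_sq].
    have M1 : Mplus (fun x => (2 ^ k)%:R%:E * ((v k.+1 x - v k x) ^+ 2)%:E).
      by apply: MplusZ => //; exact: Mplus_sq.
    have M2 : Mplus (fun x => (2 ^ k)%:R^-1%:E * (\1_F x : R)%:E).
      by apply: MplusZ => //; exact: Mplus_indic.
    rewrite -intD//; apply: le_int.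
    - by apply: Mplus_absE; exact: measurable_funB.
    - exact: MplusD.
    move=> x; rewrite indicE; case: (boolP (x \in F)) => [_|/negP xF].
      by rewrite mule1 -EFinM -EFinD lee_fin; exact: norm_le_sq.
    have xF' : ~ F x by move=> Fx; apply: xF; rewrite inE.
    by rewrite !vF// subrr normr0 expr0n !mule0 adde0.
  have [Kk sk] := vP k; have [Kk1 sk1] := vP k.+1.
  apply: (@le_trans _ _ ((2 ^ k)%:R%:E * (2 * e k.+1 + 2 * e k)%:E + (2 ^ k)%:R^-1%:E * mu F)).
    by apply: leeD2r; apply: lee_wpmul2l => //; exact: parallelogram.
  rewrite -[mu F]fineK ?ge0_fin_numE// -!EFinM -EFinD lee_fin.
  rewrite /e expnS natrM; move: (fine _) muF0 ((2 ^ k)%:R)%R (q0 k) => m m0 q q1.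
  (* The estimate to prove has the slack [3 / 2 * q^-1]. *)
  have -> : ((8 + 2 * m) / (2 * q) = q * (2 * (2 * q)^-1 ^+ 2 + 2 * q^-1 ^+ 2) + q^-1 * m + 3 / 2 * q^-1)%R.
    by field; rewrite gt_eqF.
  by rewrite lerDl mulr_ge0// invr_ge0 ltW.
have C0 : (0 <= 8 + 2 * fine (mu F))%R by rewrite addr_ge0// mulr_ge0.
have cv := ae_cvg_of_summable_increments mv C0 inc.
(* The lower limit serves as a limit that is measurable everywhere. *)
pose P x := limn_einf (fun k => (v k x)%:E).
have Mv k : Mplus (EFin \o v k) by exact: Mplus_EFin.
have MP : Mplus P by exact: (Mplus_einf Mv).
have Pu x : P x <= (u x)%:E.
  rewrite /P limn_einf_lim; apply: lime_le; first exact: is_cvg_einfs.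
  apply: nearW => k; apply: ge_ereal_inf; exists (v k x)%:E; last by rewrite lee_fin.
  by exists k => /=.
have Pfin x : P x \is a fin_num.
  by rewrite ge0_fin_numE; [exact: le_lt_trans (Pu x) (ltry _)|exact: MP.2].
pose p x := fine (P x).
have pE x : (p x)%:E = P x by rewrite fineK.
have mp : measurable_fun setT p by apply: measurableT_comp => //; exact: MP.1.
have vp : {ae mu, forall x, v k x @[k --> \oo] --> p x}.
  apply: filterS cv => x /cvg_ex[l vl].
  suff -> : p x = l by [].
  by apply: EFin_inj; rewrite pE; apply: (cvg_limn_einf_sup _).1; exact: cvgn_EFin.
exists p.
  split => //.
    by move=> x; rewrite -!lee_fin pE Pu andbT; exact: MP.2.
  apply: (norm_fatou nrho Mv).
  - by rewrite (_ : _ \o _ = P)//; apply/funext => x; exact: pE.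
  - by apply: filterS vp => x vp; exact: cvgn_EFin.
  - by move=> k; have [[]] := vP k.
apply/lee_addgt0Pr => eps eps0.
have [m me] : exists m, (e m < eps)%R.
  have [k] := ltr_add_invr eps0; rewrite add0r => keps; exists k.
  apply: le_lt_trans keps; rewrite /e exprVn lef_pV2 ?posrE ?ltr0n ?exprn_gt0//.
  rewrite -natrX ler_nat; apply: (@leq_trans (2 ^ k)); first exact: ltn_expl.
  by rewrite -expnM leq_exp2l// leq_pmulr.
apply: (int_fatou (u_ := fun k x => ((u x - v (k + m)%N x) ^+ 2)%:E)) => //.
- by move=> k; exact: Mplus_sq.
- exact: Mplus_sq.
- apply: filterS vp => x vp; apply: cvgn_EFin.
  have c : (fun k => u x - v (k + m)%N x)%R @ \oo --> (u x - p x)%R.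
    apply: cvgB; first exact: cvg_cst.
    by rewrite (cvg_shiftn m (v ^~ x)).
  by rewrite expr2; apply: cvgM.
- move=> k; have [_ /le_trans] := vP (k + m)%N; apply.
  apply: leeD2l; rewrite lee_fin; apply: le_trans (ltW me).
  rewrite /e !exprVn lef_pV2 ?posrE ?exprn_gt0//.
  rewrite lerXn2r ?nnegrE// ler_nat leq_exp2l//; exact: leq_addl.
Qed.

End projection.

Section lorentz_luxemburg.
Context (R : realType) d (S : measurableType d) (mu : {measure set S -> \bar R}).
Local Open Scope ereal_scope.
Context (rho : (S -> \bar R) -> \bar R) (nrho : banach_function_norm mu rho).

(** Brings an extended-valued function into the situation of the nearest-point
argument: bounded, with real values and supported in a set of finite measure. *)
Definition truncation (g : S -> \bar R) (F : set S) (m : nat) : S -> R :=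
  fun x => (fine (mine (g x) m%:R%:E) * \1_F x)%R.

Lemma fine_mineE (y : \bar R) (m : nat) : 0 <= y ->
  (fine (mine y m%:R%:E))%:E = mine y m%:R%:E.
Proof.
move=> y0; rewrite fineK// ge0_fin_numE; last by rewrite le_min y0 lee_fin ler0n.
by rewrite (le_lt_trans _ (ltry m%:R))// ge_min lexx orbT.
Qed.

Lemma measurable_truncation g F m : Mplus g -> measurable F ->
  measurable_fun setT (truncation g F m).
Proof.
move=> [mg _] mF; apply: measurable_funM => //.
by apply: measurableT_comp => //; apply: measurable_mine.
Qed.

Lemma truncation_bounds g F m x : Mplus g ->
  [/\ (0 <= truncation g F m x)%R, (truncation g F m x <= m%:R)%R &
   (truncation g F m x)%:E <= g x].
Proof.
move=> [_ g0]; have f0 : (0 <= fine (mine (g x) m%:R%:E))%R.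
  by rewrite fine_ge0// le_min g0 lee_fin ler0n.
rewrite /truncation indicE; case: (x \in F); rewrite ?mulr1 ?mulr0//; split => //.
- by rewrite -lee_fin fine_mineE// ge_min lexx orbT.
- by rewrite fine_mineE// ge_min lexx.
Qed.

Lemma truncation_out g F m x : ~ F x -> truncation g F m x = 0%R.
Proof. by move=> xF; rewrite /truncation indicE memNset// mulr0. Qed.

Lemma cvg_truncation g (F : nat -> set S) x : Mplus g ->
  (\forall m \near \oo, F m x) ->
  (truncation g (F m) m x)%:E @[m --> \oo] --> g x.
Proof.
move=> [_ g0] Fx; have {Fx} E : \forall m \near \oo,
    mine (g x) m%:R%:E = (truncation g (F m) m x)%:E.
  by apply: filterS Fx => m Fx; rewrite /truncation indicE mem_set// mulr1 fine_mineE.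
apply: cvg_trans (near_eq_cvg E) _ => {E}.
case gx : (g x) (g0 x) => [r| |]// r0.
  apply: cvg_near_cst; near=> m; apply/min_idPl; rewrite lee_fin.
  by near: m; exact: nbhs_infty_ger.
apply/cvgeyPge => A; near=> m; rewrite min_r ?leey// lee_fin.
by near: m; exact: nbhs_infty_ger.
Unshelve. all: by end_near. Qed.

Section separation.
Context (u : S -> R) (F : set S) (n : R).
Context (u_meas : measurable_fun setT u) (mF : measurable F) (Ffin : mu F < +oo).
Context (u0 : forall x, (0 <= u x)%R)
  (un : forall x, (u x <= n)%R) (uF : forall x, ~ F x -> u x = 0%R).
Context (p : S -> R) (Kp : minorants rho u p)
  (pmin : forall v, minorants rho u v -> sqdist mu u p <= sqdist mu u v).

Let mp : measurable_fun setT p. Proof. by case: Kp. Qed.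
Let p0 x : (0 <= p x)%R. Proof. by case: Kp => _ /(_ x) /andP[]. Qed.
Let pu x : (p x <= u x)%R. Proof. by case: Kp => _ /(_ x) /andP[]. Qed.
Let pF x : ~ F x -> p x = 0%R.
Proof. by move=> /uF ux; apply/le_anti; rewrite p0 -{1}ux pu. Qed.
Let mup : measurable_fun setT (fun x => u x - p x)%R.
Proof. exact: measurable_funB. Qed.
Let up0 x : (0 <= u x - p x)%R. Proof. by rewrite subr_ge0. Qed.

Lemma nearest_inner_fin : \int[mu]_x ((u x - p x) * p x)%:E < +oo.
Proof.
apply: le_lt_trans (sqdist_minorants_fin u_meas mF Ffin un uF (minorants0 nrho u0)).
apply: le_int; [exact: Mplus_prod|exact: Mplus_sq|move=> x].
by rewrite lee_fin; have := pu x; have := p0 x; nra.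
Qed.

(** The first order condition at the nearest point; the competitor between [p]
and [w] is cut back below [u], which can only bring it nearer to [u]. *)
Lemma nearest_variation (w : S -> R) (m : R) : measurable_fun setT w ->
  (forall x, 0 <= w x <= m)%R -> (forall x, ~ F x -> w x = 0%R) ->
  rho (EFin \o w) <= 1 ->
  \int[mu]_x ((u x - p x) * w x)%:E <= \int[mu]_x ((u x - p x) * p x)%:E.
Proof.
move=> mw wm wF rw.
have w0 x : (0 <= w x)%R by have /andP[] := wm x.
have sfin : sqdist mu w p < +oo.
  apply: (@le_lt_trans _ _ (((m + n) ^+ 2)%:E * mu F)).
    apply: sqdist_le => // [x|x xF]; last by rewrite wF// pF.
    have /andP[_ wmx] := wm x; have := p0 x; have := pu x; have := un x.
    by have := w0 x; rewrite ler_norml => *; apply/andP; split; lra.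
  by rewrite lte_mul_pinfty// lee_fin sqr_ge0.
have afin := sqdist_minorants_fin u_meas mF Ffin un uF Kp.
(* Minimality of [p] against [(1 - t) * p + t * w], with the square expanded. *)
have key t : (0 < t)%R -> (t <= 1)%R ->
    sqdist mu u p + (2 * t)%:E * \int[mu]_x ((u x - p x) * w x)%:E <=
    sqdist mu u p + (2 * t)%:E * \int[mu]_x ((u x - p x) * p x)%:E +
    (t ^+ 2)%:E * sqdist mu w p.
  move=> t0 t1; have t2 : (0 <= 2 * t)%R by rewrite mulr_ge0// ltW.
  pose q x := ((1 - t) * p x + t * w x)%R.
  have mq : measurable_fun setT q by apply: measurable_funD; apply: measurable_funM.
  have q0 x : (0 <= q x)%R by rewrite addr_ge0 ?mulr_ge0 ?subr_ge0// ltW.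
  apply: (@le_trans _ _ (sqdist mu u q + (2 * t)%:E * \int[mu]_x ((u x - p x) * w x)%:E)).
    apply: leeD2r; apply: (@le_trans _ _ (sqdist mu u (fun x => Num.min (q x) (u x)))).
      apply: pmin; split.
      - exact: measurable_minr.
      - by move=> x; rewrite le_min q0 u0/= ge_min lexx orbT.
      have t01 : (0 <= t <= 1)%R by rewrite ltW.
      have [_ _ rp] := Kp.
      apply: le_trans (norm_convex nrho t01 (Mplus_EFin mp p0) (Mplus_EFin mw w0) rp rw).
      apply: (bfn_lattice nrho).
      - apply: Mplus_EFin; first exact: measurable_minr.
        by move=> x; rewrite le_min q0 u0.
      - by apply: (Mplus_EFin mq).
      - by apply: aeW => x /=; rewrite -!EFinM -EFinD lee_fin ge_min lexx.
    apply: le_int; [|exact: Mplus_sq|].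
      by apply: Mplus_sq => //; exact: measurable_minr.
    move=> x; rewrite lee_fin; have [qu|uq] := leP (q x) (u x) => //.
    by rewrite subrr expr0n sqr_ge0.
  rewrite -!intZ ?sqr_ge0//; [|exact: Mplus_sq|exact: Mplus_prod|exact: Mplus_prod].
  have Mw : Mplus (fun x => (2 * t)%:E * ((u x - p x) * w x)%:E).
    by apply: MplusZ => //; exact: Mplus_prod.
  have Mp : Mplus (fun x => (2 * t)%:E * ((u x - p x) * p x)%:E).
    by apply: MplusZ => //; exact: Mplus_prod.
  have Ms : Mplus (fun x => (t ^+ 2)%:E * ((w x - p x) ^+ 2)%:E).
    by apply: MplusZ; [exact: sqr_ge0|exact: Mplus_sq].
  have Muq := Mplus_sq u_meas mq; have Mup := Mplus_sq u_meas mp.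
  rewrite -!intD//; last exact: MplusD.
  rewrite (_ : (fun x => _ + _) = (fun x => ((u x - p x) ^+ 2)%:E +
      (2 * t)%:E * ((u x - p x) * p x)%:E + (t ^+ 2)%:E * ((w x - p x) ^+ 2)%:E))//.
  by apply/funext => x; rewrite -!EFinM -!EFinD /q; congr EFin; ring.
have bfin := nearest_inner_fin.
have a0 : 0 <= sqdist mu u p by apply: int_ge0; exact: Mplus_sq.
have s0 : 0 <= sqdist mu w p by apply: int_ge0; exact: Mplus_sq.
have b0 : 0 <= \int[mu]_x ((u x - p x) * p x)%:E by apply: int_ge0; exact: Mplus_prod.
have c0 : 0 <= \int[mu]_x ((u x - p x) * w x)%:E by apply: int_ge0; exact: Mplus_prod.
apply/lee_addgt0Pr => e e0.
move: (sqdist mu u p) a0 afin (sqdist mu w p) s0 sfin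
  (\int[mu]_x ((u x - p x) * p x)%:E) b0 bfin
  (\int[mu]_x ((u x - p x) * w x)%:E) c0 key.
case=> [a| |]// _ _ [s| |]// s0 _ [b| |]// b0 _ [c| |]// c0 key; last first.
  have := key 1%R ltr01 (lexx _).
  by rewrite gt0_muley ?lte_fin ?mulr1// addey// -!EFinM -!EFinD leye_eq.
(* This [t] is at most one and makes the quadratic term at most [t * e]. *)
rewrite lee_fin in s0; pose t := (e / (s + 1 + e))%R.
have st : (0 < s + 1 + e)%R by lra.
have t0 : (0 < t)%R by rewrite divr_gt0.
have t1 : (t <= 1)%R by rewrite ler_pdivrMr// mul1r; lra.
have := key t t0 t1; rewrite -!EFinM -!EFinD !lee_fin => k.
have ts : (t * s <= e)%R.
  by rewrite mulrAC ler_pdivrMr// ler_pM2l//; lra.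
have : (2 * t * (c - b) <= 2 * t * e)%R by nra.
have t20 : (0 < 2 * t)%R by exact: mulr_gt0.
by rewrite ler_pM2l// => ?; lra.
Qed.

(** When [u] lies outside the unit ball, the residual [u - p] normalized is a
weight of associate norm at most one on which [u] exceeds one. *)
Lemma nearest_separates : 1 < rho (EFin \o u) ->
  exists h, [/\ Mplus h, associate mu rho h <= 1 &
    1 < \int[mu]_x ((u x)%:E * h x)].
Proof.
move=> ru; have Mup := Mplus_sq u_meas mp.
have Mb := Mplus_prod mup mp up0 p0.
have a_gt0 : 0 < sqdist mu u p.
  rewrite lt_neqAle int_ge0// andbT; apply/eqP => a0.
  have [mp' _ rp] := Kp; move: ru; apply/negP; rewrite -leNgt; apply: le_trans rp.
  apply: (bfn_lattice nrho); [exact: Mplus_EFin|exact: Mplus_EFin|].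
  have /ae_eq_integral_abs : measurable_fun setT (fun x => ((u x - p x) ^+ 2)%:E).
    exact: Mup.1.
  move=> /(_ mu measurableT)[+ _]; rewrite (_ : integral _ _ _ = 0); last first.
    by rewrite [RHS]a0; apply: eq_integral => x _; rewrite gee0_abs//; exact: Mup.2.
  move=> /(_ erefl); apply: filterS => x /(_ I) /= [] /eqP.
  by rewrite sqrf_eq0 subr_eq0 => /eqP ->.
have afin := sqdist_minorants_fin u_meas mF Ffin un uF Kp.
have bfin := nearest_inner_fin.
have b0 := int_ge0 mu Mb.
pose a := fine (sqdist mu u p).
pose b := fine (\int[mu]_x ((u x - p x) * p x)%:E).
have aE : sqdist mu u p = a%:E by rewrite fineK// gt0_fin_numE.
have bE : \int[mu]_x ((u x - p x) * p x)%:E = b%:E by rewrite fineK// ge0_fin_numE.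
rewrite aE lte_fin in a_gt0; rewrite bE lee_fin in b0.
(* The residual pairs to at most [b] with the unit ball and to [a + b] with
   [u]; any constant strictly in between will do. *)
pose B := (b + a / 2)%R; have B0 : (0 < B)%R by rewrite ltr_wpDl// divr_gt0.
have Bi0 : (0 <= B^-1)%R by rewrite invr_ge0 ltW.
have Mg : Mplus (fun x => (u x - p x)%:E) by exact: (Mplus_EFin mup).
exists (fun x => B^-1%:E * (u x - p x)%:E); split; first exact: MplusZ.
  apply: ge_ereal_sup => _ [g [Mplus_g rg] <-].
  under eq_integral do rewrite -muleA.
  rewrite intZ//; last exact: MplusM.
  rewrite lee_pdivrMl// mule1.
  apply: (@le_trans _ _ b%:E); last first.
    by rewrite lee_fin /B lerDl divr_ge0// ltW.
  rewrite -bE; apply: (int_fatou (u_ := fun m x => ((u x - p x) * truncation g F m x)%:E)).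
  - move=> m; apply: Mplus_prod => //; first exact: measurable_truncation.
    by move=> x; have [] := truncation_bounds F m x Mplus_g.
  - exact: MplusM.
  - apply: aeW => x; have [Fx|Fx] := pselect (F x).
      under eq_fun do rewrite EFinM.
      apply: cvgeZl => //; apply: (cvg_truncation (F := fun _ => F)) => //.
      exact: nearW.
    rewrite uF// pF// subrr mul0e.
    by under eq_fun do rewrite mul0r; exact: cvg_cst.
  - move=> m; have B1 x := truncation_bounds F m x Mplus_g.
    apply: (nearest_variation (m := m%:R)).
    + exact: measurable_truncation.
    + by move=> x; have [-> ->] := B1 x.
    + by move=> x; exact: truncation_out.
    + apply: le_trans rg; apply: (bfn_lattice nrho) => //.
        apply: Mplus_EFin; first exact: measurable_truncation.
        by move=> x; have [] := B1 x.
      by apply: aeW => x; have [] := B1 x.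
have -> : \int[mu]_x ((u x)%:E * (B^-1%:E * (u x - p x)%:E)) =
    \int[mu]_x (B^-1%:E * (u x * (u x - p x))%:E).
  by apply: eq_integral => x _; rewrite EFinM muleCA.
have Mu := Mplus_prod u_meas mup u0 up0.
rewrite intZ// lte_pdivlMl// mule1.
have -> : \int[mu]_x (u x * (u x - p x))%:E = b%:E + a%:E.
  rewrite -aE -bE -intD//; apply: eq_integral => x _; rewrite -EFinD; congr EFin.
  by ring.
by rewrite -EFinD lte_fin /B; lra.
Qed.

End separation.

Definition dual_ball : set (S -> \bar R) :=
  [set h | Mplus h /\ associate mu rho h <= 1].

(** The non-trivial half of the Lorentz-Luxemburg theorem.  By homogeneity it
suffices to treat level one, and by the Fatou property to treat truncations; a
truncation outside the unit ball would be separated from it by a weight of the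
dual ball. *)
Theorem norm_le_gauge_dual_ball (u : S -> \bar R) : sigma_finite [set: S] mu ->
  Mplus u -> rho u <= gauge mu dual_ball u.
Proof.
move=> /sigma_finiteP[F [TF ndF mF]] Mu.
have key (c : R) : (0 < c)%R -> gauge mu dual_ball u < c%:E -> rho u <= c%:E.
  move=> c0 uc; have ci0 : (0 <= c^-1)%R by rewrite invr_ge0 ltW.
  rewrite -[c%:E]mule1 -lee_pdivrMl// -(bfn_homogeneous nrho)//.
  pose g x := c^-1%:E * u x; have Mg : Mplus g by exact: MplusZ.
  apply: (norm_fatou nrho (u_ := fun m => EFin \o truncation g (F m) m)) => //.
  - move=> m; apply: Mplus_EFin; first by apply: measurable_truncation => //; exact: (mF m).1.
    by move=> x; have [] := truncation_bounds (F m) m x Mg.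
  - apply: aeW => x; apply: cvg_truncation => //.
    have : [set: S] x by []. rewrite TF => -[k _ Fkx].
    exists k => // m /= km; have /subsetPset := ndF _ _ km; exact.
  move=> m; rewrite leNgt; apply/negP => rm.
  have mt := measurable_truncation m Mg (mF m).1.
  have t0 x : (0 <= truncation g (F m) m x)%R.
    by have [] := truncation_bounds (F m) m x Mg.
  have tn x : (truncation g (F m) m x <= m%:R)%R.
    by have [] := truncation_bounds (F m) m x Mg.
  have tF x : ~ F m x -> truncation g (F m) m x = 0%R by exact: truncation_out.
  have [p Kp pmin] := nearest_minorant nrho mt (mF m).1 (mF m).2 t0 tn tF.
  have [h [Mh h1]] := nearest_separates mt (mF m).1 (mF m).2 t0 tn tF Kp pmin rm.
  apply/negP; rewrite -leNgt.
  apply: (@le_trans _ _ (\int[mu]_x (g x * h x))).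
    apply: le_int; [by apply: MplusM => //; exact: Mplus_EFin|exact: MplusM|].
    move=> x; apply: lee_wpmul2r; first exact: Mh.2.
    by have [] := truncation_bounds (F m) m x Mg.
  under eq_integral do rewrite -muleA.
  rewrite intZ//; last exact: MplusM.
  rewrite lee_pdivrMl// mule1; apply/ltW; apply: le_lt_trans uc.
  exact: gauge_ge.
have g0 : 0 <= gauge mu dual_ball u.
  apply: le_trans (gauge_ge mu u (h := fun _ => 0) _); last first.
    split; first exact: Mplus_cst.
    apply: ge_ereal_sup => _ [g [Mg _] <-].
    by under eq_integral do rewrite mul0e; rewrite integral0 lee01.
  by under eq_integral do rewrite mule0; rewrite integral0.
case gE : (gauge mu dual_ball u) g0 => [c| |]// c0; last by rewrite leey.
apply/lee_addgt0Pr => e e0; apply: key; first by rewrite ltr_wpDl.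
by rewrite gE lte_fin ltrDl.
Qed.

End lorentz_luxemburg.

(** * Ergodic sums *)

Section tiling.
Context (R : realType).

(** Non-negative blocks are concatenated until the length [L] is reached; the last
block overshoots by at most [N]. *)
Lemma tiling (b : nat -> R) (N : nat) :
  (forall k, exists2 n, (0 < n <= N)%N & 0 <= \sum_(i < n) b (k + i)%N) ->
  forall L, exists2 m, (L <= m <= L + N)%N & 0 <= \sum_(i < m) b i.
Proof.
move=> bN; elim=> [|L [m /andP[Lm mL] sm]]; first by exists 0%N; rewrite ?big_ord0.
have [Lm'|mL'] := ltnP L m; first by exists m => //; rewrite Lm'/= addSn leqW.
have mE : m = L by apply/eqP; rewrite eqn_leq mL' Lm.
move: sm; rewrite mE => sm.
have [n /andP[n0 nN] sn] := bN L; exists (L + n)%N.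
  by rewrite -[L.+1]addn1 leq_add2l n0/= addn1 addSn leqW// leq_add2l.
by rewrite big_split_ord/= addr_ge0.
Qed.

End tiling.

Section ergodic_sums.
Context (R : realType) d (S : measurableType d) (mu : {measure set S -> \bar R}).
Context (phi : S -> S) (mphi : measurable_fun setT phi).
Implicit Types (f g : S -> R) (n m N L : nat).

Definition ergodic_sum f n x : R := \sum_(i < n) f (iter i phi x).

Lemma measurable_iter n : measurable_fun setT (iter n phi).
Proof.
by elim: n => [|n IH]; [exact: measurable_id|exact: measurableT_comp].
Qed.

Lemma measurable_ergodic_sum f n : measurable_fun setT f ->
  measurable_fun setT (ergodic_sum f n).
Proof.
move=> mf; apply: measurable_sum => i.
exact: (measurableT_comp mf (measurable_iter i)).
Qed.

Lemma ergodic_sumS f n x : ergodic_sum f n.+1 x = f x + ergodic_sum f n (phi x).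
Proof.
rewrite /ergodic_sum big_ord_recl; congr (_ + _).
by apply: eq_bigr => i _; rewrite /= -iterSr.
Qed.

Lemma ergodic_sumD f g n x :
  ergodic_sum (f \+ g) n x = ergodic_sum f n x + ergodic_sum g n x.
Proof. by rewrite /ergodic_sum -big_split. Qed.

Lemma ergodic_sumN f n x : ergodic_sum (\- f) n x = - ergodic_sum f n x.
Proof. by rewrite /ergodic_sum -sumrN. Qed.

Lemma ler_ergodic_sum f g n x : (forall y, f y <= g y) ->
  ergodic_sum f n x <= ergodic_sum g n x.
Proof. by move=> fg; apply: ler_sum. Qed.

Lemma normr_ergodic_sum f n x :
  `|ergodic_sum f n x| <= ergodic_sum (fun y => `|f y|) n x.
Proof. exact: ler_norm_sum. Qed.

Lemma ergodic_sum_ge0 f n x : (forall y, 0 <= f y) -> 0 <= ergodic_sum f n x.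
Proof. by move=> f0; apply: sumr_ge0. Qed.

Lemma leq_ergodic_sum f n m x : (forall y, 0 <= f y) -> (n <= m)%N ->
  ergodic_sum f n x <= ergodic_sum f m x.
Proof.
move=> f0 nm; rewrite /ergodic_sum -(subnKC nm) big_split_ord/= lerDl.
exact: sumr_ge0.
Qed.

Lemma tiling_orbit f N :
  (forall x, exists2 n, (0 < n <= N)%N & 0 <= ergodic_sum f n x) ->
  forall L x, exists2 m, (L <= m <= L + N)%N & 0 <= ergodic_sum f m x.
Proof.
move=> fN L x; apply: (tiling (b := fun i => f (iter i phi x))) => k; have [n nN sn] := fN (iter k phi x).
exists n => //; rewrite (eq_bigr (fun i : 'I_n => f (iter i phi (iter k phi x))))//.
by move=> i _; rewrite addnC iterD.
Qed.

Local Open Scope ereal_scope.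
Context (A : R) (A1 : (1 <= A)%R).
Context (phi_le : forall n (E : set S), measurable E ->
    mu (iter n phi @^-1` E) <= A%:E * mu E)
  (phi_ge : forall n (E : set S), measurable E ->
    mu E <= A%:E * mu (iter n phi @^-1` E)).
Lemma measurable_preimage_iter n (E : set S) : measurable E ->
  measurable (iter n phi @^-1` E).
Proof. by move=> mE; rewrite -[X in measurable X]setTI; exact: measurable_iter. Qed.

Let A0 : (0 < A)%R. Proof. exact: lt_le_trans A1. Qed.

Lemma sum_const_ord (c : \bar R) n : 0 <= c -> \sum_(i < n) c = n%:R%:E * c.
Proof.
move=> c0; elim: n => [|n IH]; first by rewrite big_ord0 mul0e.
by rewrite big_ord_recr/= IH -natr1 EFinD ge0_muleDl ?mul1e// lee_fin.
Qed.

(** The image of [mu] under an iterate is dominated by [A] times [mu]. *)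
Lemma int_iter n (u : S -> \bar R) : Mplus u ->
  \int[mu]_x u (iter n phi x) <= A%:E * \int[mu]_x u x.
Proof.
move=> [u_meas u0].
have pf := ge0_integral_pushforward (measurable_iter n) mu measurableT u_meas
  (fun x _ => u0 x).
rewrite preimage_setT in pf.
rewrite -[leLHS]/(\int[mu]_x (u \o iter n phi) x) -pf.
have sc := ge0_integral_mscale mu measurableT (NngNum (ltW A0)) u_meas (fun x _ => u0 x).
rewrite -[leRHS]sc; apply: ge0_le_measure_integral => //.
  exact: measurable_iter.
by move=> ? E mE; exact: (phi_le n mE).
Qed.

Lemma int_ergodic_sum f n : measurable_fun setT f -> (forall x, 0 <= f x)%R ->
  \int[mu]_x (ergodic_sum f n x)%:E = \sum_(i < n) \int[mu]_x (f (iter i phi x))%:E.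
Proof.
move=> mf f0; rewrite /ergodic_sum.
under eq_integral do rewrite -sumEFin.
rewrite (@ge0_integral_sum _ _ _ mu setT measurableT _
  (fun (i : 'I_n) x => (f (iter i phi x))%:E))//.
  move=> i; apply/measurable_EFinP.
  exact: (measurableT_comp mf (measurable_iter i)).
by move=> i x _; rewrite lee_fin.
Qed.

Lemma int_ergodic_sum_le f n : measurable_fun setT f -> (forall x, 0 <= f x)%R ->
  \int[mu]_x (ergodic_sum f n x)%:E <= n%:R%:E * (A%:E * \int[mu]_x (f x)%:E).
Proof.
move=> mf f0; rewrite int_ergodic_sum//.
apply: (@le_trans _ _ (\sum_(i < n) A%:E * \int[mu]_x (f x)%:E)).
  by apply: lee_sum => i _; exact: (int_iter i (Mplus_EFin mf f0)).
rewrite sum_const_ord// mule_ge0 ?lee_fin ?(ltW A0)//.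
by apply: int_ge0; exact: Mplus_EFin.
Qed.

Lemma measurable_ergodic_above f (s : R) (P : set nat) : measurable_fun setT f ->
  measurable [set x | exists2 n, P n & (s * n%:R <= ergodic_sum f n x)%R].
Proof.
move=> mf; rewrite (_ : mkset _ =
    \bigcup_(n in P) [set x | (s * n%:R <= ergodic_sum f n x)%R]); last first.
  by apply/seteqP; split => x [n]; exists n.
apply: bigcup_measurable => n _; rewrite -[X in measurable X]setTI.
by apply: measurable_fun_ler => //; exact: measurable_ergodic_sum.
Qed.

(** Tiling an orbit segment of length [N] by blocks on which [f] has average at
least [s] bounds [s] times the number of visits to the set by a sum of [f] over
at most [2 N] steps.  Integrating costs one factor [A] to bring the visits back
to the measure of the set, and one to bring the sum back to the integral of
[f]. *)
Lemma ergodic_maximal_inequality_bounded f (s : R) N : measurable_fun setT f ->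
  (forall x, 0 <= f x)%R -> (0 < s)%R ->
  s%:E * mu [set x | exists2 n, (0 < n <= N)%N & (s * n%:R <= ergodic_sum f n x)%R] <=
  (2 * A ^+ 2)%:E * \int[mu]_x (f x)%:E.
Proof.
move=> mf f0 s0; have [->|N0] := posnP N.
  rewrite (_ : mkset _ = set0) ?measure0 ?mule0.
    apply: mule_ge0; first by rewrite lee_fin mulr_ge0// sqr_ge0.
    by apply: int_ge0; exact: Mplus_EFin.
  by apply/seteqP; split => x //= -[n]; rewrite andbC ltnNge => /andP[->].
set G := [set x | _].
have mG : measurable G by exact: (measurable_ergodic_above s [set n | 0 < n <= N]%N).
pose g x := (f x - s * \1_G x)%R.
have gE n x : ergodic_sum g n x = (ergodic_sum f n x - s * ergodic_sum \1_G n x)%R.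
  rewrite (ergodic_sumD f (fun y => - (s * \1_G y))%R) (ergodic_sumN (fun y => s * \1_G y)%R).
  by rewrite /ergodic_sum mulr_sumr.
have g_N x : exists2 n, (0 < n <= N)%N & (0 <= ergodic_sum g n x)%R.
  have [[n nN sn]|Gx] := pselect (G x); last first.
    exists 1%N => //; rewrite /ergodic_sum big_ord1 /g indicE memNset//= mulr0 subr0.
    exact: f0.
  exists n => //; rewrite gE subr_ge0; apply: le_trans sn; rewrite ler_pM2l//.
  apply: (@le_trans _ _ (\sum_(i < n) 1)%R); last by rewrite sumr_const card_ord.
  by apply: ler_sum => i _; rewrite indicE; case: (_ \in _).
(* The tiled segment may overshoot by one block, hence the length [N + N]. *)
have sumG x : (s * ergodic_sum \1_G N x <= ergodic_sum f (N + N) x)%R.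
  have [m /andP[Nm m2N]] := tiling_orbit g_N N x; rewrite gE subr_ge0 => sm.
  apply: (@le_trans _ _ (s * ergodic_sum \1_G m x)%R).
    by rewrite ler_pM2l//; apply: leq_ergodic_sum => // y; rewrite indicE.
  by apply: (le_trans sm); exact: leq_ergodic_sum.
have G0 x : (0 <= \1_G x :> R)%R by rewrite indicE.
have m1G : measurable_fun setT (\1_G : S -> R) by [].
have NsG : N%:R%:E * (s%:E * mu G) <= A%:E * \int[mu]_x (s * ergodic_sum \1_G N x)%:E.
  under eq_integral do rewrite EFinM.
  rewrite intZ ?(ltW s0)//; last first.
    by apply: Mplus_EFin => [|x]; [exact: measurable_ergodic_sum|exact: ergodic_sum_ge0].
  rewrite int_ergodic_sum// muleCA [leRHS]muleCA; apply: lee_wpmul2l.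
    by rewrite lee_fin ltW.
  rewrite -sum_const_ord// ge0_sume_distrr; last first.
    by move=> i _; apply: integral_ge0 => x _; rewrite lee_fin.
  apply: lee_sum => i _; apply: (le_trans (phi_ge i mG)).
  rewrite -int_indic; last exact: measurable_preimage_iter.
  by rewrite lee_wpmul2l// lee_fin ltW.
have NN0 : (0 < N%:R :> R)%R by rewrite ltr0n.
rewrite -(@lee_pmul2l _ N%:R%:E)//.
apply: (le_trans NsG); apply: (@le_trans _ _ (A%:E * \int[mu]_x (ergodic_sum f (N + N) x)%:E)).
  apply: lee_wpmul2l; first by rewrite lee_fin ltW.
  apply: le_int; last by move=> x; rewrite lee_fin.
    apply: Mplus_EFin => [|x].
      by apply: measurable_funM => //; exact: measurable_ergodic_sum.
    by rewrite mulr_ge0 ?(ltW s0)//; exact: ergodic_sum_ge0.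
  by apply: Mplus_EFin => [|x]; [exact: measurable_ergodic_sum|exact: ergodic_sum_ge0].
apply: (@le_trans _ _ (A%:E * ((N + N)%:R%:E * (A%:E * \int[mu]_x (f x)%:E)))).
  by apply: lee_wpmul2l; [rewrite lee_fin ltW|exact: int_ergodic_sum_le].
rewrite !muleA -!EFinM; apply: lee_wpmul2r; first by apply: int_ge0; exact: Mplus_EFin.
by rewrite lee_fin natrD le_eqVlt; apply/orP; left; apply/eqP; ring.
Qed.

Definition maximal_above f (s : R) : set S :=
  [set x | exists2 n, (0 < n)%N & (s * n%:R <= ergodic_sum f n x)%R].

Lemma ergodic_maximal_inequality f (s : R) : measurable_fun setT f ->
  (forall x, 0 <= f x)%R -> (0 < s)%R ->
  s%:E * mu (maximal_above f s) <= (2 * A ^+ 2)%:E * \int[mu]_x (f x)%:E.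
Proof.
move=> mf f0 s0; rewrite muleC -lee_pdivlMr//.
pose G N := [set x | exists2 n, (0 < n <= N)%N & (s * n%:R <= ergodic_sum f n x)%R].
have mG N : measurable (G N).
  by exact: (measurable_ergodic_above s [set n | 0 < n <= N]%N).
have -> : maximal_above f s = \bigcup_N G N.
  apply/seteqP; split => [x [n n0 sn]|x [N _ [n /andP[n0 _] sn]]].
    by exists n => //; exists n => //; rewrite n0/=.
  by exists n.
apply: (cvge_ub (nondecreasing_cvg_mu mG _ _)).
- exact: bigcupT_measurable.
- move=> m n mn; apply/subsetPset => x [k /andP[k0 km] sk].
  by exists k => //; rewrite k0 (leq_trans km).
- by move=> N; rewrite lee_pdivlMr// muleC; exact: ergodic_maximal_inequality_bounded.
Qed.

End ergodic_sums.

(** * Almost everywhere convergence of ergodic means *)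

Section pointwise_ergodic.
Context (R : realType) d (S : measurableType d) (mu : {measure set S -> \bar R}).
Context (phi : S -> S) (mphi : measurable_fun setT phi).
Local Open Scope ereal_scope.
Context (A : R) (A1 : (1 <= A)%R).
Context (phi_le : forall n (E : set S), measurable E ->
    mu (iter n phi @^-1` E) <= A%:E * mu E)
  (phi_ge : forall n (E : set S), measurable E ->
    mu E <= A%:E * mu (iter n phi @^-1` E)).
Implicit Types (f g : S -> R) (E : set S).
Local Notation sum := (ergodic_sum phi).

Let A0 : (0 < A)%R. Proof. exact: lt_le_trans A1. Qed.

Definition summable_fun f : Prop :=
  measurable_fun setT f /\ \int[mu]_x `|f x|%:E < +oo.

Lemma summable_integrable f : summable_fun f -> mu.-integrable setT (EFin \o f).
Proof.
by move=> [mf ff]; apply/integrableP; split => //; exact/measurable_EFinP.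
Qed.

Lemma summable_bound f g : measurable_fun setT f -> summable_fun g ->
  (forall x, `|f x| <= `|g x|)%R -> summable_fun f.
Proof.
move=> mf [mg gg] fg; split => //; apply: le_lt_trans gg.
by apply: le_int => [||x]; [exact: Mplus_absE|exact: Mplus_absE|rewrite lee_fin].
Qed.

Lemma summable_ergodic_sum f n : summable_fun f -> summable_fun (sum f n).
Proof.
move=> [mf ff]; split; first exact: measurable_ergodic_sum.
have mf' : measurable_fun setT (fun x => `|f x|%R) by exact: measurableT_comp.
apply: (@le_lt_trans _ _ (\int[mu]_x (sum (fun x => `|f x|%R) n x)%:E)).
  apply: le_int => [||x].
  - by apply: Mplus_absE; exact: measurable_ergodic_sum.
  - by apply: Mplus_EFin => [|x]; [exact: measurable_ergodic_sum|exact: ergodic_sum_ge0].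
  - by rewrite lee_fin; exact: normr_ergodic_sum.
apply: (le_lt_trans (int_ergodic_sum_le mphi A1 phi_le n mf' _)) => //.
rewrite muleA -EFinM lte_mul_pinfty// lee_fin mulr_ge0// ltW//.
Qed.

Lemma summable_iter f n : summable_fun f -> summable_fun (f \o iter n phi).
Proof.
move=> [mf ff]; split; first exact: (measurableT_comp mf (measurable_iter mphi n)).
apply: (le_lt_trans (int_iter mphi A1 phi_le n (Mplus_absE mf))).
by rewrite lte_mul_pinfty// lee_fin ltW.
Qed.

(** If every orbit sees a non-negative sum of [g] at some time, then the
integrals of the ergodic sums of [g] are bounded below up to a sublinear error:
a tiling of the orbits fails only where the first such time exceeds [N]. *)
Lemma sublinear_lower_bound g : summable_fun g ->
  (forall x, exists2 n, (0 < n)%N & (0 <= sum g n x)%R) ->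
  forall e : R, (0 < e)%R -> exists K : R, forall L,
    \int[mu]_x (- sum g L x)%:E <= (L%:R * e + K)%:E.
Proof.
move=> [mg gg] gn e e0.
pose B N := ~` [set x | exists2 n, (0 < n <= N)%N & (0 * n%:R <= sum g n x)%R].
have mB N : measurable (B N).
  apply: measurableC.
  exact: (measurable_ergodic_above mphi 0 [set n | 0 < n <= N]%N).
have Bout x N : ~ B N x -> exists2 n, (0 < n <= N)%N & (0 <= sum g n x)%R.
  by move=> /contrapT [n nN]; rewrite mul0r => ?; exists n.
have mag : measurable_fun setT (fun x => `|g x|%R) by exact: measurableT_comp.
have sag : summable_fun (fun x => `|g x|%R).
  by apply: (summable_bound mag (g := g)) => // x; rewrite normr_id.
pose h N x := (`|g x| * \1_(B N) x)%R.
have mh N : measurable_fun setT (h N) by exact: measurable_funM.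
have h0 N x : (0 <= h N x)%R by rewrite mulr_ge0// indicE.
have hg N x : (h N x <= `|g x|)%R by rewrite ler_piMr// indicE; case: (_ \in _).
(* The sets [B N] decrease to the empty set. *)
have [N0 hN] : exists N, \int[mu]_x (h N.+1 x)%:E <= (e / A)%:E.
  have [_ _] : [/\ mu.-integrable setT (fun=> 0 : \bar R),
      \int[mu]_x `|(h n.+1 x)%:E - 0| @[n --> \oo] --> 0 &
      \int[mu]_x (h n.+1 x)%:E @[n --> \oo] --> \int[mu]_x (0 : \bar R)].
    apply: (@dominated_convergence _ _ _ mu setT measurableT _ _ (fun x => `|g x|%:E)) => //.
    - by move=> n; exact/measurable_EFinP.
    - apply: aeW => x _; apply: cvg_near_cst.
      have [n n0 sn] := gn x; exists n => // m /= nm.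
      have nB : ~ B m.+1 x.
        apply; exists n; last by rewrite mul0r.
        by rewrite n0 ltnW.
      by rewrite /h indicE memNset// mulr0.
    - exact: (summable_integrable sag).
    - by apply: aeW => x n _; rewrite gee0_abs ?lee_fin.
  rewrite integral0 => /(_ [set y | y < (e / A)%:E]) [].
    apply: open_nbhs_nbhs; split; first exact: open_ereal_lt_ereal.
    by rewrite /= lte_fin divr_gt0.
  by move=> N _ /(_ N (leqnn N)) /= /ltW ?; exists N.
set N := N0.+1 in hN.
(* The contribution of the last block, of [h N] as well as of [g], which sits
   at the end of the segment and does not grow with its length. *)
pose K := (2 * (A * (N%:R * (A * fine (\int[mu]_x `|g x|%:E)))))%R.
exists K => L.
(* Adding [h N] makes single steps from [B N] non-negative blocks. *)
have w_N x : exists2 n, (0 < n <= N)%N & (0 <= sum (g \+ h N) n x)%R.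
  have [Bx|/Bout[n nN sn]] := pselect (B N x).
    exists 1%N => //; rewrite /ergodic_sum big_ord1 /= /h indicE mem_set// mulr1.
    by have := ler_norm (- g x)%R; rewrite normrN => ?; lra.
  exists n => //; rewrite ergodic_sumD addr_ge0//; exact: ergodic_sum_ge0.
have key x : (- sum g L x <= sum (h N) L x + 2 * sum (fun y => `|g y|%R) N (iter L phi x))%R.
  have [m /andP[Lm mL] sm] := tiling_orbit w_N L x.
  rewrite -subr_ge0 opprK; apply: (le_trans sm).
  rewrite -(subnKC Lm); set k := (m - L)%N.
  have kN : (k <= N)%N by rewrite leq_subLR.
  have -> : sum (g \+ h N)%R (L + k) x = (sum (g \+ h N) L x + sum (g \+ h N) k (iter L phi x))%R.
    rewrite /ergodic_sum big_split_ord/=; congr (_ + _)%R.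
    by apply: eq_bigr => i _; rewrite addnC iterD.
  have gk : (sum g k (iter L phi x) <= sum (fun y => `|g y|%R) N (iter L phi x))%R.
    apply: (@le_trans _ _ (sum (fun y => `|g y|%R) k (iter L phi x))%R).
      by apply: ler_ergodic_sum => y; exact: ler_norm.
    exact: leq_ergodic_sum.
  have hk : (sum (h N) k (iter L phi x) <= sum (fun y => `|g y|%R) N (iter L phi x))%R.
    apply: (@le_trans _ _ (sum (fun y => `|g y|%R) k (iter L phi x))%R).
      exact: ler_ergodic_sum.
    exact: leq_ergodic_sum.
  by rewrite !ergodic_sumD; lra.
have sh : Mplus (fun x => (sum (h N) L x)%:E).
  by apply: Mplus_EFin => [|x]; [exact: measurable_ergodic_sum|exact: ergodic_sum_ge0].
have sg : Mplus (fun x => (sum (fun y => `|g y|%R) N x)%:E).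
  by apply: Mplus_EFin => [|x]; [exact: measurable_ergodic_sum|exact: ergodic_sum_ge0].
have sg' := Mplus_comp (measurable_iter mphi L) sg.
have s2g : Mplus (fun x => 2%:E * (sum (fun y => `|g y|%R) N (iter L phi x))%:E).
  exact: MplusZ.
apply: (@le_trans _ _ (\int[mu]_x ((sum (h N) L x)%:E + 2%:E * (sum (fun y => `|g y|%R) N (iter L phi x))%:E))).
  have sL := summable_ergodic_sum L (conj mg gg).
  have sN : summable_fun (fun x => sum (fun y => `|g y|%R) N (iter L phi x)).
    exact: (summable_iter L (summable_ergodic_sum N sag)).
  have shL : summable_fun (sum (h N) L).
    apply: summable_ergodic_sum; apply: (summable_bound (mh N) sag) => x.
    by rewrite normr_id ger0_norm.
  apply: le_integral => //.
  - exact: (integrableN (summable_integrable sL)).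
  - apply: integrableD => //; first exact: (summable_integrable shL).
    exact: (integrableZl measurableT 2 (summable_integrable sN)).
  - by move=> x _; rewrite -EFinM -EFinD lee_fin.
rewrite intD// intZ// [leRHS]EFinD. apply: leeD.
  apply: (le_trans (int_ergodic_sum_le mphi A1 phi_le L (mh N) (h0 N))).
  rewrite EFinM; apply: lee_wpmul2l; first by rewrite lee_fin.
  by rewrite muleC -lee_pdivlMr// EFinM in hN *.
have gfin : \int[mu]_x `|g x|%:E = (fine (\int[mu]_x `|g x|%:E))%:E.
  by rewrite fineK// ge0_fin_numE// int_ge0//; exact: Mplus_absE.
rewrite /K !EFinM -gfin; apply: lee_wpmul2l => //.
apply: (le_trans (int_iter mphi A1 phi_le L sg)); apply: lee_wpmul2l.
  by rewrite lee_fin ltW.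
exact: int_ergodic_sum_le.
Qed.
End pointwise_ergodic.

Section real_sequences.
Context (R : realType).
Implicit Types (u : nat -> R).

(** The averages of [s] have an upper limit strictly greater than [b]; the margin
makes this insensitive to bounded changes of [s], see [exceeds_shift]. *)
Definition exceeds (s : nat -> R) (b : R) : Prop :=
  exists k, forall N, exists2 n, (N <= n)%N & (b + k.+1%:R^-1) * n%:R <= s n.

(** The upper limit is finite by boundedness, and it is the limit: otherwise a
rational interval just below it would be crossed infinitely often. *)
Lemma cvg_of_no_oscillation (s : nat -> R) (C : R) :
  (forall n, `|s n| <= C * n%:R) ->
  (forall a b : rat, a < b ->
    ~ (exceeds s (ratr b) /\ exceeds (\- s) (- ratr a))) ->
  cvgn (fun n => n%:R^-1 * s n).
Proof.
move=> sC osc; pose u n := n%:R^-1 * s n.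
have uE n : (0 < n)%N -> s n = u n * n%:R.
  by move=> n0; rewrite /u mulrAC mulVf ?mul1r// pnatr_eq0 -lt0n.
have uC n : `|u n| <= C.
  rewrite /u normrM ger0_norm ?invr_ge0//; case: n => [|n]; last first.
    by rewrite ler_pdivrMl ?ltr0n// mulrC.
  by rewrite invr0 mul0r; have := sC 1%N; rewrite mulr1; exact: le_trans.
pose Q := [set r : R | forall N, exists2 n, (N <= n)%N & r <= u n].
have Qnonempty : Q !=set0.
  by exists (- C) => N; exists N => //; have := uC N; rewrite ler_norml => /andP[].
have Qub : ubound Q C.
  by move=> r /(_ 0%N)[n _ /le_trans]; apply; have := uC n; rewrite ler_norml => /andP[].
have hsQ : has_sup Q by split => //; exists C.
(* The upper limit of the averages. *)
pose l := sup Q.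
have Qdown r : r < l -> Q r.
  move=> rl; have lr0 : 0 < l - r by rewrite subr_gt0.
  have [q Qq rq] := sup_adherent lr0 hsQ.
  move=> N; have [n Nn qn] := Qq N; exists n => //; apply: le_trans qn.
  by move: rq; rewrite opprB addrC subrK => /ltW.
apply/cvg_ex; exists l; apply/cvgrPdist_le => /= e e0.
have up : \forall n \near \oo, u n <= l + e.
  have : ~ Q (l + e).
    move=> Qle; have : l + e <= l by exact: sup_ubound hsQ.2 _ Qle.
    by rewrite gerDl leNgt e0.
  move=> /existsNP[N nN]; exists N => // n /= Nn.
  by rewrite leNgt; apply/negP => /ltW le_un; apply: nN; exists n.
have down : \forall n \near \oo, l - e <= u n.
  have le2 : l - e < l - e / 2 by rewrite ltrD2l ltrN2 gtr_pMr// invf_lt1// ltr1n.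
  have [b] := rat_in_itvoo le2; rewrite in_itv/= => /andP[eb bl].
  have [a] := rat_in_itvoo eb; rewrite in_itv/= => /andP[ea ab].
  have ab' : a < b by rewrite -(ltr_rat R).
  have [k bk] := ltr_add_invr bl.
  have hb : exceeds s (ratr b).
    have bl' : ratr b + k.+1%:R^-1 < l.
      by apply: (lt_trans bk); rewrite ltrBlDr ltrDl divr_gt0.
    exists k => N; have [n Nn un] := Qdown _ bl' N.+1.
    exists n; first exact: ltnW.
    by rewrite uE ?ler_pM2r ?ltr0n// (leq_trans _ Nn).
  have /not_andP[//|ha] := osc _ _ ab'.
  have [m am] := ltr_add_invr ea.
  move: ha => /forallNP/(_ m)/existsNP[N nN]; exists N.+1 => // n /= Nn.
  rewrite leNgt; apply/negP => une; apply: nN; exists n; first exact: ltnW.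
  have n0 : (0 < n)%N by exact: leq_trans Nn.
  rewrite [leRHS](_ : _ = - u n * n%:R); last by rewrite mulNr -uE.
  rewrite ler_pM2r ?ltr0n// lerNr opprD opprK lerBrDr.
  by apply/ltW; apply: lt_trans am; rewrite ltrD2r.
near=> n; rewrite ler_distlC; apply/andP; split.
  by near: n; exact: down.
by near: n; exact: up.
Unshelve. all: by end_near. Qed.

End real_sequences.

Section exceeds.
Context (R : realType).

(** Shifting the orbit by one step changes sums by a constant, which is absorbed
by passing to a slightly smaller margin. *)
Lemma exceeds_shift (s t : nat -> R) (c b : R) :
  (forall n, s n.+1 = c + t n) -> exceeds s b <-> exceeds t b.
Proof.
move=> st.
have margin (k : nat) (r : R) : exists M : nat, forall n, (M <= n)%N ->
    r <= (k.+1%:R^-1 - k.+2%:R^-1) * n%:R.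
  have dk : 0 < k.+1%:R^-1 - k.+2%:R^-1 :> R.
    by rewrite subr_gt0 ltf_pV2 ?posrE ?ltr0n// ltr_nat.
  exists (Num.trunc (Num.max 0 (r / (k.+1%:R^-1 - k.+2%:R^-1)))).+1 => n Mn.
  rewrite mulrC -ler_pdivrMr//; apply: (@le_trans _ _ (Num.max 0 (r / (k.+1%:R^-1 - k.+2%:R^-1)))).
    by rewrite le_max lexx orbT.
  apply: (@le_trans _ _ (Num.trunc (Num.max 0 (r / (k.+1%:R^-1 - k.+2%:R^-1)))).+1%:R).
    by apply/ltW/truncnS_gt.
  by rewrite ler_nat.
split=> -[k bk]; exists k.+1 => N.
- have [M hM] := margin k (c - (b + k.+2%:R^-1)).
  have [n nN sn] := bk (N + M).+1.
  case: n nN sn => // n; rewrite ltnS => nN; rewrite st => sn.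
  exists n; first by rewrite (leq_trans _ nN)// leq_addr.
  have := hM n.+1 (leq_trans (leq_addl _ _) (leqW nN)).
  have nE : n.+1%:R = n%:R + 1 :> R by rewrite natr1.
  rewrite nE in sn *.
  move: (t n) (n%:R)%R (k.+1%:R^-1)%R (k.+2%:R^-1)%R sn => z y p q tn pq; nra.
- have [M hM] := margin k (b + k.+2%:R^-1 - c).
  have [n nN tn] := bk (N + M)%N.
  exists n.+1; first by rewrite (leq_trans _ (leqW nN))// leq_addr.
  have nE : n.+1%:R = n%:R + 1 :> R by rewrite natr1.
  rewrite st nE; have := hM n (leq_trans (leq_addl _ _) nN).
  move: (t n) (n%:R)%R (k.+1%:R^-1)%R (k.+2%:R^-1)%R tn => z y p q tn pq; nra.
Qed.

End exceeds.

Section pointwise_ergodic_theorem.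
Context (R : realType) d (S : measurableType d) (mu : {measure set S -> \bar R}).
Context (phi : S -> S) (mphi : measurable_fun setT phi).
Local Open Scope ereal_scope.
Context (A : R) (A1 : (1 <= A)%R).
Context (phi_le : forall n (E : set S), measurable E ->
    mu (iter n phi @^-1` E) <= A%:E * mu E)
  (phi_ge : forall n (E : set S), measurable E ->
    mu E <= A%:E * mu (iter n phi @^-1` E)).
Implicit Types (f g : S -> R) (E : set S).
Local Notation sum := (ergodic_sum phi).

Lemma summableD f g : summable_fun mu f -> summable_fun mu g ->
  summable_fun mu (fun x => f x + g x)%R.
Proof.
move=> [mf ff] [mg gg]; split; first exact: measurable_funD.
apply: (@le_lt_trans _ _ (\int[mu]_x (`|f x|%:E + `|g x|%:E))); last first.
  by rewrite intD; [exact: lte_add_pinfty|exact: Mplus_absE|exact: Mplus_absE].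
apply: le_int => [||x].
- by apply: Mplus_absE; exact: measurable_funD.
- by apply: MplusD; exact: Mplus_absE.
- by rewrite -EFinD lee_fin ler_normD.
Qed.

Lemma summable_indic E (c : R) : measurable E -> mu E < +oo ->
  summable_fun mu (fun x => c * \1_E x)%R.
Proof.
move=> mE Efin; have mcE : measurable_fun setT (fun x => c * \1_E x : R)%R.
  exact: measurable_funM.
split => //; apply: (@le_lt_trans _ _ (\int[mu]_x (`|c|%:E * (\1_E x)%:E))).
  apply: le_int => [||x]; first exact: Mplus_absE.
    by apply: MplusZ => //; exact: Mplus_indic.
  by rewrite -EFinM lee_fin normrM [X in (_ * X)%R]ger0_norm// indicE.
rewrite intZ//; last exact: Mplus_indic.
by rewrite int_indic// lte_mul_pinfty// lee_fin.
Qed.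

Lemma ergodic_sum_indic f E n x : (forall y, E (phi y) <-> E y) ->
  sum (fun y => f y * \1_E y)%R n x = (sum f n x * \1_E x)%R.
Proof.
move=> Einv; rewrite /ergodic_sum mulr_suml; apply: eq_bigr => i _.
congr (_ * _)%R; rewrite !indicE; congr (_%:R : R); congr nat_of_bool.
elim: (nat_of_ord i) => // {i}k; rewrite iterS => <-.
by apply/idP/idP; rewrite !inE => /Einv.
Qed.

(** On [E] both [f - b] and [a - f] see non-negative sums along every orbit, and
invariance keeps this true after multiplying by the indicator of [E].  The lower
bounds for the two functions add up to a lower bound for the constant [a - b] on
[E]: over [L] steps, [(b - a) * mu E * L] grows slower than linearly in [L]. *)
Lemma invariant_oscillation_null f (a b : R) E : summable_fun mu f -> (a < b)%R ->
  measurable E -> (forall x, E (phi x) <-> E x) -> mu E < +oo ->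
  (forall x, E x -> exists2 n, (0 < n)%N & (b * n%:R <= sum f n x)%R) ->
  (forall x, E x -> exists2 n, (0 < n)%N & (sum f n x <= a * n%:R)%R) ->
  mu E = 0.
Proof.
move=> sf ab mE Einv Efin Eb Ea.
have sumc (c : R) n x : sum (fun=> c) n x = (c * n%:R)%R.
  by rewrite /ergodic_sum sumr_const card_ord mulr_natr.
pose g1 x := ((f x - b) * \1_E x)%R; pose g2 x := ((a - f x) * \1_E x)%R.
have sfE : summable_fun mu (fun x => f x * \1_E x)%R.
  have [mf ff] := sf.
  apply: (summable_bound _ sf) => [|x]; first exact: measurable_funM.
  by rewrite normrM ler_piMr// indicE; case: (_ \in _); rewrite ?normr1 ?normr0.
have sNf : summable_fun mu (fun x => - (f x * \1_E x))%R.
  have [mf ff] := sfE.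
  by apply: (summable_bound _ sfE) => [|x]; [exact: measurable_funN|rewrite normrN].
have s1 : summable_fun mu g1.
  have := summableD sfE (summable_indic (- b)%R mE Efin).
  by rewrite (_ : (fun x => _) = g1)//; apply/funext => x; rewrite /g1 mulrDl mulNr.
have s2 : summable_fun mu g2.
  have := summableD sNf (summable_indic a mE Efin).
  by rewrite (_ : (fun x => _) = g2)//; apply/funext => x; rewrite /g2 mulrBl addrC.
have g1E n x : sum g1 n x = ((sum f n x - b * n%:R) * \1_E x)%R.
  by rewrite ergodic_sum_indic// (ergodic_sumD _ f (fun=> - b)%R) sumc mulNr.
have g2E n x : sum g2 n x = ((a * n%:R - sum f n x) * \1_E x)%R.
  by rewrite ergodic_sum_indic// (ergodic_sumD _ (fun=> a) (\- f)%R) sumc ergodic_sumN.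
have n1 x : exists2 n, (0 < n)%N & (0 <= sum g1 n x)%R.
  have [Ex|Ex] := pselect (E x); last by exists 1%N; rewrite // g1E indicE memNset// mulr0.
  have [n n0 bn] := Eb x Ex; exists n => //.
  by rewrite g1E indicE mem_set// mulr1 subr_ge0.
have n2 x : exists2 n, (0 < n)%N & (0 <= sum g2 n x)%R.
  have [Ex|Ex] := pselect (E x); last by exists 1%N; rewrite // g2E indicE memNset// mulr0.
  have [n n0 bn] := Ea x Ex; exists n => //.
  by rewrite g2E indicE mem_set// mulr1 subr_ge0.
have m0 : 0 <= mu E by [].
have [m mE'] : exists m : R, mu E = m%:E.
  by exists (fine (mu E)); rewrite fineK// ge0_fin_numE.
rewrite mE' lee_fin in m0 *; congr EFin; apply/le_anti; rewrite m0 andbT.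
suff h e : (0 < e)%R -> ((b - a) * m <= e + e)%R.
  rewrite -(pmulr_rle0 _ (_ : 0 < b - a)%R) ?subr_gt0//.
  apply/ler_addgt0Pr => e e0; rewrite add0r; have e2 : (0 < e / 2)%R by rewrite divr_gt0.
  by apply: (le_trans (h _ e2)); rewrite -splitr.
move=> e0.
have [K1 h1] := sublinear_lower_bound mphi A1 phi_le s1 n1 e0.
have [K2 h2] := sublinear_lower_bound mphi A1 phi_le s2 n2 e0.
have hL L : ((b - a) * m * L%:R <= (e + e) * L%:R + (K1 + K2))%R.
  rewrite -lee_fin; apply: (@le_trans _ _ ((L%:R * e + K1)%:E + (L%:R * e + K2)%:E)); last first.
    by rewrite -EFinD lee_fin le_eqVlt; apply/orP; left; apply/eqP; ring.
  apply: le_trans (leeD (h1 L) (h2 L)).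
  rewrite -integralD//; last 2 first.
  - exact: (integrableN (summable_integrable (summable_ergodic_sum mphi A1 phi_le L s1))).
  - exact: (integrableN (summable_integrable (summable_ergodic_sum mphi A1 phi_le L s2))).
  rewrite [leRHS](_ : _ = \int[mu]_x (((b - a) * L%:R)%:E * (\1_E x)%:E)).
    rewrite intZ ?mulr_ge0 ?subr_ge0 ?(ltW ab)//; last exact: Mplus_indic.
    by rewrite int_indic// mE' -EFinM lee_fin mulrAC.
  apply: eq_integral => x _; rewrite -EFinD -EFinM g1E g2E; congr EFin; ring.
rewrite leNgt; apply/negP => lt.
pose z := ((b - a) * m - (e + e))%R; have z0 : (0 < z)%R by rewrite subr_gt0.
have := truncnS_gt (Num.max 0 ((K1 + K2) / z))%R; set L := (Num.trunc _).+1 => KL.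
have KL' : (K1 + K2 < z * L%:R)%R.
  by rewrite mulrC -ltr_pdivrMr//; apply: le_lt_trans KL; rewrite le_max lexx orbT.
have := hL L; apply/negP; rewrite -ltNge.
by move: KL'; rewrite /z mulrBl; move: (_ * L%:R)%R (_ * L%:R)%R => *; lra.
Qed.

Definition oscillation f (a b : R) : set S :=
  [set x | exceeds (sum f ^~ x) b] `&` [set x | exceeds (sum (\- f)%R ^~ x) (- a)%R].

Lemma measurable_exceeds f (b : R) : measurable_fun setT f ->
  measurable [set x | exceeds (sum f ^~ x) b].
Proof.
move=> mf; rewrite (_ : mkset _ = \bigcup_k \bigcap_N [set x |
    exists2 n, (N <= n)%N & ((b + k.+1%:R^-1) * n%:R <= sum f n x)%R]).
  apply: bigcupT_measurable => k; apply: bigcapT_measurable => N.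
  exact: (measurable_ergodic_above mphi _ [set n | N <= n]%N).
apply/seteqP; split => [x [k bk]|x [k _ bk]]; exists k => // N.
  by move=> _; exact: bk.
exact: (bk N).
Qed.

(** The set is invariant, and of finite measure by the maximal inequality for the
modulus of [f] at the level [Num.max b (- a)], which is positive. *)
Lemma oscillation_null f (a b : R) : summable_fun mu f -> (a < b)%R ->
  measurable (oscillation f a b) /\ mu (oscillation f a b) = 0.
Proof.
move=> sf ab; have [mf ff] := sf.
have mosc : measurable (oscillation f a b).
  by apply: measurableI; apply: measurable_exceeds => //; exact: measurable_funN.
split => //; have k0 k : (0 < k.+1%:R^-1 :> R)%R by rewrite invr_gt0.
have hi x : oscillation f a b x -> exists2 n, (0 < n)%N & (b * n%:R < sum f n x)%R.
  move=> [[k /(_ 1%N)[n n0 bn]] _]; exists n => //; apply: lt_le_trans bn.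
  by rewrite ltr_pM2r ?ltr0n// ltrDl.
have lo x : oscillation f a b x -> exists2 n, (0 < n)%N & (sum f n x < a * n%:R)%R.
  move=> [_ [k /(_ 1%N)[n n0 bn]]]; exists n => //.
  rewrite -ltrN2 -ergodic_sumN; apply: lt_le_trans bn.
  by rewrite -mulNr ltr_pM2r ?ltr0n// ltrDl.
apply: (invariant_oscillation_null sf ab mosc).
- have inv g c x : exceeds (sum g ^~ x) c <-> exceeds (sum g ^~ (phi x)) c.
    by apply: (@exceeds_shift _ _ _ (g x)) => n; rewrite ergodic_sumS.
  move=> x; split=> -[h1 h2].
    by split; [exact: (inv f b x).2 h1|exact: (inv (\- f)%R (- a)%R x).2 h2].
  by split; [exact: (inv f b x).1 h1|exact: (inv (\- f)%R (- a)%R x).1 h2].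
- pose c := Num.max b (- a)%R.
  have c0 : (0 < c)%R.
    by rewrite lt_max; case: (ltP 0%R b) => //= b0; rewrite oppr_gt0 (lt_le_trans ab).
  have maf : measurable_fun setT (fun x => `|f x|%R) by exact: measurableT_comp.
  have := ergodic_maximal_inequality mphi A1 phi_le phi_ge maf (fun x => normr_ge0 _) c0.
  set M := maximal_above _ _ _ => Mle.
  have oM : oscillation f a b `<=` M.
    move=> x ox; have [bc|ac] := leP b (- a)%R.
      have [n n0 sn] := lo x ox; exists n => //.
      rewrite /c max_r//; apply: le_trans (normr_ergodic_sum phi f n x).
      by rewrite ler_normr; apply/orP; right; rewrite mulNr lerN2 ltW.
    have [n n0 sn] := hi x ox; exists n => //.
    rewrite /c max_l ?(ltW ac)//; apply: le_trans (normr_ergodic_sum phi f n x).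
    by rewrite ler_normr ltW.
  have mM : measurable M by exact: (measurable_ergodic_above mphi c [set n | 0 < n]%N).
  apply: (@le_lt_trans _ _ (mu M)); first by apply: le_measure; rewrite ?inE.
  rewrite -(@lte_pmul2l _ c%:E)// ; apply: (le_lt_trans Mle).
  rewrite gt0_muley ?lte_fin// lte_mul_pinfty// lee_fin mulr_ge0// sqr_ge0//.
- by move=> x /hi[n n0 /ltW bn]; exists n.
- by move=> x /lo[n n0 /ltW bn]; exists n.
Qed.

Definition ergodic_average f n x : R := (n%:R^-1 * sum f n x)%R.

(** The maximal inequality makes the averages of a summable function bounded
almost everywhere, and no rational interval is crossed infinitely often. *)
Theorem summable_averages_cvg f : summable_fun mu f ->
  {ae mu, forall x, cvgn (fun n => ergodic_average f n x)}.
Proof.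
move=> sf; have [mf ff] := sf.
have maf : measurable_fun setT (fun x => `|f x|%R) by exact: measurableT_comp.
pose M m := maximal_above phi (fun x => `|f x|%R) m.+1%:R.
have mM m : measurable (M m).
  exact: (measurable_ergodic_above mphi m.+1%:R [set n | 0 < n]%N).
have bounded_ae : {ae mu, forall x, ~ (\bigcap_m M m) x}.
  have mI : measurable (\bigcap_m M m) by exact: bigcapT_measurable.
  exists (\bigcap_m M m); split => //; last by move=> x /= /contrapT.
  apply/eqP; rewrite eq_le measure_ge0 andbT; apply/lee_addgt0Pr => e e0; rewrite add0e.
  pose C := fine ((2 * A ^+ 2)%:E * \int[mu]_x `|f x|%:E).
  have CE : (2 * A ^+ 2)%:E * \int[mu]_x `|f x|%:E = C%:E.
    have A20 : (0 <= 2 * A ^+ 2)%R by rewrite mulr_ge0// sqr_ge0.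
    rewrite fineK// ge0_fin_numE ?lte_mul_pinfty// mule_ge0//.
    by apply: int_ge0; exact: Mplus_absE.
  pose m := Num.trunc (Num.max 0 (C / e))%R.
  have Cm : (C < m.+1%:R * e)%R.
    rewrite -ltr_pdivrMr//; apply: le_lt_trans (truncnS_gt _).
    by rewrite le_max lexx orbT.
  apply: (@le_trans _ _ (mu (M m))).
    by apply: le_measure; rewrite ?inE//; exact: bigcap_inf.
  rewrite -(@lee_pmul2l _ m.+1%:R%:E)//.
  apply: (le_trans (ergodic_maximal_inequality mphi A1 phi_le phi_ge maf _ _)) => //.
  by rewrite CE -EFinM lee_fin ltW.
have osc_ae : {ae mu, forall x, forall k : nat,
    if @unpickle (rat * rat)%type k is Some (a, b) then
    (a < b)%R -> ~ oscillation f (ratr a) (ratr b) x else True}.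
  apply: ae_foralln => k; case: unpickle => [[a b]|]; last exact: aeW.
  have [ab|ab] := boolP (a < b)%R; last by apply: aeW.
  have rab : (ratr a < ratr b :> R)%R by rewrite ltr_rat.
  have [mo o0] := oscillation_null sf rab.
  by exists (oscillation f (ratr a) (ratr b)); split => // x /= /not_implyP[_ /contrapT].
apply: filterS2 bounded_ae osc_ae => x /existsNP[m /not_implyP[_ Mx]] osc.
apply: (@cvg_of_no_oscillation _ _ m.+1%:R) => [n|a b ab].
  case: n => [|n]; first by rewrite /ergodic_sum big_ord0 normr0 mulr0.
  apply: (le_trans (normr_ergodic_sum phi f n.+1 x)); rewrite leNgt; apply/negP => lt.
  by apply: Mx; exists n.+1 => //; exact: ltW.
move=> [hb ha]; have := osc (pickle (a, b)); rewrite pickleK => /(_ ab); apply.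
split => //; rewrite /mkset (_ : _ ^~ x = (\- (sum f ^~ x))%R)//.
by apply/funext => n; exact: ergodic_sumN.
Qed.

End pointwise_ergodic_theorem.

(** * Convergence of ergodic means in a gauge *)

Section tame.
Context (R : realType) d (S : measurableType d) (mu : {measure set S -> \bar R}).
Context (phi : S -> S) (mphi : measurable_fun setT phi).
Local Open Scope ereal_scope.
Context (A : R) (A1 : (1 <= A)%R).
Context (phi_le : forall n (E : set S), measurable E ->
    mu (iter n phi @^-1` E) <= A%:E * mu E)
  (phi_ge : forall n (E : set S), measurable E ->
    mu E <= A%:E * mu (iter n phi @^-1` E)).
Implicit Types (f g r : S -> R) (E : set S).
Local Notation sum := (ergodic_sum phi).
Local Notation avg := (ergodic_average phi).

(** The functions handled by splitting off their large values, which are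
summable, from a uniformly small remainder. *)
Record tame r : Prop := Tame {
  tame_measurable : measurable_fun setT r ;
  tame_vanishing : forall e : R, (0 < e)%R -> mu [set x | (e < `|r x|)%R] < +oo ;
  tame_summable : forall E, measurable E -> mu E < +oo ->
    summable_fun mu (fun x => r x * \1_E x)%R }.

Lemma measurable_large r (e : R) : measurable_fun setT r ->
  measurable [set x | (e < `|r x|)%R].
Proof.
move=> mr; rewrite -[X in measurable X]setTI.
by apply: measurable_fun_ltr => //; exact: measurableT_comp.
Qed.

Lemma ergodic_averageD f g n x : avg (f \+ g)%R n x = (avg f n x + avg g n x)%R.
Proof. by rewrite /ergodic_average ergodic_sumD mulrDr. Qed.

Lemma measurable_average f n : measurable_fun setT f -> measurable_fun setT (avg f n).
Proof. by move=> mf; apply: measurable_funM => //; exact: measurable_ergodic_sum. Qed.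

Lemma average_bound f (b : R) n x : (0 <= b)%R -> (forall y, `|f y| <= b)%R ->
  (`|avg f n x| <= b)%R.
Proof.
move=> b0 fb; rewrite /ergodic_average normrM ger0_norm ?invr_ge0//.
case: n => [|n]; first by rewrite invr0 mul0r.
rewrite ler_pdivrMl ?ltr0n//; apply: (le_trans (normr_ergodic_sum _ _ _ _)).
apply: (@le_trans _ _ (\sum_(i < n.+1) b)%R); first exact: ler_sum.
by rewrite sumr_const card_ord mulr_natl.
Qed.

Lemma cvgn_of_approx (u : nat -> R) :
  (forall e : R, (0 < e)%R -> exists2 v : nat -> R, cvgn v &
    forall n, (`|u n - v n| <= e)%R) -> cvgn u.
Proof.
move=> uv; apply/cauchy_cvgP/cauchyP => e e0.
have e2 : (0 < e / 2)%R by rewrite divr_gt0.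
have [v /cvg_ex[/= l vl] uvn] := uv _ e2.
exists l; have /cvgrPdist_lt/(_ _ e2) := vl; apply: filterS => n vn /=.
rewrite /ball/=; rewrite (_ : l - u n = (l - v n) - (u n - v n))%R; last by ring.
apply: (le_lt_trans (ler_normB _ _)); rewrite [ltRHS]splitr.
exact: ltr_leD.
Qed.

(** The part of [r] below a level has averages below that level, so the averages of
[r] are uniform limits of averages of summable functions. *)
Theorem tame_averages_cvg r : tame r ->
  {ae mu, forall x, cvgn (fun n => avg r n x)}.
Proof.
move=> tr; pose E k := [set x | (k.+1%:R^-1 < `|r x|)%R].
have k0 k : (0 < k.+1%:R^-1 :> R)%R by rewrite invr_gt0.
have mE k : measurable (E k) by apply: measurable_large; exact: tame_measurable tr.
have sE k : summable_fun mu (fun x => r x * \1_(E k) x)%R.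
  by apply: (tame_summable tr) => //; exact: tame_vanishing.
have : {ae mu, forall x, forall k, cvgn (fun n => avg (fun x => r x * \1_(E k) x)%R n x)}.
  by apply: ae_foralln => k; exact: (summable_averages_cvg mphi A1 phi_le phi_ge (sE k)).
apply: filterS => x cE; apply: cvgn_of_approx => e e0.
have [k] := ltr_add_invr e0; rewrite add0r => /ltW ke.
exists (fun n => avg (fun x => r x * \1_(E k) x)%R n x); first exact: cE.
move=> n; apply: le_trans ke.
have -> : (avg r n x - avg (fun x => r x * \1_(E k) x) n x =
    avg (fun x => r x - r x * \1_(E k) x) n x)%R.
  rewrite (ergodic_averageD r (fun x => - (r x * \1_(E k) x))%R); congr (_ + _)%R.
  by rewrite /ergodic_average ergodic_sumN mulrN.
apply: average_bound; [exact: ltW|move=> y].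
rewrite indicE; case: (boolP (y \in E k)) => [_|/negP yE].
  by rewrite mulr1 subrr normr0 ltW.
rewrite mulr0 subr0 leNgt; apply/negP => ky; apply: yE; rewrite inE; exact: ky.
Qed.

(** Taken as an upper limit so that it is measurable even where the averages
diverge. *)
Definition ergodic_limit r x : R := fine (limn_esup (fun n => (avg r n x)%:E)).

Lemma ergodic_limitE r x (l : R) : avg r n x @[n --> \oo] --> l ->
  ergodic_limit r x = l.
Proof.
by move=> /cvgn_EFin/cvg_limn_einf_sup[_ e]; rewrite /ergodic_limit e.
Qed.

Lemma cvg_ergodic_limit r x : cvgn (fun n => avg r n x) ->
  avg r n x @[n --> \oo] --> ergodic_limit r x.
Proof. by move=> /cvg_ex[l rl]; rewrite (ergodic_limitE rl). Qed.

Lemma measurable_ergodic_limit r : measurable_fun setT r ->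
  measurable_fun setT (ergodic_limit r).
Proof.
move=> mr; apply: measurableT_comp => //; apply: measurable_fun_limn_esup => n.
by apply/measurable_EFinP; exact: measurable_average.
Qed.

End tame.

Section gauge_convergence.
Context (R : realType) d (S : measurableType d) (mu : {measure set S -> \bar R}).
Context (phi : S -> S) (mphi : measurable_fun setT phi).
Local Open Scope ereal_scope.
Context (A : R) (A1 : (1 <= A)%R).
Context (phi_le : forall n (E : set S), measurable E ->
    mu (iter n phi @^-1` E) <= A%:E * mu E)
  (phi_ge : forall n (E : set S), measurable E ->
    mu E <= A%:E * mu (iter n phi @^-1` E)).
Context (res : resonant mu) (H : set (S -> \bar R)) (sH : rearr_stable mu H).
Implicit Types (f g r : S -> R) (E F : set S) (u : S -> \bar R).
Local Notation sum := (ergodic_sum phi).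
Local Notation avg := (ergodic_average phi).
Local Notation lim := (ergodic_limit phi).
Local Notation p := (gauge mu H).

Let A0 : (0 < A)%R. Proof. exact: lt_le_trans A1. Qed.

(** The upper bound on preimages is a bound on distribution functions. *)
Lemma gauge_iter n u : Mplus u -> p (u \o iter n phi) <= A%:E * p u.
Proof.
move=> Mu; have mi := measurable_iter mphi n.
apply: gauge_dilation => //; first exact: Mplus_comp.
move=> s s0; rewrite !distrE//; last exact: Mplus_comp.
exact: (phi_le n (measurable_gte s%:E Mu)).
Qed.

Lemma gauge_average n r : measurable_fun setT r ->
  p (absE (avg r n)) <= A%:E * p (absE r).
Proof.
move=> mr; have Mr := Mplus_absE mr.
have p0 : 0 <= A%:E * p (absE r) by rewrite mule_ge0 ?lee_fin ?(ltW A0)// (gauge_ge0 sH).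
have n0 : (0 <= n%:R^-1 :> R)%R by rewrite invr_ge0.
have Mi (i : 'I_n) : Mplus (absE r \o iter i phi).
  by apply: Mplus_comp => //; exact: measurable_iter.
apply: (@le_trans _ _ (p (fun x => n%:R^-1%:E * \sum_(i < n) (absE r \o iter i phi) x))).
  apply: (gauge_mono sH).
  - by apply: Mplus_absE; exact: measurable_average.
  - by apply: MplusZ => //; exact: Mplus_sum.
  - apply: aeW => x; rewrite /absE/= sumEFin -EFinM lee_fin normrM ger0_norm//.
    by apply: ler_wpM2l => //; exact: normr_ergodic_sum.
apply: (le_trans (gaugeZ sH n0 (Mplus_sum _ Mi))).
apply: (@le_trans _ _ (n%:R^-1%:E * (n%:R%:E * (A%:E * p (absE r))))).
  apply: lee_wpmul2l; first by rewrite lee_fin.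
  apply: (le_trans (gauge_sum sH Mi)); rewrite -sum_const_ord//.
  by apply: lee_sum => i _; exact: gauge_iter.
rewrite muleA -EFinM; case: n {n0 Mi} => [|n]; first by rewrite mulr0 mul0e.
by rewrite mulVf ?mul1e.
Qed.

Lemma gauge_limit r : measurable_fun setT r ->
  {ae mu, forall x, cvgn (fun n => avg r n x)} ->
  p (absE (lim r)) <= A%:E * p (absE r).
Proof.
move=> mr cr; apply: (gauge_fatou sH (u_ := fun n => absE (avg r n))).
- by move=> n; apply: Mplus_absE; exact: measurable_average.
- by apply: Mplus_absE; exact: measurable_ergodic_limit.
- apply: filterS cr => x /cvg_ergodic_limit cx; apply: cvgn_EFin.
  exact: cvg_norm.
- by move=> n; exact: gauge_average.
Qed.

Lemma int_average n r : measurable_fun setT r ->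
  \int[mu]_x absE (avg r n) x <= A%:E * \int[mu]_x absE r x.
Proof.
move=> mr; have n0 : (0 <= n%:R^-1 :> R)%R by rewrite invr_ge0.
have mar : measurable_fun setT (fun x => `|r x|%R) by exact: measurableT_comp.
have Ms : Mplus (fun x => (sum (fun x => `|r x|%R) n x)%:E).
  by apply: Mplus_EFin => [|x]; [exact: measurable_ergodic_sum|exact: ergodic_sum_ge0].
apply: (@le_trans _ _ (\int[mu]_x (n%:R^-1%:E * (sum (fun x => `|r x|%R) n x)%:E))).
  apply: le_int => [||x].
  - by apply: Mplus_absE; exact: measurable_average.
  - exact: MplusZ.
  - rewrite /absE/= -EFinM lee_fin normrM ger0_norm//.
    by apply: ler_wpM2l => //; exact: normr_ergodic_sum.
rewrite intZ//; apply: (@le_trans _ _ (n%:R^-1%:E * (n%:R%:E * (A%:E * \int[mu]_x absE r x)))).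
  by apply: lee_wpmul2l => //; exact: (int_ergodic_sum_le mphi A1 phi_le).
rewrite muleA -EFinM; case: n {n0 Ms} => [|n]; last by rewrite mulVf ?mul1e.
by rewrite mulr0 mul0e mule_ge0 ?lee_fin ?(ltW A0)// int_ge0//; exact: Mplus_absE.
Qed.

Lemma int_limit r : measurable_fun setT r ->
  {ae mu, forall x, cvgn (fun n => avg r n x)} ->
  \int[mu]_x absE (lim r) x <= A%:E * \int[mu]_x absE r x.
Proof.
move=> mr cr; apply: (int_fatou (u_ := fun n => absE (avg r n))).
- by move=> n; apply: Mplus_absE; exact: measurable_average.
- by apply: Mplus_absE; exact: measurable_ergodic_limit.
- apply: filterS cr => x /cvg_ergodic_limit cx; apply: cvgn_EFin.
  exact: cvg_norm.
- by move=> n; exact: int_average.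
Qed.

Definition gauge_ac r : Prop := forall E : nat -> set S,
  (forall k, measurable (E k)) ->
  {ae mu, forall x, (\1_(E k) x : R) @[k --> \oo] --> (0 : R)%R} ->
  p (fun x => absE r x * (\1_(E k) x)%:E) @[k --> \oo] --> 0.

(** The form in which the (ACR) property of the associate space is used; the
argument of the rearrangements is the measure of a set so that the weights can be
compared with its indicator. *)
Definition uniform_tails : Prop := forall eta : R, (0 < eta)%R ->
  exists F, [/\ measurable F, mu F < +oo &
    forall h, H h -> rearr mu h (fine (mu F)) <= eta%:E].

(** A function spread so thinly that it is at most [e] pairs with the head of a
weight like [e] times an indicator, and with its tail like its integral. *)
Lemma gauge_spread u F (e eta : R) : Mplus u -> measurable F -> mu F < +oo ->
  (0 <= e)%R -> (0 <= eta)%R -> (forall x, u x <= e%:E) ->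
  (forall h, H h -> rearr mu h (fine (mu F)) <= eta%:E) ->
  p u <= e%:E * p (fun x => (\1_F x)%:E) + eta%:E * \int[mu]_x u x.
Proof.
move=> Mu mF Ffin e0 eta0 ue tail; apply: gauge_pairing_ub => // h Hh.
have M1 := @Mplus_indic R _ _ F mF.
have := gauge_pairing_ge sH res M1 Hh.
move=> /(lee_wpmul2l (_ : 0 <= e%:E)) => /(_ e0) => p1.
rewrite -integral_rearr//; apply: le_trans (leeD2r _ p1).
pose k t := rearr mu (fun x => (\1_F x)%:E) t * rearr mu h t.
have mk : measurable_fun (`[0%R, +oo[%classic : set R) k.
  by apply: emeasurable_funM; exact: measurable_rearr.
have k0 t : 0 <= k t by rewrite mule_ge0// rearr_ge0.
have mru : measurable_fun (`[0%R, +oo[%classic : set R) (rearr mu u) by exact: measurable_rearr.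
rewrite -[X in _ <= _ * X + _]/(\int[lebesgue_measure]_(t in `[0%R, +oo[) k t).
rewrite -!ge0_integralZl//; last by move=> t _; exact: rearr_ge0.
rewrite -ge0_integralD//; last 4 first.
- by move=> t _; rewrite mule_ge0.
- exact: measurable_funeM.
- by move=> t _; rewrite mule_ge0// rearr_ge0.
- exact: measurable_funeM.
apply: ge0_le_integral => //.
- by move=> t _; rewrite mule_ge0// rearr_ge0.
- by apply: emeasurable_funM; exact: measurable_rearr.
- by apply: emeasurable_funD; exact: measurable_funeM.
move=> t /=; rewrite in_itv/= andbT => t0.
have [tF|Ft] := ltP t%:E (mu F).
  apply: (@le_trans _ _ (e%:E * k t)); last first.
    by rewrite leeDl// mule_ge0// rearr_ge0.
  rewrite /k; apply: lee_pmul; rewrite ?rearr_ge0//; first exact: rearr_le_cst.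
  by rewrite -[leLHS]mul1e lee_wpmul2r ?rearr_ge0// rearr_indic_ge1.
apply: (@le_trans _ _ (eta%:E * rearr mu u t)); last by rewrite leeDr// mule_ge0.
rewrite muleC lee_wpmul2r ?rearr_ge0//; apply: le_trans (tail h Hh).
by apply: rearr_nonincreasing; rewrite -lee_fin fineK// ge0_fin_numE.
Qed.

Lemma cvge0 (u : nat -> \bar R) : (forall n, 0 <= u n) ->
  (forall e : R, (0 < e)%R -> \forall n \near \oo, u n <= e%:E) ->
  u n @[n --> \oo] --> 0.
Proof.
move=> u0 ue; have fin : \forall n \near \oo, u n \is a fin_num.
  apply: filterS (ue 1%R ltr01) => n u1.
  by rewrite ge0_fin_numE//; exact: le_lt_trans (ltry 1%R).
apply: cvg_EFin => //; apply/cvgrPdist_le => e e0.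
have := ue e e0; apply: filterS2 fin => n un ue_.
by rewrite /= sub0r normrN ger0_norm ?fine_ge0// -lee_fin fineK.
Qed.

Lemma cvge0_le (u : nat -> \bar R) (e : R) : u n @[n --> \oo] --> 0 -> (0 < e)%R ->
  \forall n \near \oo, u n <= e%:E.
Proof.
move=> u0 e0; have /u0 un : nbhs 0 [set y : \bar R | y < e%:E].
  by apply: open_nbhs_nbhs; split; [exact: open_ereal_lt_ereal|rewrite /= lte_fin].
by near=> n; apply/ltW; near: n; exact: un.
Unshelve. all: by end_near. Qed.

Context (gfin : forall F, measurable F -> mu F < +oo -> p (fun x => (\1_F x)%:E) < +oo)
  (gac : forall F, measurable F -> mu F < +oo -> gauge_ac \1_F)
  (tails : uniform_tails).

(** For a bounded summable function the differences to the limit live, up to a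
small level, on a set of finite measure where they tend to zero: such a set is
provided by the maximal inequality.  The small part is spread thin. *)
Lemma gauge_cvg_bounded r (b : R) : summable_fun mu r -> (0 <= b)%R ->
  (forall x, `|r x| <= b)%R ->
  p (absE (fun x => avg r n x - lim r x)%R) @[n --> \oo] --> 0.
Proof.
move=> sr b0 rb; have [mr fr] := sr.
have cr := summable_averages_cvg mphi A1 phi_le phi_ge sr.
have mg n : measurable_fun setT (fun x => avg r n x - lim r x)%R.
  by apply: measurable_funB; [exact: measurable_average|exact: measurable_ergodic_limit].
set g := fun n x => (avg r n x - lim r x)%R in mg *.
have Mg n : Mplus (absE (g n)) by exact: (Mplus_absE (mg n)).
apply: cvge0 => [n|e e0]; first exact: (gauge_ge0 sH (Mg n)).
pose I := fine (\int[mu]_x absE r x).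
have IE : \int[mu]_x absE r x = I%:E.
  by rewrite fineK// ge0_fin_numE//; apply: int_ge0; exact: Mplus_absE.
have I0 : (0 <= I)%R by apply: fine_ge0; apply: int_ge0; exact: Mplus_absE.
(* Adding one keeps the divisor positive when [r] vanishes. *)
pose K := (A * I + A * I + 1)%R.
have K0 : (0 < K)%R by rewrite ltr_wpDl// addr_ge0// mulr_ge0// (ltW A0).
have gK n : \int[mu]_x absE (g n) x <= K%:E.
  apply: (@le_trans _ _ (\int[mu]_x (absE (avg r n) x + absE (lim r) x))).
    apply: le_int => // [|x].
      by apply: MplusD; apply: Mplus_absE;
        [exact: measurable_average|exact: measurable_ergodic_limit].
    by rewrite -EFinD lee_fin ler_normB.
  rewrite intD; [|apply: Mplus_absE; exact: measurable_average|
    apply: Mplus_absE; exact: measurable_ergodic_limit].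
  apply: (le_trans (leeD (int_average n mr) (int_limit mr cr))).
  by rewrite IE -!EFinM -EFinD lee_fin /K lerDl.
have e4 : (0 < e / 4)%R by rewrite divr_gt0.
have [F [mF Ffin tail]] := tails (divr_gt0 e4 K0).
pose P := fine (p (fun x => (\1_F x)%:E)).
have M1 := @Mplus_indic R _ _ F mF.
have PE : p (fun x => (\1_F x)%:E) = P%:E.
  by rewrite fineK// ge0_fin_numE ?(gauge_ge0 sH)// gfin.
have P0 : (0 <= P)%R by rewrite fine_ge0// (gauge_ge0 sH).
(* The level of the thinly spread part, chosen so that its pairing with the
   heads of the weights is at most [e / 4]. *)
pose t := (e / 4 / (P + 1))%R.
have t0 : (0 < t)%R by rewrite divr_gt0// ltr_wpDl.
have tP : (t * P <= e / 4)%R.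
  by rewrite /t mulrAC ler_pdivrMr ?ltr_wpDl// ler_pM2l// lerDl.
(* Outside [G] all averages, and so the limit, are at most [t / 2]. *)
pose G := maximal_above phi (fun x => `|r x|%R) (t / 2).
have t20 : (0 < t / 2)%R by rewrite divr_gt0.
have mar : measurable_fun setT (fun x => `|r x|%R) by exact: measurableT_comp.
have mG : measurable G by exact: (measurable_ergodic_above mphi (t / 2) [set n | 0 < n]%N).
have Gfin : mu G < +oo.
  rewrite -(@lte_pmul2l _ (t / 2)%:E)//.
  apply: (le_lt_trans (ergodic_maximal_inequality mphi A1 phi_le phi_ge mar (fun x => normr_ge0 _) t20)).
  by rewrite gt0_muley ?lte_fin// lte_mul_pinfty// lee_fin mulr_ge0// sqr_ge0.
pose E n := G `&` [set x | (t < `|g n x|)%R].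
have mE n : measurable (E n) by apply: measurableI => //; exact: (measurable_large t (mg n)).
have cE : {ae mu, forall x, (\1_(E k) x : R) @[k --> \oo] --> (0 : R)%R}.
  apply: filterS cr => x /cvg_ergodic_limit cx; apply: cvg_near_cst.
  have /cvgrPdist_le/(_ _ t0) := cx; apply: filterS => n.
  rewrite distrC => gt; rewrite indicE memNset// => -[_ /=]; apply/negP.
  by rewrite -leNgt.
have pE := gac mG Gfin mE cE.
have c0 : (0 < e / 2 / (b + b + 1))%R by rewrite divr_gt0 ?divr_gt0// ltr_wpDl// addr_ge0.
have := cvge0_le pE c0; apply: filterS => n pEn.
have ME : Mplus (fun x => absE \1_G x * (\1_(E n) x : R)%:E).
  have Ma : Mplus (absE (\1_G : S -> R)) by exact: Mplus_absE.
  exact: (MplusM Ma (@Mplus_indic R _ S _ (mE n))).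
have bb0 : (0 <= b + b)%R by rewrite addr_ge0.
have Mt : Mplus (fun x => mine (absE (g n) x) t%:E).
  by apply: Mplus_min => //; apply: Mplus_cst; rewrite lee_fin ltW.
apply: (@le_trans _ _ (p (fun x => (b + b)%:E * (absE \1_G x * (\1_(E n) x)%:E) +
    mine (absE (g n) x) t%:E))).
  apply: (gauge_mono sH (Mg n) (MplusD (MplusZ bb0 ME) Mt)).
  apply: filterS cr => x /cvg_ergodic_limit cx.
  have lb : (`|lim r x| <= b)%R.
    rewrite -(cvg_lim _ (cvg_norm cx))//; apply: limr_le.
      by apply/cvg_ex; eexists; exact: cvg_norm cx.
    by apply: nearW => m; exact: average_bound.
  have gb : (`|g n x| <= b + b)%R.
    apply: (le_trans (ler_normB _ _)); apply: lerD => //; exact: average_bound.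
  have Mx := (MplusZ bb0 ME).2 x.
  have [Gx|Gx] := pselect (G x); last first.
    have at2 m : (`|avg r m x| <= t / 2)%R.
      rewrite /ergodic_average normrM ger0_norm ?invr_ge0//.
      case: m => [|m]; first by rewrite invr0 mul0r ltW.
      rewrite ler_pdivrMl ?ltr0n// mulrC; apply: (le_trans (normr_ergodic_sum _ _ _ _)).
      by rewrite leNgt; apply/negP => /ltW lt; apply: Gx; exists m.+1.
    have lt2 : (`|lim r x| <= t / 2)%R.
      rewrite -(cvg_lim _ (cvg_norm cx))//; apply: limr_le.
        by apply/cvg_ex; eexists; exact: cvg_norm cx.
      by apply: nearW => m; exact: at2.
    have gt : (`|g n x| <= t)%R.
      by rewrite [leRHS]splitr; apply: (le_trans (ler_normB _ _)); apply: lerD.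
    by rewrite min_l; [rewrite leeDr|rewrite lee_fin].
  have [gt|gt] := leP `|g n x|%R t.
    by rewrite min_l; [rewrite leeDr|rewrite lee_fin].
  rewrite /absE !indicE !mem_set//= normr1 !mule1.
  apply: (@le_trans _ _ (b + b)%:E); first by rewrite lee_fin.
  by rewrite leeDl// le_min !lee_fin normr_ge0 ltW.
apply: (le_trans (gaugeD sH (MplusZ bb0 ME) Mt)).
rewrite [leRHS](_ : e%:E = (e / 2)%:E + ((e / 4)%:E + (e / 4)%:E)); last first.
  by rewrite -!EFinD; congr EFin; field.
apply: leeD.
  apply: (le_trans (gaugeZ sH bb0 ME)).
  apply: (@le_trans _ _ ((b + b)%:E * (e / 2 / (b + b + 1))%:E)).
    by apply: lee_wpmul2l; rewrite ?lee_fin.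
  rewrite -EFinM lee_fin mulrCA ler_piMr ?divr_ge0 ?(ltW e0)//.
  by rewrite ler_pdivrMr ?ltr_wpDl// mul1r lerDl.
have tlt x : mine (absE (g n) x) t%:E <= t%:E by rewrite ge_min lexx orbT.
have eta0 : (0 <= e / 4 / K)%R by rewrite ltW// divr_gt0.
apply: (le_trans (gauge_spread Mt mF Ffin (ltW t0) eta0 tlt tail)).
rewrite PE; apply: leeD; first by rewrite -EFinM lee_fin.
apply: (@le_trans _ _ ((e / 4 / K)%:E * K%:E)).
  apply: lee_wpmul2l; first by rewrite lee_fin.
  by apply: le_trans (gK n); apply: le_int => // x; rewrite ge_min lexx.
by rewrite -EFinM divfK// gt_eqF.
Qed.

End gauge_convergence.

Section gauge_convergence_tame.
Context (R : realType) d (S : measurableType d) (mu : {measure set S -> \bar R}).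
Context (phi : S -> S) (mphi : measurable_fun setT phi).
Local Open Scope ereal_scope.
Context (A : R) (A1 : (1 <= A)%R).
Context (phi_le : forall n (E : set S), measurable E ->
    mu (iter n phi @^-1` E) <= A%:E * mu E)
  (phi_ge : forall n (E : set S), measurable E ->
    mu E <= A%:E * mu (iter n phi @^-1` E)).
Context (res : resonant mu) (H : set (S -> \bar R)) (sH : rearr_stable mu H).
Implicit Types (f g r : S -> R) (E F : set S) (u : S -> \bar R).
Local Notation avg := (ergodic_average phi).
Local Notation lim := (ergodic_limit phi).
Local Notation p := (gauge mu H).
Context (gfin : forall F, measurable F -> mu F < +oo -> p (fun x => (\1_F x)%:E) < +oo)
  (gac : forall F, measurable F -> mu F < +oo -> gauge_ac mu H \1_F)
  (tails : uniform_tails mu H).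

Let A0 : (0 < A)%R. Proof. exact: lt_le_trans A1. Qed.

Lemma absE_indic r E x : absE (fun x => r x * \1_E x)%R x = absE r x * (\1_E x : R)%:E.
Proof. by rewrite /absE normrM [X in (_ * X)%R]ger0_norm// indicE. Qed.

(** The parts of [r] where it is very large or very small are negligible in the
gauge, uniformly along the averages; the remaining part is bounded and
supported in a set of finite measure. *)
Theorem gauge_cvg_tame r : tame mu r -> gauge_ac mu H r ->
  p (absE (fun x => avg r n x - lim r x)%R) @[n --> \oo] --> 0.
Proof.
move=> tr acr; have mr := tame_measurable tr.
pose C (k : nat) : set S := [set x | (k.+1%:R^-1 < `|r x|)%R] `&` [set x | (`|r x| <= k.+1%:R)%R].
have k0 (k : nat) : (0 < k.+1%:R^-1 :> R)%R by rewrite invr_gt0.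
have mC k : measurable (C k).
  apply: measurableI; first exact: measurable_large.
  rewrite -[X in measurable X]setTI; apply: measurable_fun_ler => //.
  exact: measurableT_comp.
have mr0 : measurable [set x | (0 < `|r x|)%R] by exact: measurable_large.
pose E (k : nat) : set S := [set x | (0 < `|r x|)%R] `\` C k.
have mE k : measurable (E k) by exact: measurableD.
have cE : {ae mu, forall x, (\1_(E k) x : R) @[k --> \oo] --> (0 : R)%R}.
  apply: aeW => x; apply: cvg_near_cst.
  have [r0|r0] := ltP 0%R `|r x|%R; last first.
    by apply: nearW => k; rewrite indicE memNset// => -[/=]; rewrite ltNge r0.
  have [m] := ltr_add_invr r0; rewrite add0r => mr'.
  exists (maxn m (Num.trunc `|r x|%R)) => // k /=; rewrite geq_max => /andP[mk tk].
  rewrite indicE memNset// => -[_]; apply; split => /=.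
    by apply: le_lt_trans mr'; rewrite lef_pV2 ?posrE ?ltr0n// ler_nat ltnS.
  apply: (@le_trans _ _ (Num.trunc `|r x|%R).+1%:R); first exact/ltW/truncnS_gt.
  by rewrite ler_nat ltnS.
have cr := tame_averages_cvg mphi A1 phi_le phi_ge tr.
have pos n : 0 <= p (absE (fun x => avg r n x - lim r x)%R).
  apply: (gauge_ge0 sH); apply: Mplus_absE; apply: measurable_funB.
    exact: measurable_average.
  exact: measurable_ergodic_limit.
apply: cvge0 => // e e0.
have e4 : (0 < e / 4 / A)%R by rewrite !divr_gt0.
have [k _ /(_ k (leqnn k))/= pk] := cvge0_le (acr E mE cE) e4.
pose r1 x := (r x * \1_(E k) x)%R; pose r2 x := (r x * \1_(C k) x)%R.
have mr1 : measurable_fun setT r1 by exact: measurable_funM.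
have mr2 : measurable_fun setT r2 by exact: measurable_funM.
have rE : r = (r1 \+ r2)%R.
  apply/funext => x; rewrite /r1 /r2 /= -mulrDr.
  have [->|r0] := eqVneq (r x) 0%R; first by rewrite mul0r.
  rewrite !indicE; have [Cx|Cx] := pselect (C k x).
    rewrite memNset; last by move=> [].
    by rewrite mem_set//= add0r mulr1.
  rewrite mem_set; last by split => //=; rewrite normr_gt0.
  by rewrite memNset//= addr0 mulr1.
have s2 : summable_fun mu r2.
  apply: (tame_summable tr) => //.
  apply: le_lt_trans (tame_vanishing tr (k0 k)).
  by apply: le_measure; rewrite ?inE//; [exact: measurable_large|move=> x []].
have b2 x : (`|r2 x| <= k.+1%:R)%R.
  rewrite /r2 normrM indicE; case: (boolP (x \in C k)) => [/set_mem[_ /=]|_].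
    by rewrite normr1 mulr1.
  by rewrite normr0 mulr0.
have c2 := summable_averages_cvg mphi A1 phi_le phi_ge s2.
have r1E : r1 = (r \- r2)%R by apply/funext => x; rewrite rE /= addrK.
have avg1 n x : avg r1 n x = (avg r n x - avg r2 n x)%R by rewrite rE ergodic_averageD addrK.
have c1 : {ae mu, forall x, cvgn (fun n => avg r1 n x)}.
  apply: filterS2 cr c2 => x /cvg_ex[l rl] /cvg_ex[l2 r2l]; apply/cvg_ex.
  exists (l - l2)%R; under eq_fun do rewrite avg1; exact: cvgB.
have limE : {ae mu, forall x, lim r x = (lim r1 x + lim r2 x)%R}.
  apply: filterS2 c1 c2 => x /cvg_ergodic_limit x1 /cvg_ergodic_limit x2.
  apply: ergodic_limitE; rewrite rE; under eq_fun do rewrite ergodic_averageD.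
  exact: cvgD.
have pr1 : p (absE r1) <= (e / 4 / A)%:E.
  by rewrite (_ : absE r1 = fun x => absE r x * (\1_(E k) x : R)%:E)//;
    apply/funext => x; exact: absE_indic.
have e2 : (0 < e / 2)%R by rewrite divr_gt0.
have := cvge0_le (gauge_cvg_bounded mphi A1 phi_le phi_ge res sH gfin gac tails s2 (ler0n _ _) b2) e2.
apply: filterS => n p2.
have M1 : Mplus (absE (avg r1 n)) by apply: Mplus_absE; exact: measurable_average.
have M2 : Mplus (absE (lim r1)) by apply: Mplus_absE; exact: measurable_ergodic_limit.
have M3 : Mplus (absE (fun x => avg r2 n x - lim r2 x)%R).
  by apply: Mplus_absE; apply: measurable_funB;
    [exact: measurable_average|exact: measurable_ergodic_limit].
apply: (@le_trans _ _ (p (fun x => (absE (avg r1 n) x + absE (lim r1) x) +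
    absE (fun x => avg r2 n x - lim r2 x)%R x))).
  apply: (gauge_mono sH).
  - by apply: Mplus_absE; apply: measurable_funB;
      [exact: measurable_average|exact: measurable_ergodic_limit].
  - by apply: MplusD => //; exact: MplusD.
  apply: filterS limE => x limx; rewrite /absE -!EFinD lee_fin limx.
  have -> : avg r n x = (avg r1 n x + avg r2 n x)%R by rewrite avg1 subrK.
  rewrite (_ : _ - _ = (avg r1 n x - lim r1 x) + (avg r2 n x - lim r2 x))%R; last by ring.
  by apply: (le_trans (ler_normD _ _)); rewrite lerD2r ler_normB.
apply: (le_trans (gaugeD sH (MplusD M1 M2) M3)).
rewrite [leRHS](_ : e%:E = ((e / 4)%:E + (e / 4)%:E) + (e / 2)%:E); last first.
  by rewrite -!EFinD; congr EFin; field.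
have h : A%:E * p (absE r1) <= (e / 4)%:E.
  rewrite -lee_pdivlMl//; apply: (le_trans pr1).
  by rewrite -EFinM lee_fin mulrC.
apply: leeD => //; apply: (le_trans (gaugeD sH M1 M2)); apply: leeD.
  by apply: le_trans h; exact: gauge_average.
by apply: le_trans h; exact: gauge_limit.
Qed.

End gauge_convergence_tame.

(** * The function norm as a gauge *)

Section norm_gauge.
Context (R : realType) d (S : measurableType d) (mu : {measure set S -> \bar R}).
Local Open Scope ereal_scope.
Context (rho : (S -> \bar R) -> \bar R) (nrho : banach_function_norm mu rho).
Implicit Types (u h : S -> \bar R).
Local Notation assoc := (associate mu rho).
Local Notation ball := (dual_ball mu rho).

Lemma associate_ge h u : Mplus u -> rho u <= 1 -> \int[mu]_x (h x * u x) <= assoc h.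
Proof. by move=> Mu u1; apply: ereal_sup_ubound; exists u. Qed.

Lemma associate_ub h (b : \bar R) :
  (forall u, Mplus u -> rho u <= 1 -> \int[mu]_x (h x * u x) <= b) -> assoc h <= b.
Proof. by move=> ub; apply: ge_ereal_sup => _ [u [Mu u1] <-]; exact: ub. Qed.

Lemma holder u h : Mplus u -> Mplus h -> rho u < +oo ->
  \int[mu]_x (u x * h x) <= rho u * assoc h.
Proof.
move=> Mu Mh; have := bfn_ge0 nrho Mu; case ru : (rho u) => [a| |]//.
rewrite lee_fin le_eqVlt => /predU1P[a0|a0] _.
  have u0 : {ae mu, forall x, u x = 0} by apply/(bfn_eq0 nrho) => //; rewrite ru -a0.
  rewrite -a0 mul0e.
  apply: (@le_trans _ _ (\int[mu]_x (0 : \bar R))); last by rewrite integral0.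
  apply: le_int_ae; [exact: MplusM|exact: Mplus_cst|].
  by apply: filterS u0 => x ->; rewrite mul0e.
have ai0 : (0 <= a^-1)%R by rewrite invr_ge0 ltW.
have M1 : Mplus (fun x => a^-1%:E * u x) by exact: MplusZ.
rewrite -lee_pdivrMl// -intZ//; last exact: MplusM.
apply: le_trans (associate_ge h M1 _).
  apply: le_int; [by apply: MplusZ => //; exact: MplusM|exact: MplusM|].
  by move=> x; rewrite muleA [leRHS]muleC.
by rewrite (bfn_homogeneous nrho)// ru -EFinM mulVf// gt_eqF.
Qed.

Context (ri : rearrangement_invariant mu rho) (res : resonant mu)
  (sf : sigma_finite [set: S] mu).

(** Resonance lets the rearrangement pass from the weight to the function it is
paired with, where the norm is invariant. *)
Lemma associate_same_rearr h h' : Mplus h -> Mplus h' -> same_rearr mu h' h ->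
  assoc h' <= assoc h.
Proof.
move=> Mh Mh' hh; apply: associate_ub => u Mu u1.
apply: (le_trans (int_le_pairing res Mh' Mu)).
rewrite (_ : rearr_pairing mu h' u = rearr_pairing mu h u); last first.
  by apply: eq_integral => t; rewrite inE/= in_itv/= andbT => t0; rewrite hh.
apply: pairing_ub => // u' Mu' uu'; apply: associate_ge => //.
by rewrite (ri Mu' Mu uu').
Qed.

Lemma dual_ball_stable : rearr_stable mu ball.
Proof.
split.
- exists (fun=> 0); split; first exact: Mplus_cst.
  by apply: associate_ub => u _ _; under eq_integral do rewrite mul0e; rewrite integral0 lee01.
- by move=> h [].
- move=> h h' [Mh h1] Mh' hh; split => //; apply: le_trans h1.
  exact: associate_same_rearr.
Qed.

Lemma gauge_dual_ball u : Mplus u -> gauge mu ball u = rho u.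
Proof.
move=> Mu; apply/le_anti/andP; split; last exact: norm_le_gauge_dual_ball.
have [ru|] := ltP (rho u) +oo; last by rewrite leye_eq => /eqP ->; rewrite leey.
apply: gauge_ub => h [Mh h1]; apply: (le_trans (holder Mu Mh ru)).
by rewrite -[leRHS]mule1; apply: lee_wpmul2l => //; exact: (bfn_ge0 nrho Mu).
Qed.

(** Otherwise the constant one would belong to the associate space without
vanishing at infinity. *)
Lemma associate_cst_infty : mu setT = +oo -> ACR mu assoc ->
  assoc (fun=> 1) = +oo.
Proof.
move=> Sinf acr; apply/eqP; rewrite -leye_eq leNgt; apply/negP => fin.
have c1 : cmod (fun _ : S => 1%R : R[i]) = (fun=> 1).
  by apply/funext => x; rewrite /cmod normr1.
have /acr : bfspace assoc (fun _ : S => 1%R : R[i]).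
  by split; [split; exact: measurable_cst|rewrite /cnorm c1].
rewrite c1 => /(_ [set y | y < 1]) [].
  by apply: open_nbhs_nbhs; split; [exact: open_ereal_lt_ereal|rewrite /= lte01].
move=> T [_ /(_ (Num.max 0 (T + 1))%R)].
rewrite /= lt_max ltrDl ltr01 orbT => /(_ isT).
apply/negP; rewrite -leNgt.
rewrite (_ : (fun=> 1) = (fun x : S => (\1_setT x : R)%:E)); last first.
  by apply/funext => x; rewrite indicE in_setT.
by apply: rearr_indic_ge1 => //; rewrite Sinf ltry.
Qed.

(** On a space of finite measure there are no tails at all.  Otherwise the
constant one has infinite associate norm, so the unit ball contains functions of
arbitrarily large integral, and these can be taken supported in sets of finite
measure; pairing with one of them bounds the tails of all weights at once. *)
Lemma dual_ball_uniform_tails : ACR mu assoc -> uniform_tails mu ball.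
Proof.
move=> acr eta eta0; have sball := dual_ball_stable.
have [Sfin|] := ltP (mu setT) +oo.
  exists setT; split => // h [Mh _].
  rewrite (rearr_eq0 measurableT Mh) ?lee_fin ?(ltW eta0)//.
    by move=> x /(_ I).
  by rewrite fineK// ge0_fin_numE.
rewrite leye_eq => /eqP Sinf; have a1 := associate_cst_infty Sinf acr.
have : eta^-1%:E < assoc (fun=> 1) by rewrite a1 ltry.
move=> /ereal_sup_gt[_ [g [Mg g1] <-]]; under eq_integral do rewrite mul1e.
move=> ig; have /sigma_finiteP[F [TF ndF mF]] := sf.
have MgF n : Mplus (fun x => g x * (\1_(F n) x : R)%:E).
  by apply: MplusM => //; apply: Mplus_indic; exact: (mF n).1.
have [n gn] : exists n, eta^-1%:E < \int[mu]_x (g x * (\1_(F n) x : R)%:E).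
  apply/not_existsP => all; move: ig; apply/negP; rewrite -leNgt.
  apply: (int_fatou MgF Mg) => [|n]; last by rewrite leNgt; exact/negP.
  apply: aeW => x; apply: cvg_near_cst.
  have : [set: S] x by []. rewrite TF => -[k _ Fkx].
  exists k => // m /= km; have /subsetPset := ndF _ _ km => /(_ _ Fkx) Fmx.
  by rewrite indicE mem_set// mule1.
exists (F n); split; [exact: (mF n).1|exact: (mF n).2|move=> h Hh].
set v := (fun x => _) in gn; have Mv : Mplus v := MgF n.
set tau := fine (mu (F n)).
have tauE : tau%:E = mu (F n) by rewrite fineK// ge0_fin_numE//; exact: (mF n).2.
have Mh := stable_Mplus sball Hh.
rewrite -[leRHS]mule1 -lee_pdivrMl//.
apply: (@le_trans _ _ ((\int[mu]_x v x) * rearr mu h tau)).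
  by apply: lee_wpmul2r; [exact: rearr_ge0|exact: ltW].
apply: (@le_trans _ _ (rearr_pairing mu v h)); last first.
  apply: (le_trans (gauge_pairing_ge sball res Mv Hh)).
  rewrite gauge_dual_ball//; apply: le_trans g1; apply: (bfn_lattice nrho) => //.
  apply: aeW => x; rewrite /v indicE; case: (_ \in _); rewrite ?mule1// mule0.
  exact: Mg.2.
rewrite -(integral_rearr res Mv) muleC -ge0_integralZl//; last 3 first.
- exact: measurable_rearr.
- by move=> t _; exact: rearr_ge0.
- exact: rearr_ge0.
apply: ge0_le_integral => //.
- by move=> t _; rewrite mule_ge0// rearr_ge0.
- by apply: measurable_funeM; exact: measurable_rearr.
- by apply: emeasurable_funM; exact: measurable_rearr.
move=> t /=; rewrite in_itv/= andbT => t0; rewrite muleC.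
have [lt|le] := leP t tau.
  by apply: lee_wpmul2l; [exact: rearr_ge0|exact: rearr_nonincreasing].
rewrite (rearr_eq0 (mF n).1 Mv) ?mul0e// ?tauE.
  by move=> x Fx; rewrite /v indicE memNset// mule0.
by rewrite -tauE lee_fin ltW.
Qed.

End norm_gauge.

(** * The seminorms of the topology xi as gauges *)

Section equimeasurable_gauge.
Context (R : realType) d (S : measurableType d) (mu : {measure set S -> \bar R}).
Local Open Scope ereal_scope.
Context (res : resonant mu) (psi : S -> \bar R) (Mpsi : Mplus psi).
Implicit Types (u h : S -> \bar R).

Definition equimeasurable : set (S -> \bar R) :=
  [set h | Mplus h /\ same_rearr mu h psi].
Local Notation p := (gauge mu equimeasurable).

Lemma equimeasurable_stable : rearr_stable mu equimeasurable.
Proof.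
split; first by exists psi; split.
- by move=> h [].
- move=> h h' [Mh hpsi] Mh' hh; split => // t t0; by rewrite hh// hpsi.
Qed.

Lemma gauge_equimeasurable u : Mplus u -> p u = rearr_pairing mu psi u.
Proof.
move=> Mu; have sH := equimeasurable_stable.
rewrite rearr_pairingC; apply/le_anti/andP; split.
  apply: (gauge_pairing_ub sH res Mu) => h [Mh hpsi].
  rewrite le_eqVlt; apply/orP; left; apply/eqP; apply: eq_integral => t.
  by rewrite inE/= in_itv/= andbT => t0; rewrite hpsi.
by apply: (gauge_pairing_ge sH res Mu); split.
Qed.

(** All the weights have the rearrangement of [psi], so a single function has to
be considered. *)
Lemma equimeasurable_uniform_tails : sigma_finite [set: S] mu ->
  rearr mu psi t @[t --> +oo%R] --> 0 -> uniform_tails mu equimeasurable.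
Proof.
move=> /sigma_finiteP[F [TF ndF mF]] psi0 eta eta0.
suff [E [mE Efin ptail]] : exists E, [/\ measurable E, mu E < +oo &
    rearr mu psi (fine (mu E)) <= eta%:E].
  by exists E; split => // h [Mh ->//]; exact: fine_ge0.
have [Sfin|] := ltP (mu setT) +oo.
  exists setT; split => //; rewrite (rearr_eq0 measurableT Mpsi) ?lee_fin ?(ltW eta0)//.
    by move=> x /(_ I).
  by rewrite fineK// ge0_fin_numE.
rewrite leye_eq => /eqP Sinf.
have /psi0[T [_ psiT]] : nbhs 0 [set y : \bar R | y < eta%:E].
  by apply: open_nbhs_nbhs; split; [exact: open_ereal_lt_ereal|rewrite /= lte_fin].
have : mu (F n) @[n --> \oo] --> +oo.
  rewrite -Sinf TF; apply: nondecreasing_cvg_mu => //.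
    by move=> n; exact: (mF n).1.
  by rewrite -TF.
move=> /cvgey_gt/(_ T)[n _ /(_ n (leqnn n))/= Tn].
exists (F n); split; [exact: (mF n).1|exact: (mF n).2|].
apply/ltW/psiT; rewrite -lte_fin fineK// ge0_fin_numE//; exact: (mF n).2.
Qed.

Lemma cvg_measure_setI (B : set S) (E : nat -> set S) : measurable B ->
  mu B < +oo -> (forall k, measurable (E k)) ->
  {ae mu, forall x, (\1_(E k) x : R) @[k --> \oo] --> (0 : R)%R} ->
  mu (B `&` E k) @[k --> \oo] --> 0.
Proof.
move=> mB Bfin mE cE.
have [_ _] : [/\ mu.-integrable setT (fun=> 0 : \bar R),
    \int[mu]_x `|(\1_(B `&` E k) x)%:E - 0| @[k --> \oo] --> 0 &
    \int[mu]_x (\1_(B `&` E k) x)%:E @[k --> \oo] --> \int[mu]_x (0 : \bar R)].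
  apply: (@dominated_convergence _ _ _ mu setT measurableT _ _ (fun x => (\1_B x)%:E)) => //.
  - by move=> k; apply/measurable_EFinP; apply: measurable_indic; exact: measurableI.
  - apply: filterS cE => x cx _; apply: cvgn_EFin.
    rewrite (_ : (fun k => _) = (fun k => \1_B x * \1_(E k) x : R)%R); last first.
      by apply/funext => k; rewrite indicI.
    by rewrite -[0%R](mulr0 (\1_B x : R)); apply: cvgMr.
  - apply/integrableP; split; first exact: (@Mplus_indic R _ _ _ mB).1.
    by under eq_integral do rewrite gee0_abs ?lee_fin//; rewrite int_indic.
  - apply: aeW => x k _; rewrite gee0_abs ?lee_fin// indicI/=.
    by rewrite !indicE; do 2 case: (_ \in _); rewrite ?mulr0 ?mul0r ?mulr1.
rewrite integral0; apply: cvg_trans; apply: near_eq_cvg; apply: nearW => k.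
by rewrite int_indic//; exact: measurableI.
Qed.

(** Dominated convergence on the half-line: a function cut down to sets that
shrink to a null set has rearrangements tending to zero. *)
Lemma equimeasurable_gauge_ac (r : S -> R) : measurable_fun setT r ->
  (forall e : R, (0 < e)%R -> mu [set x | (e < `|r x|)%R] < +oo) ->
  p (absE r) < +oo -> gauge_ac mu equimeasurable r.
Proof.
move=> mr vr pr E mE cE; have Mr := Mplus_absE mr.
pose u k x := absE r x * (\1_(E k) x : R)%:E.
have Mu k : Mplus (u k) by apply: MplusM => //; exact: Mplus_indic.
have ur k x : u k x <= absE r x.
  rewrite /u indicE; case: (_ \in _); rewrite ?mule1// mule0; exact: Mr.2.
pose D : set R := `[0%R, +oo[%classic.
pose g t := rearr mu psi t * rearr mu (absE r) t.
have g0 t : 0 <= g t by rewrite mule_ge0// rearr_ge0.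
have ig : (@lebesgue_measure R).-integrable D g.
  apply/integrableP; split; first by apply: emeasurable_funM; apply: measurable_rearr; exact: measurable_itv.
  under eq_integral do rewrite gee0_abs//.
  by rewrite -[X in X < _]/(rearr_pairing mu psi (absE r)) -gauge_equimeasurable.
rewrite (_ : (fun k => _) = (fun k => rearr_pairing mu psi (u k))); last first.
  by apply/funext => k; rewrite -(gauge_equimeasurable (Mu k)).
have rt t (s : R) : (0 < t)%R -> (0 < s)%R ->
    \forall k \near \oo, rearr mu (u k) t <= s%:E.
  move=> t0 s0; have mB : measurable [set x | (s < `|r x|)%R] by exact: measurable_large.
  have := cvge0_le (cvg_measure_setI mB (vr s s0) mE cE) t0.
  apply: filterS => k kt; apply: rearr_le; first exact: ltW.
  rewrite distrE//; apply: le_trans kt; apply: le_measure; rewrite ?inE//.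
  - exact: measurable_gte.
  - exact: measurableI.
  - move=> x /=; rewrite /u indicE; case: (boolP (x \in E k)) => [/set_mem Ex|_].
      by rewrite mule1 lte_fin.
    by rewrite mule0 lte_fin ltNge ltW.
have gae : {ae @lebesgue_measure R, forall t, D t -> g t \is a fin_num}.
  by apply: integrable_ae ig; exact: measurable_itv.
have t0ae : {ae @lebesgue_measure R, forall t, t != 0%R}.
  exists [set 0%R]; split; [exact: measurable_set1|exact: lebesgue_measure_set1|].
  by move=> t /= /negP; rewrite negbK => /eqP.
have cae : {ae @lebesgue_measure R, forall t, D t ->
    rearr mu psi t * rearr mu (u k) t @[k --> \oo] --> 0}.
  apply: (@filterS2 _ _ (ae_filter_ringOfSetsType _) _ _ _ _ t0ae gae) => t t0 gt Dt.
  have tpos : (0 < t)%R.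
        by rewrite lt_neqAle eq_sym t0; move: Dt; rewrite /D/= in_itv/= andbT.
      have {gt Dt} := gt Dt; rewrite /g; have := rearr_ge0 mu psi t.
      case: (rearr mu psi t) => [c| |]// c0; last first.
        move=> gt; have r0 : rearr mu (absE r) t = 0.
          move: gt; have := rearr_ge0 mu (absE r) t; rewrite le_eqVlt.
          by move=> /predU1P[<-//|rp]; rewrite gt0_mulye.
        apply: cvg_near_cst; apply: nearW => k.
        suff -> : rearr mu (u k) t = 0 by rewrite mule0.
        by apply/le_anti; rewrite rearr_ge0 -r0 rearr_mono.
      move=> _; rewrite -[0](mule0 c%:E); apply: cvgeZl => //.
      apply: cvge0 => [k|e e0]; first exact: rearr_ge0.
      exact: rt.
have [_ _] : [/\ (@lebesgue_measure R).-integrable D (fun=> 0 : \bar R),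
    \int[lebesgue_measure]_(t in D) `|rearr mu psi t * rearr mu (u k) t - 0| @[k --> \oo] --> 0 &
    \int[lebesgue_measure]_(t in D) (rearr mu psi t * rearr mu (u k) t) @[k --> \oo] -->
    \int[lebesgue_measure]_(t in D) (0 : \bar R)].
  apply: (@dominated_convergence _ _ _ lebesgue_measure D _
    (fun k t => rearr mu psi t * rearr mu (u k) t) (fun=> 0) g) => //.
  - exact: measurable_itv.
  - by move=> k; apply: emeasurable_funM; apply: measurable_rearr; exact: measurable_itv.
  - apply: aeW => t k Dt; rewrite gee0_abs ?mule_ge0 ?rearr_ge0//.
    by apply: lee_wpmul2l; [exact: rearr_ge0|exact: rearr_mono].
by rewrite integral0.
Qed.

End equimeasurable_gauge.

(** * Complex functions *)

Section complex_functions.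
Context (R : realType) d (S : measurableType d) (mu : {measure set S -> \bar R}).
Implicit Types (f g : S -> R[i]).

Definition cRe f : S -> R := fun x => complex.Re (f x).
Definition cIm f : S -> R := fun x => complex.Im (f x).

Lemma normc_sqrt (z : R[i]) :
  complex.Re `|z| = Num.sqrt (complex.Re z ^+ 2 + complex.Im z ^+ 2).
Proof. by case: z. Qed.

Lemma Re_le_normc (z : R[i]) : `|complex.Re z| <= complex.Re `|z|.
Proof.
by rewrite normc_sqrt -[leLHS]sqrtr_sqr ler_wsqrtr// lerDl sqr_ge0.
Qed.

Lemma Im_le_normc (z : R[i]) : `|complex.Im z| <= complex.Re `|z|.
Proof.
by rewrite normc_sqrt -[leLHS]sqrtr_sqr ler_wsqrtr// lerDr sqr_ge0.
Qed.

Lemma normc_le_ReIm (z : R[i]) :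
  complex.Re `|z| <= `|complex.Re z| + `|complex.Im z|.
Proof.
rewrite normc_sqrt -[leRHS]ger0_norm ?addr_ge0// -[leRHS]sqrtr_sqr ler_wsqrtr//.
rewrite sqrrD !real_normK ?num_real// addrAC lerDl.
by rewrite mulrn_wge0// mulr_ge0.
Qed.

Lemma Mplus_cmod f : cmeasurable f -> Mplus (cmod f).
Proof.
move=> [mre mim]; split => [|x]; last first.
  by rewrite lee_fin; exact: le_trans (Re_le_normc _).
apply/measurable_EFinP.
under eq_fun do rewrite normc_sqrt.
apply: (measurableT_comp (continuous_measurable_fun (@sqrt_continuous R))).
by apply: measurable_funD; exact: measurable_funX.
Qed.

Lemma absE_Re_le f x : (absE (cRe f) x <= cmod f x)%E.
Proof. by rewrite lee_fin Re_le_normc. Qed.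

Lemma absE_Im_le f x : (absE (cIm f) x <= cmod f x)%E.
Proof. by rewrite lee_fin Im_le_normc. Qed.

Lemma cmod_le f x : (cmod f x <= absE (cRe f) x + absE (cIm f) x)%E.
Proof. by rewrite -EFinD lee_fin normc_le_ReIm. Qed.

Lemma cReB f g : cRe (f \- g) = (cRe f \- cRe g).
Proof. by apply/funext => x; rewrite /cRe /= raddfB. Qed.

Lemma cImB f g : cIm (f \- g) = (cIm f \- cIm g).
Proof. by apply/funext => x; rewrite /cIm /= raddfB. Qed.

Lemma cmeasurableB f g : cmeasurable f -> cmeasurable g -> cmeasurable (f \- g).
Proof.
move=> [fr fi] [gr gi]; split.
  by rewrite -/(cRe (f \- g)) cReB; exact: measurable_funB.
by rewrite -/(cIm (f \- g)) cImB; exact: measurable_funB.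
Qed.

Context (phi : S -> S).

Lemma iter_composition n f x :
  iter n (composition_operator phi) f x = f (iter n phi x).
Proof. by elim: n x => // n IH x; rewrite iterS iterSr /composition_operator/= IH. Qed.

Lemma inv_natC (n : nat) : n%:R^-1 = (n%:R^-1 : R)%:C%C :> R[i].
Proof. by rewrite fmorphV rmorph_nat. Qed.

Lemma Re_ergodic_mean n f x :
  complex.Re (ergodic_mean phi n f x) = ergodic_average phi (cRe f) n x.
Proof.
rewrite /ergodic_mean /ergodic_average inv_natC /ergodic_sum.
under eq_bigr do rewrite iter_composition.
rewrite (_ : \sum_(i < n) cRe f _ = complex.Re (\sum_(i < n) f (iter i phi x))).
  case: (\sum_(i < n) f (iter i phi x)) => a b /=. by rewrite mul0r subr0.
by rewrite raddf_sum.
Qed.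

Lemma Im_ergodic_mean n f x :
  complex.Im (ergodic_mean phi n f x) = ergodic_average phi (cIm f) n x.
Proof.
rewrite /ergodic_mean /ergodic_average inv_natC /ergodic_sum.
under eq_bigr do rewrite iter_composition.
rewrite (_ : \sum_(i < n) cIm f _ = complex.Im (\sum_(i < n) f (iter i phi x))).
  by case: (\sum_(i < n) _) => a b /=; rewrite mul0r addr0.
by rewrite raddf_sum.
Qed.

Lemma cmeasurable_ergodic_mean n f : measurable_fun setT phi ->
  cmeasurable f -> cmeasurable (ergodic_mean phi n f).
Proof.
move=> mphi [mr mi]; split.
  rewrite (_ : (fun x => _) = ergodic_average phi (cRe f) n).
    exact: measurable_average.
  by apply/funext => x; exact: Re_ergodic_mean.
rewrite (_ : (fun x => _) = ergodic_average phi (cIm f) n).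
  exact: measurable_average.
by apply/funext => x; exact: Im_ergodic_mean.
Qed.

Lemma cvg_complex (u : nat -> R[i]) (l : R[i]) :
  (fun n => complex.Re (u n)) @ \oo --> complex.Re l ->
  (fun n => complex.Im (u n)) @ \oo --> complex.Im l ->
  (fun n => u n : R[i]^o) @ \oo --> (l : R[i]^o).
Proof.
move=> cr ci; apply/cvgrPdist_le => /= e e0.
have [er e0'] : e = (complex.Re e)%:C%C /\ 0 < complex.Re e.
  by case: e e0 => a b; rewrite ltcE/= => /andP[/eqP -> ->].
have e2 : 0 < complex.Re e / 2 by rewrite divr_gt0.
have /cvgrPdist_le/(_ _ e2) nr := cr; have /cvgrPdist_le/(_ _ e2) ni := ci.
apply: filterS2 nr ni => n nr ni.
rewrite er.
have -> : `|l - u n| = (complex.Re `|l - u n|)%:C%C by case: (l - u n).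
rewrite lecR; apply: (le_trans (normc_le_ReIm _)).
by rewrite !raddfB [leRHS]splitr; exact: lerD.
Qed.

End complex_functions.

(** * Ergodicity of the composition operator *)

Section composition.
Context (R : realType) d (S : measurableType d) (mu : {measure set S -> \bar R}).
Local Open Scope ereal_scope.
Context (sf : sigma_finite [set: S] mu) (res : resonant mu).
Context (rho : (S -> \bar R) -> \bar R) (nrho : banach_function_norm mu rho)
  (ri : rearrangement_invariant mu rho).
Implicit Types (f g : S -> R[i]).
Local Notation X := (bfspace rho).

Lemma bfspace_Re f : X f -> measurable_fun setT (cRe f) /\ rho (absE (cRe f)) < +oo.
Proof.
move=> [mf ff]; have mr := mf.1; split => //; apply: le_lt_trans ff.
apply: (bfn_lattice nrho); [exact: Mplus_absE|exact: Mplus_cmod|].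
by apply: aeW => x; exact: absE_Re_le.
Qed.

Lemma bfspace_Im f : X f -> measurable_fun setT (cIm f) /\ rho (absE (cIm f)) < +oo.
Proof.
move=> [mf ff]; have mi := mf.2; split => //; apply: le_lt_trans ff.
apply: (bfn_lattice nrho); [exact: Mplus_absE|exact: Mplus_cmod|].
by apply: aeW => x; exact: absE_Im_le.
Qed.

Lemma bfspace_of_parts f : cmeasurable f -> rho (absE (cRe f)) < +oo ->
  rho (absE (cIm f)) < +oo -> X f.
Proof.
move=> mf rf jf; split => //.
have Mr : Mplus (absE (cRe f)) by apply: Mplus_absE; exact: mf.1.
have Mi : Mplus (absE (cIm f)) by apply: Mplus_absE; exact: mf.2.
apply: (@le_lt_trans _ _ (rho (fun x => absE (cRe f) x + absE (cIm f) x))).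
  apply: (bfn_lattice nrho); [exact: Mplus_cmod|exact: MplusD|].
  by apply: aeW => x; exact: cmod_le.
by apply: (le_lt_trans (bfn_subadditive nrho Mr Mi)); exact: lte_add_pinfty.
Qed.

Lemma bfspaceB f g : X f -> X g -> X (f \- g)%R.
Proof.
move=> Xf Xg; have sub (r s : S -> R) : measurable_fun setT r ->
    measurable_fun setT s -> rho (absE r) < +oo -> rho (absE s) < +oo ->
    rho (absE (r \- s)%R) < +oo.
  move=> mr ms rr rs; have Mr := Mplus_absE mr; have Ms := Mplus_absE ms.
  apply: (@le_lt_trans _ _ (rho (fun x => absE r x + absE s x))).
    apply: (bfn_lattice nrho); [|exact: MplusD|].
      by apply: Mplus_absE; exact: measurable_funB.
    by apply: aeW => x; rewrite -EFinD lee_fin ler_normB.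
  by apply: (le_lt_trans (bfn_subadditive nrho Mr Ms)); exact: lte_add_pinfty.
have [mfr fr] := bfspace_Re Xf; have [mfi fi] := bfspace_Im Xf.
have [mgr gr] := bfspace_Re Xg; have [mgi gi] := bfspace_Im Xg.
apply: bfspace_of_parts; first by apply: cmeasurableB; [exact: Xf.1|exact: Xg.1].
  by rewrite cReB; exact: sub.
by rewrite cImB; exact: sub.
Qed.

Lemma norm_locally_summable (r : S -> R) (E : set S) : measurable_fun setT r ->
  rho (absE r) < +oo -> measurable E -> mu E < +oo ->
  summable_fun mu (fun x => r x * \1_E x)%R.
Proof.
move=> mr rr mE Efin; split; first exact: measurable_funM.
have [C rC] := bfn_local_integral nrho mE Efin.
have Mr := Mplus_absE mr.
apply: (@le_lt_trans _ _ (C%:E * rho (absE r))); last first.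
  have := bfn_ge0 nrho Mr; move: rr; case: (rho _) => [a| |]// _ _.
  by rewrite -EFinM ltry.
apply: le_trans (rC _ Mr); rewrite [leRHS]integral_mkcond.
rewrite le_eqVlt; apply/orP; left; apply/eqP; apply: eq_integral => x _.
rewrite patchE indicE; case: (x \in E); first by rewrite mulr1.
by rewrite mulr0 normr0.
Qed.

Lemma bfspace_tame (r : S -> R) f : X f -> measurable_fun setT r ->
  rho (absE r) < +oo -> (forall x, absE r x <= cmod f x) ->
  (forall e : R, (0 < e)%R -> mu [set x | e%:E < cmod f x] < +oo) -> tame mu r.
Proof.
move=> Xf mr rr rf vf; split => // [e e0|E mE Efin]; last exact: norm_locally_summable.
apply: le_lt_trans (vf e e0); apply: le_measure; rewrite ?inE.
- exact: measurable_large.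
- by apply: measurable_gte; apply: Mplus_cmod; exact: Xf.1.
- by move=> x /= ex; apply: lt_le_trans (rf x); rewrite lte_fin.
Qed.

Context (phi : S -> S) (mphi : measurable_fun setT phi).
Context (A : R) (A1 : (1 <= A)%R).
Context (phi_le : forall n (E : set S), measurable E ->
    mu (iter n phi @^-1` E) <= A%:E * mu E)
  (phi_ge : forall n (E : set S), measurable E ->
    mu E <= A%:E * mu (iter n phi @^-1` E)).
Context (vanish : forall f, X f -> forall e : R, (0 < e)%R ->
  mu [set x | e%:E < cmod f x] < +oo).
Local Notation lim := (ergodic_limit phi).

Let A0 : (0 < A)%R. Proof. exact: lt_le_trans A1. Qed.

Definition limit_operator f : S -> R[i] :=
  fun x => (lim (cRe f) x +i* lim (cIm f) x)%C.
Local Notation T := limit_operator.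

Lemma tame_Re f : X f -> tame mu (cRe f).
Proof.
move=> Xf; have [mr rr] := bfspace_Re Xf.
exact: (bfspace_tame Xf mr rr (absE_Re_le f) (vanish Xf)).
Qed.

Lemma tame_Im f : X f -> tame mu (cIm f).
Proof.
move=> Xf; have [mr rr] := bfspace_Im Xf.
exact: (bfspace_tame Xf mr rr (absE_Im_le f) (vanish Xf)).
Qed.

Lemma cmeasurable_limit f : X f -> cmeasurable (T f).
Proof.
move=> Xf; split; first exact: (measurable_ergodic_limit mphi (bfspace_Re Xf).1).
exact: (measurable_ergodic_limit mphi (bfspace_Im Xf).1).
Qed.

Lemma limit_operator_ae f : X f -> ergodic_means_cvg_ae mu phi f (T f).
Proof.
move=> Xf.
have cr := tame_averages_cvg mphi A1 phi_le phi_ge (tame_Re Xf).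
have ci := tame_averages_cvg mphi A1 phi_le phi_ge (tame_Im Xf).
apply: filterS2 cr ci => x /cvg_ergodic_limit xr /cvg_ergodic_limit xi.
apply: cvg_complex.
  by under eq_fun do rewrite Re_ergodic_mean.
by under eq_fun do rewrite Im_ergodic_mean.
Qed.

Lemma limit_operator_linear : linear_on mu X T.
Proof.
move=> a f g Xf Xg.
have rf := tame_averages_cvg mphi A1 phi_le phi_ge (tame_Re Xf).
have jf := tame_averages_cvg mphi A1 phi_le phi_ge (tame_Im Xf).
have rg := tame_averages_cvg mphi A1 phi_le phi_ge (tame_Re Xg).
have jg := tame_averages_cvg mphi A1 phi_le phi_ge (tame_Im Xg).
have rj : {ae mu, forall x, cvgn (fun n => ergodic_average phi (cRe f) n x) /\
    cvgn (fun n => ergodic_average phi (cIm f) n x)}.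
  by apply: filterS2 rf jf => x.
apply: filterS3 rj rg jg => x [/cvg_ergodic_limit xr /cvg_ergodic_limit xi]
  /cvg_ergodic_limit yr /cvg_ergodic_limit yi.
case: a => a b; rewrite /T; apply/eqP; rewrite eq_complex /=; apply/andP; split; apply/eqP.
  apply: ergodic_limitE; rewrite (_ : (fun n => _) = (fun n =>
     (a * ergodic_average phi (cRe f) n x - b * ergodic_average phi (cIm f) n x) +
     ergodic_average phi (cRe g) n x)%R).
    by apply: cvgD => //; apply: cvgB; apply: cvgMr.
  apply/funext => n; rewrite /ergodic_average !mulrA ![(_ * n%:R^-1)%R]mulrC -!mulrA.
  rewrite -mulrBr -mulrDr; congr (_ * _)%R; rewrite /ergodic_sum !mulr_sumr -sumrB -big_split.
  by apply: eq_bigr => i _; rewrite /cRe /cIm; case: (f _) => u v; case: (g _) => u' v'.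
apply: ergodic_limitE; rewrite (_ : (fun n => _) = (fun n =>
   (a * ergodic_average phi (cIm f) n x + b * ergodic_average phi (cRe f) n x) +
   ergodic_average phi (cIm g) n x)%R).
  by apply: cvgD => //; apply: cvgD; apply: cvgMr.
apply/funext => n; rewrite /ergodic_average !mulrA ![(_ * n%:R^-1)%R]mulrC -!mulrA.
rewrite -!mulrDr; congr (_ * _)%R; rewrite /ergodic_sum !mulr_sumr -!big_split.
by apply: eq_bigr => i _; rewrite /cRe /cIm; case: (f _) => u v; case: (g _) => u' v'.
Qed.

Section bounded_for_gauge.
Context (H : set (S -> \bar R)) (sH : rearr_stable mu H).
Local Notation p := (gauge mu H).

(** The real and imaginary parts each cost a factor [A]. *)
Lemma gauge_limit_operator f : X f -> p (cmod (T f)) <= (A + A)%:E * p (cmod f).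
Proof.
move=> Xf; have MTr := Mplus_absE (cmeasurable_limit Xf).1.
have MTi := Mplus_absE (cmeasurable_limit Xf).2.
have Mf := Mplus_cmod Xf.1.
apply: (@le_trans _ _ (p (fun x => absE (lim (cRe f)) x + absE (lim (cIm f)) x))).
  apply: (gauge_mono sH); [exact/Mplus_cmod/cmeasurable_limit|exact: MplusD|].
  by apply: aeW => x; exact: cmod_le.
apply: (le_trans (gaugeD sH MTr MTi)).
rewrite EFinD ge0_muleDl ?lee_fin ?(ltW A0)//.
have part (r : S -> R) : tame mu r -> (forall x, absE r x <= cmod f x) ->
    p (absE (lim r)) <= A%:E * p (cmod f).
  move=> tr rf; have mr := tame_measurable tr.
  have cr := tame_averages_cvg mphi A1 phi_le phi_ge tr.
  apply: (le_trans (gauge_limit mphi A1 phi_le res sH mr cr)).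
  apply: lee_wpmul2l; first by rewrite lee_fin ltW.
  by apply: (gauge_mono sH) => //; [exact: Mplus_absE|exact: aeW].
apply: leeD; apply: part.
- exact: tame_Re.
- exact: absE_Re_le.
- exact: tame_Im.
- exact: absE_Im_le.
Qed.

Lemma gauge_limit_operatorB f g : X f -> X g ->
  p (cmod (T g \- T f)%R) <= (A + A)%:E * p (cmod (g \- f)%R).
Proof.
move=> Xf Xg; have Xgf := bfspaceB Xg Xf.
apply: le_trans (gauge_limit_operator Xgf).
apply: (gauge_mono sH).
- by apply: Mplus_cmod; apply: cmeasurableB; exact: cmeasurable_limit.
- exact/Mplus_cmod/cmeasurable_limit.
have := limit_operator_linear (-1)%R Xf Xg; apply: filterS => x lin.
rewrite (_ : (g \- f)%R = (fun y => -1 * f y + g y)%R).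
  rewrite /cmod lin; suff -> : (T g \- T f)%R x = (-1 * T f x + T g x)%R by [].
  by rewrite mulN1r addrC.
by apply/funext => y; rewrite mulN1r addrC.
Qed.

Lemma gauge_mean_cvg f : X f ->
  (forall F, measurable F -> mu F < +oo -> p (fun x => (\1_F x)%:E) < +oo) ->
  (forall F, measurable F -> mu F < +oo -> gauge_ac mu H \1_F) ->
  uniform_tails mu H -> gauge_ac mu H (cRe f) -> gauge_ac mu H (cIm f) ->
  p (cmod (ergodic_mean phi n f \- T f)%R) @[n --> \oo] --> 0.
Proof.
move=> Xf gfin gac tails acr aci.
have cr := gauge_cvg_tame mphi A1 phi_le phi_ge res sH gfin gac tails (tame_Re Xf) acr.
have ci := gauge_cvg_tame mphi A1 phi_le phi_ge res sH gfin gac tails (tame_Im Xf) aci.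
have mre : measurable_fun setT (cRe f) := Xf.1.1.
have mim : measurable_fun setT (cIm f) := Xf.1.2.
have reE n : cRe (ergodic_mean phi n f \- T f)%R =
    (fun x => ergodic_average phi (cRe f) n x - lim (cRe f) x)%R.
  by rewrite cReB; apply/funext => x; rewrite /= /cRe Re_ergodic_mean.
have imE n : cIm (ergodic_mean phi n f \- T f)%R =
    (fun x => ergodic_average phi (cIm f) n x - lim (cIm f) x)%R.
  by rewrite cImB; apply/funext => x; rewrite /= /cIm Im_ergodic_mean.
have mB (r : S -> R) n : measurable_fun setT r ->
    measurable_fun setT (fun x => ergodic_average phi r n x - lim r x)%R.
  by move=> mr; apply: measurable_funB;
    [exact: measurable_average|exact: measurable_ergodic_limit].
have mM n : cmeasurable (ergodic_mean phi n f \- T f)%R.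
  by split; [rewrite -/(cRe _) reE; exact: mB|rewrite -/(cIm _) imE; exact: mB].
apply: cvge0 => [n|e e0]; first by apply: (gauge_ge0 sH); exact: Mplus_cmod.
have e2 : (0 < e / 2)%R by rewrite divr_gt0.
have := cvge0_le cr e2; have := cvge0_le ci e2; apply: filterS2 => n ni nr.
have Mr := Mplus_absE (mB _ n mre); have Mi := Mplus_absE (mB _ n mim).
apply: (@le_trans _ _ (p (fun x => absE (fun x => ergodic_average phi (cRe f) n x - lim (cRe f) x)%R x +
   absE (fun x => ergodic_average phi (cIm f) n x - lim (cIm f) x)%R x))).
  apply: (gauge_mono sH); [exact: Mplus_cmod|exact: MplusD|].
  by apply: aeW => x; rewrite -reE -imE; exact: cmod_le.
apply: (le_trans (gaugeD sH Mr Mi)).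
rewrite [leRHS](_ : e%:E = (e / 2)%:E + (e / 2)%:E); first exact: (leeD nr ni).
by rewrite -EFinD -splitr.
Qed.

End bounded_for_gauge.

Lemma limit_operator_bfspace f : X f -> X (T f).
Proof.
move=> Xf; split; first exact: cmeasurable_limit.
have sball := dual_ball_stable ri res.
have MT := Mplus_cmod (cmeasurable_limit Xf).
rewrite /cnorm -(gauge_dual_ball nrho sf)//.
apply: (le_lt_trans (gauge_limit_operator sball Xf)).
rewrite (gauge_dual_ball nrho sf (Mplus_cmod Xf.1)).
rewrite lte_mul_pinfty// ?lee_fin ?addr_ge0 ?(ltW A0)//; exact: Xf.2.
Qed.

(** By [gauge_limit_operatorB] each seminorm is controlled by itself alone, so one
statement covers the norm topology and the topology xi. *)
Lemma limit_operator_continuous (P : set ((S -> R[i]) -> \bar R)) :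
  (forall q, P q -> exists2 H, rearr_stable mu H &
     forall f, cmeasurable f -> q f = gauge mu H (cmod f)) ->
  continuous_for P X T.
Proof.
move=> PH f Xf q Pq e e0; have [H sH qH] := PH q Pq.
exists [set q]; split; [exact: finite_set1|by move=> _ ->|].
have A20 : (0 < A + A)%R by rewrite addr_gt0.
exists (e / (A + A))%R; first by rewrite divr_gt0.
move=> g Xg /(_ q erefl); have Xgf := bfspaceB Xg Xf.
rewrite (qH _ Xgf.1).
rewrite (qH _ (cmeasurableB (cmeasurable_limit Xg) (cmeasurable_limit Xf))).
move=> lt; apply: (le_lt_trans (gauge_limit_operatorB sH Xf Xg)).
by rewrite -lte_pdivlMl// -EFinM mulrC.
Qed.

End composition.

(** * Functions vanishing at infinity *)

Section vanishing.
Context (R : realType) d (S : measurableType d) (mu : {measure set S -> \bar R}).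
Local Open Scope ereal_scope.
Context (rho : (S -> \bar R) -> \bar R) (nrho : banach_function_norm mu rho)
  (ri : rearrangement_invariant mu rho).
Implicit Types (f g : S -> R[i]).
Local Notation X := (bfspace rho).

Lemma ACR_vanishing f : ACR mu rho -> X f -> forall e : R, (0 < e)%R ->
  mu [set x | e%:E < cmod f x] < +oo.
Proof.
move=> acr Xf e e0; have Mf := Mplus_cmod Xf.1.
have /(acr f Xf)[T [_ fT]] : nbhs 0 [set y : \bar R | y < e%:E].
  by apply: open_nbhs_nbhs; split; [exact: open_ereal_lt_ereal|rewrite /= lte_fin].
have := fT (T + 1)%R; rewrite ltrDl ltr01 => /(_ isT)/ereal_inf_lt[_ [s [s0 sT] <-]].
rewrite lte_fin => se; apply: (@le_lt_trans _ _ (T + 1)%:E); last by rewrite ltry.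
apply: le_trans sT; rewrite distrE//; apply: le_measure; rewrite ?inE; try exact: measurable_gte.
by move=> x /=; apply: lt_trans; rewrite lte_fin.
Qed.

Lemma same_rearr_indic_infinite (E F : set S) : measurable E -> measurable F ->
  mu E = +oo -> mu F = +oo ->
  same_rearr mu (fun x => (\1_E x : R)%:E) (fun x => (\1_F x : R)%:E).
Proof.
move=> mE mF Einf Finf t t0; apply/le_anti/andP; split.
  apply: (@le_trans _ _ 1); first exact: rearr_indic_le1.
  by apply: rearr_indic_ge1; rewrite // Finf ltry.
apply: (@le_trans _ _ 1); first exact: rearr_indic_le1.
by apply: rearr_indic_ge1; rewrite // Einf ltry.
Qed.

(** If [f] exceeded a level on a set of infinite measure, removing from it sets
of finite measure that exhaust the space would not change the norm of its
indicator. *)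
Lemma ac_vanishing f : sigma_finite [set: S] mu -> X f -> ac_norm mu rho f ->
  forall e : R, (0 < e)%R -> mu [set x | e%:E < cmod f x] < +oo.
Proof.
move=> /sigma_finiteP[F [TF ndF mF]] Xf acf e e0; have Mf := Mplus_cmod Xf.1.
set B := [set x | _]; have mB : measurable B by exact: measurable_gte.
rewrite ltNge leye_eq; apply/negP => /eqP Binf.
pose E k := B `\` F k.
have mE k : measurable (E k) by apply: measurableD => //; exact: (mF k).1.
have Einf k : mu (E k) = +oo.
  apply/eqP; rewrite -leye_eq leNgt; apply/negP => Efin.
  have BU : mu B <= mu (F k `|` E k).
    apply: le_measure; rewrite ?inE//; first by apply: measurableU => //; exact: (mF k).1.
    by move=> x Bx; have [Fx|Fx] := pselect (F k x); [left|right].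
  have U2 : mu (F k `|` E k) <= mu (F k) + mu (E k).
    by apply: measureU2 => //; exact: (mF k).1.
  have : mu (F k) + mu (E k) < +oo by rewrite lte_add_pinfty//; exact: (mF k).2.
  by rewrite ltNge -Binf (le_trans BU U2).
have cE : {ae mu, forall x, (\1_(E k) x : R) @[k --> \oo] --> (0 : R)%R}.
  apply: aeW => x; apply: cvg_near_cst.
  have : [set: S] x by []. rewrite TF => -[k _ Fkx].
  exists k => // m /= km; have /subsetPset := ndF _ _ km => /(_ _ Fkx) Fmx.
  by rewrite indicE memNset// => -[].
have M1 (D : set S) : measurable D -> Mplus (fun x => (\1_D x : R)%:E).
  by move=> mD; exact: Mplus_indic.
have rB k : e%:E * rho (fun x => (\1_B x : R)%:E) <=
    rho (fun x => cmod f x * (\1_(E k) x : R)%:E).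
  have -> : rho (fun x => (\1_B x : R)%:E) = rho (fun x => (\1_(E k) x : R)%:E).
    by apply: ri; [exact: M1|exact: M1|exact: same_rearr_indic_infinite].
  rewrite -(bfn_homogeneous nrho) ?(ltW e0)//; last exact: M1.
  apply: (bfn_lattice nrho).
  - by apply: MplusZ; [exact: ltW|exact: M1].
  - by apply: MplusM => //; exact: M1.
  apply: aeW => x; rewrite indicE; case: (boolP (x \in E k)) => [/set_mem[Bx _]|_].
    by rewrite !mule1 ltW.
  by rewrite !mule0.
have r0 : rho (fun x => (\1_B x : R)%:E) = 0.
  apply/le_anti; rewrite (bfn_ge0 nrho (M1 B mB)) andbT.
  rewrite -(@lee_pmul2l _ e%:E)// mule0.
  by rewrite -(cvg_lim _ (acf E mE cE))//; apply: lime_ge;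
    [apply/cvg_ex; exists 0; exact: acf|exact: nearW].
have /(bfn_eq0 nrho (M1 B mB)) [N [mN N0 BN]] := r0.
have : mu B <= mu N.
  apply: le_measure; rewrite ?inE//; move=> x Bx; apply: BN => /=.
  rewrite indicE mem_set//= => -[] /eqP; rewrite oner_eq0//.
by rewrite N0 Binf.
Qed.

End vanishing.

(** * Absolute continuity and finiteness of the gauges *)

Section instances.
Context (R : realType) d (S : measurableType d) (mu : {measure set S -> \bar R}).
Local Open Scope ereal_scope.

Lemma absolutely_continuous_gauge (rho : (S -> \bar R) -> \bar R)
    (nrho : banach_function_norm mu rho) (sf : sigma_finite [set: S] mu) (r : S -> R) :
  ac_norm_space mu rho -> measurable_fun setT r -> rho (absE r) < +oo ->
  gauge_ac mu (dual_ball mu rho) r.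
Proof.
move=> ac mr rr E mE cE; pose f : S -> R[i] := fun x => (r x)%:C%C.
have cf : cmod f = absE r.
  by apply/funext => x; rewrite /cmod normc_sqrt /= expr0n addr0 sqrtr_sqr.
have Xf : bfspace rho f by split; [split => //; exact: measurable_cst|rewrite /cnorm cf].
have := ac f Xf E mE cE; rewrite cf.
rewrite (_ : (fun k => gauge _ _ _) = (fun k => rho (fun x => absE r x * (\1_(E k) x)%:E)))//.
apply/funext => k; rewrite (gauge_dual_ball nrho sf)//; apply: MplusM; first exact: Mplus_absE.
exact: Mplus_indic.
Qed.

(** Hoelder's inequality, uniformly over the weights, whose associate norms agree
with that of [psi]. *)
Lemma gauge_equimeasurable_fin (rho : (S -> \bar R) -> \bar R)
    (nrho : banach_function_norm mu rho) (ri : rearrangement_invariant mu rho)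
    (res : resonant mu) (psi u : S -> \bar R) : Mplus psi ->
  associate mu rho psi < +oo -> Mplus u -> rho u < +oo ->
  gauge mu (equimeasurable mu psi) u < +oo.
Proof.
move=> Mpsi psifin Mu ufin; apply: (@le_lt_trans _ _ (rho u * associate mu rho psi)).
  apply: gauge_ub => h [Mh hpsi]; apply: (le_trans (holder nrho Mu Mh ufin)).
  apply: lee_wpmul2l; first exact: (bfn_ge0 nrho Mu).
  exact: (associate_same_rearr ri res Mpsi Mh hpsi).
rewrite lte_mul_pinfty//; first exact: (bfn_ge0 nrho Mu).
by rewrite ge0_fin_numE//; exact: (bfn_ge0 nrho Mu).
Qed.

End instances.

(** * Pointwise ergodicity *)

Theorem theorem1p2 (R : realType) (d : measure_display) (S : measurableType d)
  (mu : {measure set S -> \bar R})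
  (mu_sigma_finite : sigma_finite [set: S] mu)
  (mu_resonant : resonant mu)
  (rho : (S -> \bar R) -> \bar R)
  (rho_norm : banach_function_norm mu rho)
  (rho_ri : rearrangement_invariant mu rho)
  (rho'_ACR : ACR mu (associate mu rho))
  (phi : S -> S)
  (phi_measurable : measurable_fun setT phi)
  (phi_bounds : exists2 A : R, 0 < A &
     forall n : nat, (1 <= n)%N -> forall E : set S, measurable E ->
       ((A^-1)%:E * mu E <= mu (iter n phi @^-1` E) /\
        mu (iter n phi @^-1` E) <= A%:E * mu E)%E) :
  (ac_norm_space mu rho ->
     exists T : (S -> R[i]) -> (S -> R[i]),
       mean_ergodic_limit mu rho (norm_topology rho) phi T /\
       forall f, bfspace rho f -> ergodic_means_cvg_ae mu phi f (T f)) /\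
  (~ ac_norm_space mu rho -> ACR mu rho ->
     exists T : (S -> R[i]) -> (S -> R[i]),
       mean_ergodic_limit mu rho (xi_topology mu rho) phi T /\
       forall f, bfspace rho f -> ac_norm mu rho f ->
         ergodic_means_cvg_ae mu phi f (T f)).
Proof.
(* Replacing the constant by a larger one, at least one, covers [n = 0]. *)
have [A0 A0_gt0 bounds] := phi_bounds.
pose A := Num.max A0 1.
have A1 : 1 <= A by rewrite le_max lexx orbT.
have A0A : A0 <= A by rewrite le_max lexx.
have phi_le n (E : set S) : measurable E -> (mu (iter n phi @^-1` E) <= A%:E * mu E)%E.
  case: n => [|n] mE; first by rewrite -[leLHS]mul1e lee_wpmul2r// lee_fin.
  by apply: (le_trans (bounds n.+1 isT E mE).2); rewrite lee_wpmul2r// lee_fin.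
have phi_ge n (E : set S) : measurable E -> (mu E <= A%:E * mu (iter n phi @^-1` E))%E.
  case: n => [|n] mE; first by rewrite -[leLHS]mul1e lee_wpmul2r// lee_fin.
  have mpre : measurable (iter n.+1 phi @^-1` E).
    exact: (measurable_preimage_iter phi_measurable n.+1 mE).
  apply: (@le_trans _ _ (A0%:E * mu (iter n.+1 phi @^-1` E))%E).
    by rewrite -lee_pdivrMl//; exact: (bounds n.+1 isT E mE).1.
  by rewrite lee_wpmul2r// lee_fin.
have sball := dual_ball_stable rho_ri mu_resonant.
have normE f : cmeasurable f -> cnorm rho f = gauge mu (dual_ball mu rho) (cmod f).
  by move=> mf; rewrite (gauge_dual_ball rho_norm mu_sigma_finite)//;
    exact: Mplus_cmod.
have indicE' (F : set S) : measurable F ->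
    absE (\1_F : S -> R) = (fun x => (\1_F x)%:E).
  by move=> mF; apply/funext => x; rewrite /absE ger0_norm// indicE.
split=> [ac|_ acr].
  have vanish f : bfspace rho f -> forall e : R, 0 < e ->
      (mu [set x | e%:E < cmod f x] < +oo)%E.
    by move=> Xf; exact: (ac_vanishing rho_norm rho_ri mu_sigma_finite Xf (ac f Xf)).
  have Pball q : norm_topology rho q -> exists2 H, rearr_stable mu H &
      forall f, cmeasurable f -> q f = gauge mu H (cmod f).
    by move=> ->; exists (dual_ball mu rho).
  exists (limit_operator phi); split; last first.
    by move=> f; exact: (limit_operator_ae rho_norm phi_measurable A1 phi_le phi_ge vanish).
  have XT := limit_operator_bfspace mu_sigma_finite mu_resonant rho_norm rho_ri
    phi_measurable A1 phi_le phi_ge vanish.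
  have cT := limit_operator_continuous mu_resonant rho_norm
    phi_measurable A1 phi_le phi_ge vanish Pball.
  split => //.
    exact: (limit_operator_linear rho_norm phi_measurable A1 phi_le phi_ge vanish).
  move=> f Xf _ ->.
  have [mre rre] := bfspace_Re rho_norm Xf; have [mim rim] := bfspace_Im rho_norm Xf.
  have acg := absolutely_continuous_gauge rho_norm mu_sigma_finite ac.
  have gfin F : measurable F -> (mu F < +oo)%E ->
      (gauge mu (dual_ball mu rho) (fun x => (\1_F x)%:E) < +oo)%E.
    move=> mF Ffin; rewrite (gauge_dual_ball rho_norm mu_sigma_finite); last exact: Mplus_indic.
    exact: (bfn_indic rho_norm).
  rewrite (_ : (fun n => _) = (fun n => gauge mu (dual_ball mu rho)
      (cmod (ergodic_mean phi n f \- limit_operator phi f)))).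
    apply: (gauge_mean_cvg mu_resonant rho_norm phi_measurable A1 phi_le phi_ge vanish sball Xf gfin).
    - move=> F mF Ffin; apply: acg => //; rewrite indicE'//.
      exact: (bfn_indic rho_norm).
    - exact: (dual_ball_uniform_tails rho_norm rho_ri mu_resonant mu_sigma_finite rho'_ACR).
    - exact: acg.
    - exact: acg.
  apply/funext => n; apply: normE; apply: cmeasurableB; last exact: (XT f Xf).1.
  exact: (cmeasurable_ergodic_mean n phi_measurable Xf.1).
have vanish f : bfspace rho f -> forall e : R, 0 < e ->
    (mu [set x | e%:E < cmod f x] < +oo)%E.
  by move=> Xf; exact: (ACR_vanishing acr Xf).
have Pball q : norm_topology rho q -> exists2 H, rearr_stable mu H &
    forall f, cmeasurable f -> q f = gauge mu H (cmod f).
  by move=> ->; exists (dual_ball mu rho).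
have Pxi q : xi_topology mu rho q -> exists2 H, rearr_stable mu H &
    forall f, cmeasurable f -> q f = gauge mu H (cmod f).
  move=> [psi [mpsi _] <-]; exists (equimeasurable mu (cmod psi)).
    exact: (equimeasurable_stable mu (Mplus_cmod mpsi)).
  move=> f mf.
  by rewrite (gauge_equimeasurable mu_resonant (Mplus_cmod mpsi) (Mplus_cmod mf)).
exists (limit_operator phi); split; last first.
  by move=> f Xf _; exact: (limit_operator_ae rho_norm phi_measurable A1 phi_le phi_ge vanish).
have XT := limit_operator_bfspace mu_sigma_finite mu_resonant rho_norm rho_ri
  phi_measurable A1 phi_le phi_ge vanish.
split => //.
- exact: (limit_operator_linear rho_norm phi_measurable A1 phi_le phi_ge vanish).
- exact: (limit_operator_continuous mu_resonant rho_norm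
    phi_measurable A1 phi_le phi_ge vanish Pball).
- exact: (limit_operator_continuous mu_resonant rho_norm
    phi_measurable A1 phi_le phi_ge vanish Pxi).
move=> f Xf _ [psi Xpsi <-].
have Mpsi := Mplus_cmod Xpsi.1.
have sH := equimeasurable_stable mu Mpsi.
have pfin u : Mplus u -> (rho u < +oo)%E ->
    (gauge mu (equimeasurable mu (cmod psi)) u < +oo)%E.
  exact: (gauge_equimeasurable_fin rho_norm rho_ri mu_resonant Mpsi Xpsi.2).
have gfin F : measurable F -> (mu F < +oo)%E ->
    (gauge mu (equimeasurable mu (cmod psi)) (fun x => (\1_F x)%:E) < +oo)%E.
  by move=> mF Ffin; apply: pfin; [exact: Mplus_indic|exact: (bfn_indic rho_norm)].
have acg (r : S -> R) : measurable_fun setT r -> (rho (absE r) < +oo)%E ->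
    (forall e : R, 0 < e -> (mu [set x | (e < `|r x|)%R] < +oo)%E) ->
    gauge_ac mu (equimeasurable mu (cmod psi)) r.
  move=> mr rr vr; apply: (equimeasurable_gauge_ac mu_resonant Mpsi mr vr).
  by apply: pfin => //; exact: Mplus_absE.
rewrite (_ : (fun n => _) = (fun n => gauge mu (equimeasurable mu (cmod psi))
    (cmod (ergodic_mean phi n f \- limit_operator phi f)))); last first.
  apply/funext => n; rewrite (gauge_equimeasurable mu_resonant Mpsi)//.
  apply/Mplus_cmod/cmeasurableB; last exact: (XT f Xf).1.
  exact: (cmeasurable_ergodic_mean n phi_measurable Xf.1).
have tr := tame_Re rho_norm vanish Xf; have ti := tame_Im rho_norm vanish Xf.
apply: (gauge_mean_cvg mu_resonant rho_norm phi_measurable A1 phi_le phi_ge vanish sH Xf gfin).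
- move=> F mF Ffin; apply: acg => //.
    by rewrite indicE'//; exact: (bfn_indic rho_norm).
  move=> e e0; apply: le_lt_trans Ffin; apply: le_measure; rewrite ?inE//.
    exact: measurable_large.
  move=> x /=; rewrite indicE; case: (boolP (x \in F)) => [/set_mem//|_].
  by rewrite normr0 ltNge ltW.
- exact: (equimeasurable_uniform_tails Mpsi mu_sigma_finite (rho'_ACR psi Xpsi)).
- apply: acg; [exact: tame_measurable tr|exact: (bfspace_Re rho_norm Xf).2|].
  exact: tame_vanishing tr.
- apply: acg; [exact: tame_measurable ti|exact: (bfspace_Im rho_norm Xf).2|].
  exact: tame_vanishing ti.
Qed.
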